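(* Let $s\in(0,1)$, let $\Omega\subset\mathbb{R}^d$ be a bounded open Lipschitz domain, and let $\rho_0\in L^\infty(\Omega)$ be nonnegative with $\frac1{|\Omega|}\int_\Omega\rho_0\,dx=1$. Let $\rho$ be a nonnegative smooth solution of the initial-boundary-value problem $$\partial_t\rho=\Delta\rho-\nabla\cdot(\rho\nabla c),\quad-(-\Delta_{\mathrm N})^sc=\rho^*\quad\text{in }\Omega\times(0,\infty),\qquad\partial_n\rho=0,\ \partial_nc=0\ \text{on }\partial\Omega\times(0,\infty),\qquad\rho(\cdot,0)=\rho_0 .$$ Then the following free energy identity holds for all $t\ge0$: $$\frac{\mathrm d}{\mathrm dt}E(\rho)=-\int_\Omega\rho\,|\nabla(\log\rho-c)|^2\,dx\le0 .$$
   Context: $\rho^*:=\rho-\frac1{|\Omega|}\int_\Omega\rho\,dx$. Spectral fractional Neumann Laplacian: with eigenvalues $0=\lambda_0<\lambda_1\le\lambda_2\le\cdots$ of the Neumann Laplacian on $\Omega$ and $L^2(\Omega)$-orthonormal eigenfunctions $\psi_k$, $(-\Delta_{\mathrm N})^su:=\sum_{k\ge1}\lambda_k^su_k\psi_k$, $u_k=\int_\Omega u\psi_k\,dx$, for zero-mean $u$ with $\sum_{k\ge1}\lambda_k^su_k^2<\infty$; thus $c=-(-\Delta_{\mathrm N})^{-s}\rho^*$ has zero mean. Energy: $G(r):=r(\log r-1)+1$ for $r>0$, $G(0):=1$, and $E(\rho):=\int_\Omega G(\rho)\,dx-\frac12\int_\Omega c\,\rho\,dx=\int_\Omega G(\rho)\,dx-\frac12\int_\Omega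 c\,\rho^*\,dx$. ''Smooth solution'' means that $\rho$ and $c$ (and all expressions involving them in the statement, in particular $\log\rho$) have the regularity needed for these expressions to be classically meaningful on $\overline\Omega\times[0,\infty)$. *)

(* Defs.v *)
From HB Require Import structures.
From mathcomp Require Import all_boot all_order all_algebra.
From mathcomp Require Import all_classical all_reals all_analysis.

Set Implicit Arguments.
Unset Strict Implicit.
Unset Printing Implicit Defensive.

Import Order.TTheory GRing.Theory Num.Theory.
Import numFieldNormedType.Exports.

Local Open Scope classical_set_scope.
Local Open Scope ring_scope.

(* The product sigma-algebra on R^n, generated by the coordinates as in the
   library's instance for [n.-tuple T]. *)
Section measurable_rV.
Context {R : realType}.
Variable n : nat.

Let coords (i : 'I_n) (x : 'rV[R]_n) : measurableTypeR R := x 0 i.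

Let rV_set0 : g_sigma_preimage coords set0.
Proof. exact: sigma_algebra0. Qed.

Let rV_setC A : g_sigma_preimage coords A -> g_sigma_preimage coords (~` A).
Proof. exact: sigma_algebraC. Qed.

Let rV_bigcup (F : (set 'rV[R]_n)^nat) :
  (forall i, g_sigma_preimage coords (F i)) ->
  g_sigma_preimage coords (\bigcup_i (F i)).
Proof. exact: sigma_algebra_bigcup. Qed.

HB.instance Definition _ := @isMeasurable.Build default_measure_display
  'rV[R]_n (g_sigma_preimage coords) rV_set0 rV_setC rV_bigcup.

Lemma measurable_coord (i : 'I_n) :
  measurable_fun [set: 'rV[R]_n] (fun x : 'rV[R]_n => x 0 i : measurableTypeR R).
Proof.
move=> _ Y mY; rewrite setTI; apply: sub_sigma_algebra => /=.
rewrite -bigcup_seq/=; exists i => /=; first by rewrite mem_index_enum.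
by exists Y => //; rewrite setTI.
Qed.

Lemma measurable_fun_rV d (T : measurableType d) (f : T -> 'rV[R]_n) :
  (forall i, measurable_fun [set: T] (fun t => f t 0 i : measurableTypeR R)) ->
  measurable_fun [set: T] f.
Proof.
move=> mf _ A mA; rewrite setTI.
suff : preimage_set_system [set: T] f (g_sigma_preimage coords) `<=` measurable.
  by apply; exists A => //; rewrite setTI.
rewrite -g_sigma_preimage_comp; apply: smallest_sub.
  exact: sigma_algebra_measurable.
rewrite -bigcup_seq/=; apply: bigcup_sub => i _ _ [B mB <-].
exact: mf.
Qed.

End measurable_rV.

Section lebesgue_measure_rV.
Context {R : realType}.
Local Notation leb1 := (@lebesgue_measure R).

Definition consv n (p : measurableTypeR R * 'rV[R]_n) : 'rV[R]_n.+1 :=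
  row_mx (p.1%:M : 'rV[R]_1) p.2.

Definition unconsv n (x : 'rV[R]_n.+1) : measurableTypeR R * 'rV[R]_n :=
  (x 0 0, \row_i x 0 (lift 0 i)).

Lemma consvE0 n p : @consv n p 0 0 = p.1.
Proof.
rewrite /consv (_ : 0 = lshift n (0 : 'I_1)); last exact: val_inj.
by rewrite (row_mxEl (p.1%:M : 'rV[R]_1)) mxE eqxx.
Qed.

Lemma consvElift n p i : @consv n p 0 (lift 0 i) = p.2 0 i.
Proof.
rewrite /consv (_ : lift 0 i = rshift 1 i); last exact: val_inj.
by rewrite (row_mxEr (p.1%:M : 'rV[R]_1)).
Qed.

Lemma measurable_consv n : measurable_fun [set: _] (@consv n).
Proof.
apply: measurable_fun_rV => i.
have [j ->|->] := unliftP 0 i.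
  under eq_fun do rewrite consvElift.
  exact: (measurableT_comp (measurable_coord j) measurable_snd).
by under eq_fun do rewrite consvE0; exact: measurable_fst.
Qed.

Lemma measurable_unconsv n : measurable_fun [set: _] (@unconsv n).
Proof.
apply: measurable_fun_pair; first exact: measurable_coord.
apply: measurable_fun_rV => i; under eq_fun do rewrite mxE.
exact: measurable_coord.
Qed.

Lemma consvK n : cancel (@consv n) (@unconsv n).
Proof.
move=> [a v]; rewrite /unconsv consvE0; congr pair.
by apply/rowP => i; rewrite mxE consvElift.
Qed.

(* Iterated integration: |A| = \int |{y : (x, y) \in A}| dx, and the point has
   mass 1 in dimension 0. *)
Fixpoint lebesgue_rV n : set 'rV[R]_n -> \bar R :=
  match n return set 'rV[R]_n -> \bar R with
  | 0 => dirac (0 : 'rV[R]_0)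
  | m.+1 => fun A =>
      (\int[leb1]_x lebesgue_rV [set y : 'rV[R]_m | A (consv (x, y))])%E
  end.

Let pushconsv n (m : {sigma_finite_measure set 'rV[R]_n -> \bar R}) :
  {measure set 'rV[R]_n.+1 -> \bar R} :=
  measure_function_pushforward__canonical__measure_function_Measure
    (leb1 \x m)%E (@measurable_consv n).

Let prod_sigma_finite d1 d2 (T1 : measurableType d1) (T2 : measurableType d2)
    (m1 : {sigma_finite_measure set T1 -> \bar R})
    (m2 : {sigma_finite_measure set T2 -> \bar R}) :
  sigma_finite setT (m1 \x m2)%E.
Proof.
have /sigma_finiteP[F [TF ndF Foo]] := sigma_finiteT m1.
have /sigma_finiteP[G [TG ndG Goo]] := sigma_finiteT m2.
exists (fun n => F n `*` G n).
  rewrite -setXTT TF TG predeqE => -[x y]; split.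
    move=> [/= [n _ Fnx] [k _ Gky]]; exists (maxn n k) => //; split.
    - by move: x Fnx; exact/subsetPset/ndF/leq_maxl.
    - by move: y Gky; exact/subsetPset/ndG/leq_maxr.
  by move=> [n _ []/= ? ?]; split; exists n.
move=> k; have [? ?] := Foo k; have [? ?] := Goo k.
split; first exact: measurableX.
by rewrite product_measure1E// lte_mul_pinfty// ge0_fin_numE.
Qed.

Let pushconsv_sigma_finite n (m : {sigma_finite_measure set 'rV[R]_n -> \bar R}) :
  sigma_finite setT (pushconsv m).
Proof.
have [F FT mF] := prod_sigma_finite leb1 m.
exists (fun k => @unconsv n @^-1` F k).
  by rewrite -preimage_bigcup -FT preimage_setT.
move=> k; split.
  by rewrite -[X in measurable X]setTI; apply: measurable_unconsv => //; exact: (mF k).1.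
rewrite /= /pushforward (_ : _ @^-1` _ = F k); first exact: (mF k).2.
by apply/seteqP; split => p /=; rewrite consvK.
Qed.

Lemma lebesgue_rV_sigma_finite_measure n :
  exists m : {sigma_finite_measure set 'rV[R]_n -> \bar R},
    @lebesgue_rV n = m :> (set _ -> _).
Proof.
elim: n => [|n [m mE]]; first by exists (dirac (0 : 'rV[R]_0)).
have E : @lebesgue_rV n.+1 = pushconsv m.
  apply/funext => A /=; rewrite /pushforward /product_measure1.
  apply: eq_integral => x _ /=; rewrite mE; congr (m _).
  by apply/seteqP; split => y; rewrite /xsection/= in_setE.
pose h1 := isSFinite.Build _ _ _ (pushconsv m : set _ -> _)
  (sfinite_measure_sigma_finite (pushconsv_sigma_finite m)).
pose h2 := isSigmaFinite.Build _ _ _ (pushconsv m : set _ -> _)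
  (pushconsv_sigma_finite m).
pose M : {sigma_finite_measure set 'rV[R]_n.+1 -> \bar R} :=
  HB.pack (Measure.sort (pushconsv m)) (Measure.class (pushconsv m)) h1 h2.
by exists M.
Qed.

Section instance.
Variable n : nat.
Let m := sval (cid (lebesgue_rV_sigma_finite_measure n)).
Let mE : @lebesgue_rV n = m := svalP (cid (lebesgue_rV_sigma_finite_measure n)).

Let leb0 : @lebesgue_rV n set0 = 0%E.
Proof. by rewrite mE measure0. Qed.
Let leb_ge0 A : (0 <= @lebesgue_rV n A)%E.
Proof. by rewrite mE measure_ge0. Qed.
Let leb_sigma_additive : semi_sigma_additive (@lebesgue_rV n).
Proof. by rewrite mE; exact: measure_semi_sigma_additive. Qed.

HB.instance Definition _ := isMeasure.Build _ _ _ (@lebesgue_rV n)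
  leb0 leb_ge0 leb_sigma_additive.

Let leb_sigma_finite : sigma_finite setT (@lebesgue_rV n).
Proof. by rewrite mE; exact: sigma_finiteT. Qed.

HB.instance Definition _ := Measure_isSigmaFinite.Build _ _ _ (@lebesgue_rV n)
  leb_sigma_finite.
End instance.
End lebesgue_measure_rV.

Arguments lebesgue_rV {R} n _.

Section euclidean.
Context {R : realType} {d : nat}.
Local Notation E := 'rV[R]_d.
Implicit Types (Omega : set E) (u f : E -> R).

Definition dotv (x y : E) : R := \sum_i x 0 i * y 0 i.

(* The norm [`|x|] of ['rV[R]_d] is the sup norm, hence this one. *)
Definition enorm (x : E) : R := Num.sqrt (dotv x x).

Definition evec (i : 'I_d) : E := delta_mx 0 i.

Definition pderiv (i : 'I_d) u (x : E) : R := 'D_(evec i) u x.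

Definition grad u (x : E) : E := \row_i pderiv i u x.

Definition divergence (F : E -> E) (x : E) : R := \sum_i pderiv i (fun y => F y 0 i) x.

Definition laplacian u (x : E) : R := divergence (grad u) x.

(* Near x0, Omega is the open hypograph of a Lipschitz function in the
   orthonormal frames of R^d whose last vector is e: phi is a function on the
   hyperplane e^\perp, extended to R^d as a constant along e. *)
Definition lipschitz_graph_at Omega (x0 e : E) (phi : E -> R) :=
  [/\ enorm e = 1,
      forall y a, phi (y + a *: e) = phi y,
      exists L, forall y z, `|phi y - phi z| <= L * enorm (y - z) &
      \forall y \near x0, Omega y <-> dotv y e < phi y].

(* The boundary of an open set. *)
Definition boundary Omega := closure Omega `\` Omega.

Record bounded_lipschitz_domain Omega : Prop := {
  domain_nonempty : Omega !=set0 ;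
  domain_open : open Omega ;
  domain_connected : connected Omega ;
  domain_bounded : bounded_set Omega ;
  domain_lipschitz : forall x0, boundary Omega x0 ->
    exists e phi, lipschitz_graph_at Omega x0 e phi }.

(* The normal of the graph {y | y.e = phi y}, at the boundary points where the
   graph has a tangent hyperplane (almost all of them, by Rademacher). *)
Definition outer_normal Omega (x0 n : E) :=
  boundary Omega x0 /\ exists e phi,
    [/\ lipschitz_graph_at Omega x0 e phi, differentiable phi x0 &
        n = (enorm (e - grad phi x0))^-1 *: (e - grad phi x0)].

(* \partial_n u = 0 on the boundary; the gradient there is the limit of the
   gradient from inside Omega. *)
Definition neumann_condition Omega u :=
  forall x0 n, outer_normal Omega x0 n ->
    dotv (grad u x) n @[x --> within Omega (nbhs x0)] --> (0 : R).

Local Notation mu := (lebesgue_rV d).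

Definition in_Lp Omega (p : \bar R) u := u \_ Omega \in Lfun mu p.

Definition average Omega u : R :=
  (fine (mu Omega))^-1 * (\int[mu]_(x in Omega) u x)%R.

(* u^* = u - |Omega|^-1 \int_Omega u *)
Definition mean_free Omega u (x : E) : R := u x - average Omega u.

Definition inner Omega u v : R := (\int[mu]_(x in Omega) (u x * v x))%R.

Definition iter_pderiv (s : seq 'I_d) u : E -> R := foldr pderiv u s.

Record test_function Omega (phi : E -> R) : Prop := {
  test_derivable : forall s i x, derivable (iter_pderiv s phi) x (evec i) ;
  test_continuous : forall s, continuous (iter_pderiv s phi) ;
  test_support : exists K, [/\ compact K, K `<=` Omega &
    forall x, ~ K x -> phi x = 0] }.

(* u \in H^1(Omega), with weak gradient g *)
Record H1_with_gradient Omega u (g : E -> E) : Prop := {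
  H1_L2 : in_Lp Omega 2%:E u ;
  H1_gradient_L2 : forall i, in_Lp Omega 2%:E (fun x => g x 0 i) ;
  H1_by_parts : forall phi i, test_function Omega phi ->
    inner Omega u (pderiv i phi) = - inner Omega (fun x => g x 0 i) phi }.

Definition neumann_eigenfunction Omega (lambda : R) u :=
  exists2 g, H1_with_gradient Omega u g &
  forall v h, H1_with_gradient Omega v h ->
    (\int[mu]_(x in Omega) dotv (g x) (h x))%R = lambda * inner Omega u v.

(* The full list of eigenvalues with multiplicities: completeness in L^2 says
   that no eigenfunction is left out. *)
Record neumann_spectrum Omega (lambda : nat -> R) (psi : nat -> E -> R)
    : Prop := {
  spectrum_0 : lambda 0 = 0 ;
  spectrum_1 : 0 < lambda 1 ;
  spectrum_nondecreasing : nondecreasing_seq lambda ;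
  spectrum_eigen : forall k, neumann_eigenfunction Omega (lambda k) (psi k) ;
  spectrum_orthonormal : forall j k,
    inner Omega (psi j) (psi k) = (j == k)%:R ;
  spectrum_complete : forall u, in_Lp Omega 2%:E u ->
    (forall k, inner Omega u (psi k) = 0) ->
    {ae mu, forall x, Omega x -> u x = 0} }.

(* (-Delta_N)^s u = f, for f in L^2. The series defining (-Delta_N)^s u is
   summed in L^2: as f is in L^2 this is the same as its convergence to f in
   the dual of the form domain. *)
Record frac_neumann_laplacian Omega (lambda : nat -> R) (psi : nat -> E -> R)
    (s : R) u f : Prop := {
  frac_L2 : in_Lp Omega 2%:E u ;
  frac_mean_zero : (\int[mu]_(x in Omega) u x)%R = 0 ;
  frac_domain : cvgn (fun n =>
    \sum_(1 <= k < n) lambda k `^ s * inner Omega u (psi k) ^+ 2) ;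
  frac_rhs_L2 : in_Lp Omega 2%:E f ;
  frac_series : (\int[mu]_(x in Omega)
    (f x - \sum_(1 <= k < n) lambda k `^ s * inner Omega u (psi k) * psi k x)
      ^+ 2)%R @[n --> \oo] --> (0 : R) }.

Definition continuous_up_to_closure (D : set (E * R)) (f : E * R -> R) :=
  exists2 g : E * R -> R, {within closure D, continuous g} &
    forall p, D p -> f p = g p.

(* u is C^2 in space up to the boundary, jointly continuously in time *)
Record C2_space Omega (u : E -> R -> R) : Prop := {
  C2_continuous : {within closure Omega `*` [set t | 0 <= t],
    continuous (fun p : E * R => u p.1 p.2)} ;
  C2_derivable1 : forall i x t, Omega x -> 0 <= t ->
    derivable (u^~ t) x (evec i) ;
  C2_continuous1 : forall i,
    continuous_up_to_closure (Omega `*` [set t | 0 <= t])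
      (fun p => pderiv i (u^~ p.2) p.1) ;
  C2_derivable2 : forall i j x t, Omega x -> 0 <= t ->
    derivable (pderiv i (u^~ t)) x (evec j) ;
  C2_continuous2 : forall i j,
    continuous_up_to_closure (Omega `*` [set t | 0 <= t])
      (fun p => pderiv j (pderiv i (u^~ p.2)) p.1) }.

(* u has a time derivative, continuous up to the boundary and to time 0 *)
Record C1_time Omega (u : E -> R -> R) : Prop := {
  C1_derivable : forall x t, Omega x -> 0 < t -> derivable (u x) t 1 ;
  C1_continuous : continuous_up_to_closure (Omega `*` [set t | 0 < t])
    (fun p => 'D_1 (u p.1) p.2) }.

Record smooth_solution Omega (lambda : nat -> R) (psi : nat -> E -> R) (s : R)
    (rho0 : E -> R) (rho c : E -> R -> R) : Prop := {
  sol_rho_space : C2_space Omega rho ;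
  sol_rho_time : C1_time Omega rho ;
  sol_c_space : C2_space Omega c ;
  (* log rho has to be meaningful up to the boundary and to time 0 *)
  sol_rho_pos : forall x t, closure Omega x -> 0 <= t -> 0 < rho x t ;
  sol_evolution : forall x t, Omega x -> 0 < t ->
    'D_1 (rho x) t =
      laplacian (rho^~ t) x - divergence (fun y => rho y t *: grad (c^~ t) y) x ;
  sol_potential : forall t, 0 < t ->
    frac_neumann_laplacian Omega lambda psi s (c^~ t)
      (fun x => - mean_free Omega (rho^~ t) x) ;
  sol_rho_neumann : forall t, 0 < t -> neumann_condition Omega (rho^~ t) ;
  sol_c_neumann : forall t, 0 < t -> neumann_condition Omega (c^~ t) ;
  sol_initial : {ae mu, forall x, Omega x -> rho x 0 = rho0 x} }.

Definition entropy (r : R) : R := if r == 0 then 1 else r * (ln r - 1) + 1.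

Definition energy Omega (u c : E -> R) : R :=
  (\int[mu]_(x in Omega) entropy (u x))%R
  - 2^-1 * (\int[mu]_(x in Omega) (c x * u x))%R.

Definition dissipation Omega (u c : E -> R) : R :=
  (\int[mu]_(x in Omega)
    (u x * enorm (grad (fun y => ln (u y) - c y) x) ^+ 2))%R.

End euclidean.

(* Main.v *)
(* The operator (-Delta_N)^s is symmetric, so \int c(t') rho(t) = \int c(t) rho(t')
   for all t, t'.  Hence E(t + h) - E(t) equals the entropy increment minus
   1/2 \int (c(t + h) + c(t)) (rho(t + h) - rho(t)), and as the difference quotients
   of rho and of rho log rho converge uniformly, dE/dt = \int (log rho - c) d_t rho,
   without differentiating c in time.  For t > 0 the divergence theorem for
   (log rho - c) (grad rho - rho grad c), whose normal trace vanishes, turns this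
   into minus the dissipation; both sides are continuous up to t = 0.

   Divergence theorem on a Lipschitz domain, for a C^1 field G tangent to the
   boundary: average over z the integrals over Omega of div (bump_r(. - z) G).
   They vanish when z is at distance > r from the boundary, and the z close to the
   boundary have measure O(r).  There the integral is O(r^(d + 3)), and o(r^(d + 3))
   at the points where the graph of the boundary is eps-close to its tangent plane
   at scale r, because Omega can be replaced by a half-space and G by a constant
   field tangent to it.  By Rademacher's theorem the other points fill an
   arbitrarily small part of the layer, so the average is o(r^(d + 4)), whereas the
   bump has mass of order r^(d + 4).  Rademacher's theorem itself follows from the
   one-dimensional one along lines, and no change of variables other than
   translations is used. *)

Require Import Defs.
From HB Require Import structures.
From mathcomp Require Import all_boot all_order all_algebra.
From mathcomp Require Import all_classical all_reals all_analysis.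
From mathcomp Require Import measurable_realfun lra ring.

Set Implicit Arguments.
Unset Strict Implicit.
Unset Printing Implicit Defensive.

Import Order.TTheory GRing.Theory Num.Theory.
Import numFieldNormedType.Exports.

Local Open Scope classical_set_scope.
Local Open Scope ring_scope.

(** * Lebesgue measure on row vectors *)

(** The normal exists only at almost every boundary point, so the divergence theorem is reached
    without surface integrals. Averaging over the centre [z] replaces them: by Fubini the average is
    the mass of the bump times the integral of div G, because the gradient of the bump has integral
    0. The scaling is critical: the crude bound on the layer is of exactly the same order in r as
    the mass, so a gain is needed at almost every centre of the layer. It is available because the
    set of points that are bad at a fixed scale does not depend on r and is invariant along the
    vertical direction of the chart: its share of a layer of width r has measure at most r times a
    quantity that was made small beforehand. The same invariance transfers differentiability from a
    centre to the boundary point above or below it, where the Neumann condition can be used. In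
    time, the equations are available only for t > 0. The identities are therefore written with
    functions continuous on the closed cylinder, and reach t = 0 by continuity of their
    integrals. *)

Section lebesgue_rV_theory.
Context {R : realType}.
Implicit Type n : nat.
Local Notation leb1 := (@lebesgue_measure R).

Lemma rV_norm_le n (x : 'rV[R]_n) (r : R) : 0 <= r ->
  (`|x| <= r) <-> (forall i, `|x 0 i| <= r).
Proof.
move=> r0; rewrite /Num.norm/= mx_normrE; split=> [h i|h].
  by have [_ /(_ (0, i) isT)] := elimT (bigmax_leP _ _ _ _) h.
by apply/bigmax_leP; split=> //= -[i j] _ /=; rewrite (ord1 i); exact: h.
Qed.

Lemma rV_norm_coord n (x : 'rV[R]_n) i : `|x 0 i| <= `|x|.
Proof. exact: (rV_norm_le _ (normr_ge0 x)).1. Qed.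

Lemma rV_rat_approx n (x : 'rV[R]_n) (e : R) : 0 < e ->
  exists q : 'rV[rat]_n, `|x - map_mx ratr q| <= e.
Proof.
move=> e0.
have /choice[q qP] : forall i, exists q : rat, `|x 0 i - ratr q| <= e.
  move=> i; have : x 0 i - e < x 0 i + e by lra.
  move=> /rat_in_itvoo[q]; rewrite in_itv/= => /andP[h1 h2]; exists q.
  by rewrite ler_norml; apply/andP; split; lra.
exists (\row_i q i); apply/rV_norm_le; first exact: ltW.
by move=> i; rewrite !mxE.
Qed.

(** Closed balls of the sup norm are products of segments, so their volume is explicit and scales
    exactly. *)
Definition cube n (z : 'rV[R]_n) (r : R) : set 'rV[R]_n := [set x | `|x - z| <= r].

Lemma cubeP n (z : 'rV[R]_n) (r : R) x : 0 <= r ->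
  cube z r x <-> (forall i, `|x 0 i - z 0 i| <= r).
Proof.
move=> r0; rewrite /cube/= rV_norm_le//.
by split=> h i; have := h i; rewrite !mxE.
Qed.

Lemma cube_lt0 n (z : 'rV[R]_n) (r : R) : r < 0 -> cube z r = set0.
Proof.
move=> r0; apply/seteqP; split=> x //= /le_lt_trans/(_ r0).
by rewrite ltNge normr_ge0.
Qed.

Lemma measurable_cube n (z : 'rV[R]_n) (r : R) : measurable (cube z r).
Proof.
have [r0|r0] := leP 0 r; last by rewrite cube_lt0.
have -> : cube z r = \bigcap_(i : 'I_n)
   ((fun x : 'rV[R]_n => x 0 i : measurableTypeR R) @^-1`
     `[z 0 i - r, z 0 i + r]).
  apply/seteqP; split => x.
    by move=> /(cubeP _ _ r0) h i _ /=; rewrite in_itv/= -ler_distl.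
  move=> h; apply/cubeP => // i; rewrite ler_distl.
  by have := h i Logic.I; rewrite /= in_itv.
apply: fin_bigcap_measurable => // i _.
by rewrite -[X in measurable X]setTI; apply: measurable_coord => //.
Qed.

(** The sigma-algebra comes from the coordinates and not from the topology. An open set is the union
    of the cubes with rational centre and radius [k.+1%:R^-1] that it contains, and these are
    countably many. *)
Lemma measurable_open_rV n (U : set 'rV[R]_n) : open U -> measurable U.
Proof.
move=> oU.
pose B (p : 'rV[rat]_n * nat) := cube (map_mx ratr p.1 : 'rV[R]_n) p.2.+1%:R^-1.
have -> : U = \bigcup_p (if `[< B p `<=` U >] then B p else set0).
  apply/seteqP; split => [x Ux|x [p _]]; last by case: ifP => // /asboolP; apply.
  have /nbhs_ballP[e/= e0 xe] := open_nbhs_nbhs (conj oU Ux).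
  (* Factor 2: [x] and [y] are both within the radius of the rational centre, hence within twice the
     radius of each other. *)
  have [k ke] : exists k, 2 * k.+1%:R^-1 < e.
    have e20 : 0 < e / 2 by lra.
    near \oo => k; exists k; rewrite -ltr_pdivlMl// mulrC.
    by near: k; exact: near_infty_natSinv_lt (PosNum e20).
  have k0 : 0 < k.+1%:R^-1 :> R by rewrite invr_gt0.
  have [q xq] := rV_rat_approx x k0.
  exists (q, k) => //; case: ifP => // /asboolP; apply => y /= yq; apply: xe.
  rewrite -ball_normE/=.
  rewrite (_ : x - y = x - map_mx ratr q - (y - map_mx ratr q)); last first.
    by rewrite opprB addrA subrK.
  apply: le_lt_trans (ler_normB _ _) _.
  by apply: le_lt_trans (lerD xq yq) _; rewrite -mulr2n -[ltLHS]mulr_natl.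
apply: countable_bigcupT_measurable => // p.
by case: ifP => // _; exact: measurable_cube.
Unshelve. all: end_near. Qed.

Lemma continuous_measurable_rV n (f : 'rV[R]_n -> R) : continuous f ->
  measurable_fun setT f.
Proof.
move=> cf; apply: (measurability _ (RGenOInfty.measurableE R)).
move=> _ [_ [a ->] <-]; rewrite setTI.
by apply: measurable_open_rV; apply: open_comp => //; exact: rray_open.
Qed.

Lemma continuous_in_measurable_rV n (U : set 'rV[R]_n) (f : 'rV[R]_n -> R) :
  open U -> {in U, continuous f} -> measurable_fun U f.
Proof.
move=> oU cf; apply: (measurability _ (RGenOInfty.measurableE R)).
move=> _ [_ [a ->] <-].
apply: measurable_open_rV; rewrite openE => x [Ux fx].
apply: filterI; first exact: open_nbhs_nbhs.
apply: cf; first by rewrite inE.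
by apply: open_nbhs_nbhs; split=> //; exact: rray_open.
Qed.

Lemma measurable_shift1 (a : R) :
  measurable_fun setT (fun x : measurableTypeR R => x + a : measurableTypeR R).
Proof. exact: measurable_funD. Qed.

(** The push-forward by the shift has the right value on half-open intervals, and this characterises
    the Lebesgue measure. *)
Lemma lebesgue_measure_shift (a : R) (A : set R) : measurable A ->
  leb1 [set x | A (x + a)] = leb1 A.
Proof.
move=> mA.
pose m := measure_function_pushforward__canonical__measure_function_Measure
    leb1 (measurable_shift1 a).
rewrite -[LHS]/(m A); symmetry; apply: lebesgue_measure_unique => // X.
move=> /ocitvP[->|[[x y] /= xy ->]]; first by rewrite !measure0.
rewrite [RHS](_ : _ = leb1 `]x - a, y - a]%classic).
  rewrite !lebesgue_measure_itv/= !lte_fin xy ltrD2r xy.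
  by rewrite -!EFinB; congr EFin; ring.
congr (leb1 _); apply/seteqP; split=> z /=; rewrite !in_itv/= => /andP[? ?];
  apply/andP; split; lra.
Qed.

Lemma ge0_integral_shift1 (a : R) (f : R -> \bar R) :
  measurable_fun setT f -> (forall x, 0 <= f x)%E ->
  (\int[leb1]_x f ((x : R) + a)%R = \int[leb1]_x f x)%E.
Proof.
move=> mf f0.
pose m := measure_function_pushforward__canonical__measure_function_Measure
    leb1 (measurable_shift1 a).
transitivity (\int[m]_x f x)%E.
  by rewrite ge0_integral_pushforward//; exact: measurable_shift1.
apply: eq_measure_integral => A mA _; exact: lebesgue_measure_shift.
Qed.

Lemma measurable_shift n (v : 'rV[R]_n) :
  measurable_fun setT (fun x : 'rV[R]_n => x + v).
Proof.
apply: measurable_fun_rV => i; under eq_fun do rewrite mxE.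
by apply: measurable_funD => //; exact: measurable_coord.
Qed.

Lemma consvD n (x a : R) (y v : 'rV[R]_n) :
  consv (x, y) + consv (a, v) = consv (x + a, y + v).
Proof.
apply/rowP => i; rewrite mxE.
by have [j ->|->] := unliftP 0 i; rewrite ?consvElift ?consvE0 //= mxE.
Qed.

Lemma unconsvK n : cancel (@unconsv R n) (@consv R n).
Proof.
move=> x; apply/rowP => i.
by have [j ->|->] := unliftP 0 i; rewrite ?consvElift ?consvE0 //= mxE.
Qed.

Lemma lebesgue_rVS n (A : set 'rV[R]_n.+1) :
  lebesgue_rV n.+1 A =
  (\int[leb1]_x lebesgue_rV n [set y : 'rV[R]_n | A (consv (x, y))])%E.
Proof. by []. Qed.

Lemma measurable_section n (A : set 'rV[R]_n.+1) (x : R) : measurable A ->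
  measurable [set y : 'rV[R]_n | A (consv (x, y))].
Proof.
move=> mA; rewrite -[X in measurable X]setTI.
have := measurableT_comp (@measurable_consv R n)
  (@pair1_measurable _ _ (measurableTypeR R) 'rV[R]_n x).
exact.
Qed.

Lemma measurable_fun_section n (A : set 'rV[R]_n.+1) : measurable A ->
  measurable_fun setT (fun x : R =>
    lebesgue_rV n [set y : 'rV[R]_n | A (consv (x, y))]).
Proof.
move=> mA.
have mA' : measurable (@consv R n @^-1` A).
  by rewrite -[X in measurable X]setTI; exact: measurable_consv.
have := @measurable_fun_xsection _ _ (measurableTypeR R) _ _ (lebesgue_rV n) _ mA'.
congr (measurable_fun _ _); apply/funext => x /=; congr (lebesgue_rV n _).
by apply/seteqP; split => y; rewrite /xsection/= in_setE.
Qed.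

(** Induction on the dimension: the outer integral absorbs the first coordinate of [v] by the
    one-dimensional invariance, the sections absorb the others by induction. *)
Lemma lebesgue_rV_shift n (v : 'rV[R]_n) (A : set 'rV[R]_n) : measurable A ->
  lebesgue_rV n [set x | A (x + v)] = lebesgue_rV n A.
Proof.
elim: n v A => [|n IH] v A mA.
  congr (lebesgue_rV 0 _); apply/seteqP; split=> x /=; by rewrite !thinmx0.
rewrite !lebesgue_rVS -(unconsvK v).
rewrite -[RHS](@ge0_integral_shift1 (unconsv v).1); first last.
- by move=> x; exact: measure_ge0.
- exact: measurable_fun_section.
apply: eq_integral => x _.
rewrite -[RHS](IH (unconsv v).2) //; last exact: measurable_section.
by congr (lebesgue_rV n _); apply/seteqP; split => y /=; rewrite -consvD.
Qed.

Lemma ge0_integral_shift n (v : 'rV[R]_n) (f : 'rV[R]_n -> \bar R) :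
  measurable_fun setT f -> (forall x, 0 <= f x)%E ->
  (\int[lebesgue_rV n]_x f (x + v)%R = \int[lebesgue_rV n]_x f x)%E.
Proof.
move=> mf f0.
pose m := measure_function_pushforward__canonical__measure_function_Measure
    (lebesgue_rV n) (measurable_shift v).
transitivity (\int[m]_x f x)%E.
  by rewrite ge0_integral_pushforward//; exact: measurable_shift.
apply: eq_measure_integral => A mA _; exact: lebesgue_rV_shift.
Qed.

Lemma integral_shift n (v : 'rV[R]_n) (f : 'rV[R]_n -> \bar R) :
  measurable_fun setT f ->
  (\int[lebesgue_rV n]_x f (x + v)%R = \int[lebesgue_rV n]_x f x)%E.
Proof.
move=> mf; rewrite integralE [RHS]integralE; congr (_ - _)%E.
  rewrite -(ge0_integral_shift v (measurable_funepos mf) (funepos_ge0 f)).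
  by apply: eq_integral => x _; rewrite !funeposE.
rewrite -(ge0_integral_shift v (measurable_funeneg mf) (funeneg_ge0 f)).
by apply: eq_integral => x _; rewrite !funenegE.
Qed.

Lemma Rintegral_shift n (v : 'rV[R]_n) (f : 'rV[R]_n -> R) :
  measurable_fun setT f ->
  (\int[lebesgue_rV n]_x f (x + v) = \int[lebesgue_rV n]_x f x)%R.
Proof.
move=> mf; congr fine.
by rewrite -(@integral_shift _ v (EFin \o f))//; exact/measurable_EFinP.
Qed.

(** Induction on the dimension: the section over a first coordinate within [r] of [z 0 0] is a cube
    of the same radius, and the other sections are empty. *)
Lemma lebesgue_rV_cube n (z : 'rV[R]_n) (r : R) : 0 <= r ->
  lebesgue_rV n (cube z r) = ((2 * r) ^+ n)%:E.
Proof.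
move=> r0; elim: n z => [|n IH] z.
  by rewrite expr0 /= diracE mem_set// /cube/= thinmx0 normr0.
rewrite lebesgue_rVS.
pose I := `[z 0 0 - r, z 0 0 + r]%classic.
transitivity (\int[leb1]_(x in I) ((2 * r) ^+ n)%:E)%E.
  rewrite [RHS]integral_mkcond; apply: eq_integral => x _; rewrite patchE.
  case: ifPn => [|/negP]; rewrite inE /I/= in_itv/= -ler_distl => xr.
    rewrite -(IH (unconsv z).2); congr (lebesgue_rV n _).
    apply/seteqP; split => y /=.
      move=> /(cubeP _ _ r0) h; apply/cubeP => // i; rewrite mxE.
      by have := h (lift 0 i); rewrite consvElift.
    move=> /(cubeP _ _ r0) h; apply/cubeP => // i.
    have [j ->|->] := unliftP 0 i; rewrite ?consvElift ?consvE0//=.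
    by have := h j; rewrite mxE.
  rewrite (_ : mkset _ = set0) ?measure0//; apply/seteqP; split => y //=.
  by move=> /(cubeP _ _ r0)/(_ 0); rewrite consvE0.
rewrite integral_cst//; last exact: measurable_itv.
rewrite /I/= lebesgue_measure_itv/= lte_fin.
case: ifPn => h.
  by rewrite -EFinD -EFinM; congr EFin; rewrite exprS; ring.
have -> : r = 0 by apply/eqP; rewrite eq_le r0 andbT; move: h; rewrite -leNgt; lra.
by rewrite mulr0 mule0 expr0n.
Qed.

Lemma lebesgue_rV_cube_lty n (z : 'rV[R]_n) (r : R) :
  (lebesgue_rV n (cube z r) < +oo)%E.
Proof.
have [r0|r0] := leP 0 r; first by rewrite lebesgue_rV_cube// ltry.
by rewrite cube_lt0// measure0.
Qed.

Lemma sub_cube_lty n (z : 'rV[R]_n) (r : R) (A : set 'rV[R]_n) :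
  measurable A -> A `<=` cube z r -> (lebesgue_rV n A < +oo)%E.
Proof.
move=> mA Az; apply: le_lt_trans (lebesgue_rV_cube_lty z r).
by apply: le_measure => //; rewrite inE//; exact: measurable_cube.
Qed.

Lemma lebesgue_measure_itvcc (a b : R) : a <= b ->
  leb1 `[a, b]%classic = (b - a)%:E.
Proof.
move=> ab; rewrite lebesgue_measure_itv/= lte_fin EFinB.
case: ifPn => //; rewrite -leNgt => ba.
have -> : a = b by apply/eqP; rewrite eq_le ab.
by rewrite subee.
Qed.

Lemma measurable_line n (e : 'rV[R]_n) :
  measurable_fun setT (fun p : measurableTypeR R * 'rV[R]_n => p.2 + (p.1 : R) *: e).
Proof.
apply: measurable_fun_rV => i; under eq_fun do rewrite !mxE.
apply: measurable_funD.
  exact: (measurableT_comp (measurable_coord i) measurable_snd).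
by apply: measurable_funM => //; exact: measurable_fst.
Qed.

(* Translation invariance lets the measure of [A] be computed by averaging over
   segments in an arbitrary direction [e], without changing coordinates. *)
Lemma measure_le_lines n (e : 'rV[R]_n) (T M : R) (A K : set 'rV[R]_n) :
  0 <= T -> 0 <= M -> measurable A -> measurable K ->
  (forall x t, 0 <= t <= T -> A (x + t *: e) -> K x) ->
  (forall x, K x -> leb1 [set t : R | 0 <= t <= T /\ A (x + t *: e)]%R <= M%:E)%E ->
  (T%:E * lebesgue_rV n A <= M%:E * lebesgue_rV n K)%E.
Proof.
move=> T0 M0 mA mK AK hM.
pose P := [set p : measurableTypeR R * 'rV[R]_n | 0 <= p.1 <= T /\ A (p.2 + (p.1 : R) *: e)].
have mP : measurable P.
  have -> : P = (`[0, T]%classic `*` setT) `&`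
      ((fun p : measurableTypeR R * 'rV[R]_n => p.2 + (p.1 : R) *: e) @^-1` A).
    by apply/seteqP; split=> -[t x] /=; rewrite in_itv/= => -[]; [split|case].
  apply: measurableI; first by apply: measurableX => //; exact: measurable_itv.
  by rewrite -[X in measurable X]setTI; exact: measurable_line.
(* Tonelli for the indicator of [P]: at fixed [t] the section is a translate of [A]; at fixed [x] it
   has length at most [M] if [K x], and is empty otherwise. *)
have := indic_fubini_tonelli leb1 (lebesgue_rV n) mP.
rewrite indic_fubini_tonelli_FE// indic_fubini_tonelli_GE//= => PE.
have -> : (T%:E * lebesgue_rV n A =
    \int[leb1]_t (lebesgue_rV n \o xsection P) t)%E.
  transitivity (\int[leb1]_(t in `[0%R, T]%classic) lebesgue_rV n A)%E.
    rewrite integral_cst//.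
    by rewrite /= lebesgue_measure_itvcc// subr0 muleC.
  rewrite integral_mkcond; apply: eq_integral => t _ /=; rewrite patchE.
  case: ifPn => [|/negP]; rewrite inE/= in_itv/= => t0.
    rewrite -(@lebesgue_rV_shift _ (t *: e))//; congr (lebesgue_rV n _).
    by apply/seteqP; split => y; rewrite /xsection/= in_setE//= => -[].
  rewrite (_ : xsection _ _ = set0) ?measure0//; apply/seteqP; split => y //=.
  by rewrite /xsection/= in_setE/= => -[].
rewrite PE -integral_cst//.
rewrite [leRHS]integral_mkcond; apply: ge0_le_integral => //.
- exact: measurable_fun_ysection.
- by apply/(measurable_restrictT _ _).1 => //; exact: measurable_cst.
move=> x _ /=; rewrite patchE.
rewrite (_ : ysection _ _ = [set t : R | 0 <= t <= T /\ A (x + t *: e)]); last first.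
  by apply/seteqP; split => y; rewrite /ysection/= in_setE.
case: ifPn => [/set_mem/hM//|/negP]; rewrite inE => nK.
rewrite (_ : [set _ | _] = set0) ?measure0//; apply/seteqP.
by split => t //= -[/AK/[apply]] /nK.

Qed.

(** [measure_le_lines] with [T = 1], [M = 0] and [K = setT]. The measure of [K] may be infinite, but
    its product with 0 is 0. *)
Lemma null_lines n (e : 'rV[R]_n) (A : set 'rV[R]_n) : measurable A ->
  (forall x, leb1 [set t : R | A (x + t *: e)%R] = 0)%E -> lebesgue_rV n A = 0%E.
Proof.
move=> mA A0.
have : (1%:E * lebesgue_rV n A <= 0%:E * lebesgue_rV n setT)%E.
  apply: (@measure_le_lines _ e) => // x _.
  rewrite -[leRHS](A0 x); apply: le_measure; rewrite ?inE/=.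
  - rewrite [X in measurable X](_ : _ = `[0, 1]%classic `&` [set t : R | A (x + t *: e)]).
      apply: measurableI; first exact: measurable_itv.
      rewrite -[X in measurable X]setTI.
      have := measurableT_comp (measurable_line e)
        (@pair2_measurable _ _ (measurableTypeR R) 'rV[R]_n x); exact.
    by apply/seteqP; split => t /=; rewrite in_itv.
  - rewrite -[X in measurable X]setTI.
    have := measurableT_comp (measurable_line e)
        (@pair2_measurable _ _ (measurableTypeR R) 'rV[R]_n x); exact.
  - by move=> t /= [].
by rewrite mul1e mul0e => ?; apply/eqP; rewrite eq_le measure_ge0 andbT.
Qed.

Lemma bounded_integrable n (A : set 'rV[R]_n) (f : 'rV[R]_n -> R) (C : R) :
  measurable A -> (lebesgue_rV n A < +oo)%E -> measurable_fun A f ->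
  (forall x, A x -> `|f x| <= C) -> (lebesgue_rV n).-integrable A (EFin \o f).
Proof.
move=> mA Afin mf fC; apply: measurable_bounded_integrable => //.
exists C; split; first exact: num_real.
by move=> M CM x Ax /=; apply: le_trans (ltW CM); exact: fC.
Qed.

Lemma le_norm_Rintegral n (A : set 'rV[R]_n) (f : 'rV[R]_n -> R) (C : R) :
  measurable A -> (lebesgue_rV n A < +oo)%E -> measurable_fun A f ->
  (forall x, A x -> `|f x| <= C) ->
  `|(\int[lebesgue_rV n]_(x in A) f x)%R| <= C * fine (lebesgue_rV n A).
Proof.
move=> mA Afin mf fC.
have fi := bounded_integrable mA Afin mf fC.
apply: le_trans (le_normr_Rintegral mA fi) _.
rewrite -Rintegral_cst//; apply: le_Rintegral => //.
  apply: (@bounded_integrable _ _ _ C) => // [|x Ax]; last by rewrite normr_id fC.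
  exact: measurableT_comp.
by apply: (@bounded_integrable _ _ _ `|C|) => // x Ax; rewrite normr_id.
Qed.

Section integrable_fun.
Context d (T : measurableType d) (mu : {measure set T -> \bar R}) (D : set T).
Hypothesis mD : measurable D.
Implicit Types f g : T -> R.

Lemma integrable_funD f g : mu.-integrable D (EFin \o f) ->
  mu.-integrable D (EFin \o g) -> mu.-integrable D (EFin \o (fun x => f x + g x)).
Proof.
by move=> fi gi; apply: eq_integrable (integrableD mD fi gi) => // x _; rewrite /= EFinD.
Qed.

Lemma integrable_funB f g : mu.-integrable D (EFin \o f) ->
  mu.-integrable D (EFin \o g) -> mu.-integrable D (EFin \o (fun x => f x - g x)).
Proof.
by move=> fi gi; apply: eq_integrable (integrableB mD fi gi) => // x _; rewrite /= EFinB.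
Qed.

Lemma integrable_funZ k f : mu.-integrable D (EFin \o f) ->
  mu.-integrable D (EFin \o (fun x => k * f x)).
Proof.
by move=> fi; apply: eq_integrable (integrableZl mD k fi) => // x _; rewrite /= EFinM.
Qed.

Lemma integrable_fun_sum (I : Type) (s : seq I) (P : pred I) (f : I -> T -> R) :
  (forall i, P i -> mu.-integrable D (EFin \o f i)) ->
  mu.-integrable D (EFin \o (fun x => \sum_(i <- s | P i) f i x)).
Proof.
move=> fi; have := integrable_sum mD s fi.
by apply: eq_integrable => // x _; rewrite /= -sumEFin.
Qed.

Lemma Rintegral_sum (I : Type) (s : seq I) (f : I -> T -> R) :
  (forall i, mu.-integrable D (EFin \o f i)) ->
  (\int[mu]_(x in D) (\sum_(i <- s) f i x))%R =
  \sum_(i <- s) (\int[mu]_(x in D) f i x)%R.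
Proof.
move=> fi; elim: s => [|i s IH].
  by rewrite big_nil; under eq_Rintegral do rewrite big_nil; rewrite Rintegral_cst// mul0r.
rewrite big_cons -IH -RintegralD//; last exact: integrable_fun_sum.
by apply: eq_Rintegral => x _; rewrite big_cons.
Qed.
End integrable_fun.

Lemma integrable_shift n (v : 'rV[R]_n) (f : 'rV[R]_n -> \bar R) :
  (lebesgue_rV n).-integrable setT f ->
  (lebesgue_rV n).-integrable setT (fun x : 'rV[R]_n => f (x + v)%R).
Proof.
move=> /integrableP[mf fi]; apply/integrableP; split.
  exact: measurableT_comp mf (measurable_shift _).
rewrite (@ge0_integral_shift _ _ (fun x : 'rV[R]_n => `|f x|%E))//.
exact: measurableT_comp.
Qed.

(** Difference quotients along the sequence of steps [k.+1%:R^-1] give access to measurability of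
    limits and to dominated convergence. *)
Lemma derivable_cvg_seq n (f : 'rV[R]_n -> R) (x w : 'rV[R]_n) : derivable f x w ->
  k.+1%:R * (f (x + k.+1%:R^-1 *: w) - f x) @[k --> \oo] --> 'D_w f x.
Proof.
move=> df.
have : h^-1 *: (f (h *: w + x) - f x) @[h --> 0^'] --> 'D_w f x by exact: df.
move=> /cvgr_dnbhsP h.
have /h : (forall k, harmonic k != 0 :> R) /\ (harmonic : R^nat) @ \oo --> 0.
  by split; [move=> k; rewrite gt_eqF// harmonic_gt0|exact: cvg_harmonic].
by under eq_fun do rewrite /= invrK [in f (_ + x)]addrC.
Qed.

Lemma Rdominated_convergence d (T : measurableType d)
    (mu : {measure set T -> \bar R}) (D : set T) (g : nat -> T -> R) (f b : T -> R) :
  measurable D -> (forall k, measurable_fun D (g k)) ->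
  (forall x, D x -> g k x @[k --> \oo] --> f x) ->
  mu.-integrable D (EFin \o b) -> (forall k x, D x -> `|g k x| <= b x) ->
  mu.-integrable D (EFin \o f) /\
  (\int[mu]_(x in D) g k x)%R @[k --> \oo] --> (\int[mu]_(x in D) f x)%R.
Proof.
move=> mD mg gf bi gb.
have mf : measurable_fun D f by exact: measurable_fun_cvg gf.
have mg' k : measurable_fun D (EFin \o g k) by exact/measurable_EFinP.
have mf' : measurable_fun D (EFin \o f) by exact/measurable_EFinP.
have [||fi _ h] := dominated_convergence mD mg' mf' _ bi.
- by apply: aeW => x Dx; apply: cvg_EFin; [near=> k|exact: gf].
- by apply: aeW => x k Dx; rewrite lee_fin gb.
split=> //; apply: fine_cvg; rewrite fineK; first exact: h.
exact: integrable_fin_num.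
Unshelve. all: end_near. Qed.

Lemma integrable_cst_indic n (D K : set 'rV[R]_n) (C : R) :
  measurable D -> measurable K -> (lebesgue_rV n K < +oo)%E ->
  (lebesgue_rV n).-integrable D (EFin \o (fun x => C * \1_K x)).
Proof.
move=> mD mK Kfin; apply: (@integrableS _ _ _ _ setT) => //.
have -> : EFin \o (fun x => C * \1_K x) = ((cst C%:E) \_ K)%E.
  apply/funext => x /=; rewrite patchE indicE.
  by case: ifPn => _; rewrite ?mulr1 ?mulr0.
apply/(integrable_mkcond _ mK).
by apply: (@bounded_integrable _ _ (cst C) `|C|) => //.
Qed.

(** As [A] is invariant along [w], translation invariance makes the integral over [A] of every
    difference quotient along [w] vanish. The quotients are bounded by [C] and live in a fixed cube,
    so dominated convergence applies. [A] will be the whole space, or a half-space parallel to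
    [w]. *)
Lemma Rintegral_derive0 n (f : 'rV[R]_n -> R) (w z : 'rV[R]_n) (r C : R)
    (A : set 'rV[R]_n) :
  (lebesgue_rV n).-integrable setT (EFin \o f) ->
  (forall x, ~ cube z r x -> f x = 0) ->
  (forall x, derivable f x w) ->
  (forall x h, `|f (x + h *: w) - f x| <= C * `|h|) ->
  measurable A -> (forall x h, A x -> A (x + h *: w)) ->
  (\int[lebesgue_rV n]_(x in A) 'D_w f x)%R = 0.
Proof.
move=> fi f0 df fC mA Aw.
have mf : measurable_fun setT f by case/integrableP : fi => /measurable_EFinP.
pose g k (x : 'rV[R]_n) := k.+1%:R * (f (x + k.+1%:R^-1 *: w) - f x).
have mfs (k : nat) : measurable_fun setT (fun x : 'rV[R]_n => f (x + k.+1%:R^-1 *: w)).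
  exact: measurableT_comp mf (measurable_shift _).
have mg k : measurable_fun setT (g k).
  by apply: measurable_funM => //; apply: measurable_funB.
have gD x : g k x @[k --> \oo] --> 'D_w f x by exact: derivable_cvg_seq.
(* Large enough to contain the supports of [f] and of all its translates by [k.+1%:R^-1 *: w]. *)
pose K := cube z (r + `|w|).
have gC k x : `|g k x| <= C * \1_K x.
  have k0 : 0 < k.+1%:R :> R by [].
  rewrite indicE; have [xK|xK] := boolP (x \in K).
    rewrite mulr1 /g normrM gtr0_norm// mulrC -ler_pdivlMr//.
    by apply: le_trans (fC _ _) _; rewrite gtr0_norm// invr_gt0.
  rewrite mulr0 normr_le0 /g !f0 ?subrr ?mulr0//.
    move=> h; move/negP: xK; apply; rewrite inE /K/cube/=.
    by rewrite (le_trans h)// lerDl.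
  move=> h; move/negP: xK; apply; rewrite inE /K/cube/=.
  rewrite (_ : x - z = x + k.+1%:R^-1 *: w - z - k.+1%:R^-1 *: w); last first.
    by rewrite addrAC addrK.
  apply: le_trans (ler_normB _ _) _; apply: lerD => //.
  by rewrite normrZ gtr0_norm ?invr_gt0// ler_piMl// invf_le1// ler1n.
have Ki := integrable_cst_indic C mA (measurable_cube z (r + `|w|))
  (lebesgue_rV_cube_lty z (r + `|w|)).
have [_ h] := Rdominated_convergence mA (fun k => measurable_funTS (mg k))
  (fun x _ => gD x) Ki (fun k x _ => gC k x).
rewrite -[LHS](cvg_lim _ h)//.
apply/lim_near_cst => //; near=> k.
have fiA : (lebesgue_rV n).-integrable setT (EFin \o (f \_ A)).
  by rewrite -restrict_EFin; apply/(integrable_mkcond _ mA); exact: (integrableS measurableT).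
have Aw' (x : 'rV[R]_n) h' : (x + h' *: w \in A) = (x \in A).
  apply/idP/idP; rewrite !inE; last exact: Aw.
  by move=> /(Aw _ (- h')); rewrite scaleNr addrK.
have sE (x : 'rV[R]_n) : (fun x : 'rV[R]_n => f (x + k.+1%:R^-1 *: w)) \_ A x = (f \_ A) (x + k.+1%:R^-1 *: w).
  by rewrite !patchE Aw'.
have fsi : (lebesgue_rV n).-integrable setT
    (EFin \o ((fun x : 'rV[R]_n => f (x + k.+1%:R^-1 *: w)) \_ A)).
  rewrite (funext sE).
  exact: (@integrable_shift _ (k.+1%:R^-1 *: w) (EFin \o (f \_ A))).
rewrite Rintegral_mkcond.
under eq_Rintegral.
  move=> x _; rewrite (_ : _ \_ _ _ = k.+1%:R * ((fun x : 'rV[R]_n => f (x + k.+1%:R^-1 *: w)) \_ A x - f \_ A x)); last first.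
    by rewrite !patchE; case: ifPn => // _; rewrite subrr mulr0.
  over.
rewrite RintegralZl//; last exact: integrable_funB.
rewrite RintegralB//.
under eq_Rintegral do rewrite sE.
rewrite Rintegral_shift ?subrr ?mulr0//.
by case/integrableP : fiA => /measurable_EFinP.
Unshelve. all: end_near. Qed.
End lebesgue_rV_theory.

(** * Lipschitz functions on the line *)

Section lipschitz_derivable.
Context {R : realType}.
Local Notation leb1 := (@lebesgue_measure R).

Lemma lebesgue_stieltjes_itv (g : cumulative R R) (a b : R) : a <= b ->
  lebesgue_stieltjes_measure g `]a, b]%classic = (g b - g a)%:E.
Proof.
move=> ab; rewrite /lebesgue_stieltjes_measure.
rewrite /measure_extension measurable_mu_extE/=; last exact: is_ocitv.
by rewrite wlength_itv_bnd.
Qed.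

(* The Stieltjes measures of [g] and [g'] add up to [c] times the Lebesgue measure. *)
Lemma lebesgue_stieltjes_dominated (g g' h : cumulative R R) (c : {nonneg R}) :
  (forall x, h x = c%:num * x) -> (forall x, g x + g' x = h x) ->
  lebesgue_stieltjes_measure g `<< leb1.
Proof.
move=> hE ggE; apply/null_content_dominatesP => A mA A0.
have h1 : lebesgue_stieltjes_measure h A = mscale c leb1 A.
  apply: lebesgue_stieltjes_measure_unique => // X /ocitvP[->|[[x y]/= xy ->]].
    by rewrite !measure0.
  rewrite lebesgue_stieltjes_itv ?ltW// /mscale/= lebesgue_measure_itv/= lte_fin xy.
  by rewrite -EFinB -EFinM !hE mulrBr.
have h2 : lebesgue_stieltjes_measure h A =
    measure_add (lebesgue_stieltjes_measure g) (lebesgue_stieltjes_measure g') A.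
  apply: lebesgue_stieltjes_measure_unique => // X /ocitvP[->|[[x y]/= xy ->]].
    by rewrite !measure0.
  have xy' := ltW xy.
  rewrite [RHS](measure_addE (lebesgue_stieltjes_measure g) (lebesgue_stieltjes_measure g')).
  have := lebesgue_stieltjes_itv g xy'.
  have := lebesgue_stieltjes_itv g' xy'; have := lebesgue_stieltjes_itv h xy'.
  move=> /= -> -> ->.
  by rewrite -EFinD; congr EFin; rewrite -!ggE; ring.
move: h2; rewrite h1.
rewrite [RHS](measure_addE (lebesgue_stieltjes_measure g) (lebesgue_stieltjes_measure g')).
rewrite /mscale/= A0 mule0 => /esym/eqP.
by rewrite padde_eq0 ?measure_ge0// => /andP[/eqP].
Qed.

Lemma derivable_mull (L x : R) : derivable (fun y : R => L * y) x 1.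
Proof. by apply: derivableM; [exact: derivable_cst|exact: derivable_id]. Qed.

Lemma derivable_addr (f : R -> R) (c x : R) :
  derivable f x 1 -> derivable (fun y : R => f y + c) x 1.
Proof. by move=> df; exact: derivableD. Qed.

Lemma derivable_fsub (f g : R -> R) (x : R) :
  derivable f x 1 -> derivable g x 1 -> derivable (fun y : R => f y - g y) x 1.
Proof. by move=> df dg; exact: derivableB. Qed.

Variables (f : R -> R) (L : R).
Hypothesis fL : forall x y, `|f x - f y| <= L * `|x - y|.

Lemma lip_ge0 : 0 <= L.
Proof. by have := fL 1 0; rewrite subr0 normr1 mulr1; exact: le_trans. Qed.

Lemma lip_continuous : continuous f.
Proof.
have L1 : 0 < L + 1 by rewrite ltr_wpDl// lip_ge0.
move=> x; apply/cvgrPdist_le => /= e e0; near=> y.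
apply: le_trans (fL _ _) _.
have : `|x - y| <= e / (L + 1).
  near: y; have := @cvgr_dist_le _ _ _ (nbhs x) _ id x (@cvg_id _ (nbhs x)).
  by move=> /(_ _ (e / (L + 1)) (divr_gt0 e0 L1)); apply.
rewrite ler_pdivlMr// mulrC; apply: le_trans.
by rewrite ler_wpM2r// lerDl.
Unshelve. all: end_near. Qed.

Lemma lip_abs x y : x <= y -> - (L * (y - x)) <= f y - f x <= L * (y - x).
Proof.
by move=> xy; rewrite -ler_norml; have := fL y x; rewrite (@ger0_norm _ (y - x))// subr_ge0.
Qed.

(** [lip_up] and [lip_down] are nondecreasing by the Lipschitz bound and add up to [lip_sum]. So
    their Stieltjes measures add up to [2 * L] times the Lebesgue measure, which makes that of
    [lip_up] absolutely continuous. *)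
Definition lip_up (x : R) := f x + L * x.
Definition lip_down (x : R) := L * x - f x.
Definition lip_sum (x : R) := 2 * L * x.

Let Lx_cont : continuous (fun x : R => L * x).
Proof. by move=> x; apply: cvgM; [exact: cvg_cst|exact: cvg_id]. Qed.

Let up_nd : nondecreasing lip_up.
Proof. by move=> x y xy; have := lip_abs xy; rewrite /lip_up; lra. Qed.
Let up_rc : right_continuous lip_up.
Proof.
by apply: right_continuousW => x; apply: cvgD; [exact: lip_continuous|exact: Lx_cont].
Qed.
HB.instance Definition _ := isCumulative.Build R _ R lip_up up_nd up_rc.

Let down_nd : nondecreasing lip_down.
Proof. by move=> x y xy; have := lip_abs xy; rewrite /lip_down; lra. Qed.
Let down_rc : right_continuous lip_down.
Proof.
by apply: right_continuousW => x; apply: cvgB; [exact: Lx_cont|exact: lip_continuous].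
Qed.
HB.instance Definition _ := isCumulative.Build R _ R lip_down down_nd down_rc.

Let sum_nd : nondecreasing lip_sum.
Proof.
by move=> x y xy; rewrite /lip_sum ler_wpM2l// mulr_ge0// lip_ge0.
Qed.
Let sum_rc : right_continuous lip_sum.
Proof.
by apply: right_continuousW => x; apply: cvgM; [exact: cvg_cst|exact: cvg_id].
Qed.
HB.instance Definition _ := isCumulative.Build R _ R lip_sum sum_nd sum_rc.

Lemma lip_up_dominated : lebesgue_stieltjes_measure lip_up `<< leb1.
Proof.
have L0 : 0 <= 2 * L by rewrite mulr_ge0// lip_ge0.
apply: (@lebesgue_stieltjes_dominated _ lip_down lip_sum (NngNum L0)) => // x.
have E : (f x + L * x) + (L * x - f x) = 2 * L * x by ring.
exact: E.
Qed.

(** The Stieltjes measure of [lip_up], cut to a bounded interval to make it finite, has an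
    integrable Radon-Nikodym density. Inside the interval [lip_up] is the primitive of this density
    up to a constant, and such a primitive is derivable almost everywhere by Lebesgue
    differentiation. *)
Lemma lip_derivable_on (N : nat) :
  {ae leb1, forall x, - N%:R < x < N%:R -> derivable f x 1}.
Proof.
pose a : R := - N%:R; pose b : R := N%:R.
have ab : a <= b by rewrite /a /b; have : 0 <= N%:R :> R by []; lra.
pose nu : {measure set (measurableTypeR R) -> \bar R} :=
  lebesgue_stieltjes_measure lip_up.
have mD : measurable (`]a, b]%classic : set (measurableTypeR R)) by exact: measurable_itv.
have Dfin : (nu `]a, b]%classic < +oo)%E by rewrite /nu /= lebesgue_stieltjes_itv// ltry.
pose nuD : {finite_measure set (measurableTypeR R) -> \bar R} := mfrestr mD Dfin.
have nuD_dom : nuD `<< leb1.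
  apply/null_content_dominatesP => A mA A0; rewrite /nuD /mfrestr /mrestr/=.
  have /null_content_dominatesP := lip_up_dominated; apply.
    by apply: measurableI.
  by apply: (subset_measure0 _ mA) => //; exact: measurableI.
have [F [F0 Ffin Fi FE]] := radon_nikodym_sigma_finite nuD_dom.
pose phi := fine \o F.
have phiE : EFin \o phi = F by apply/funext => x; rewrite /phi/= fineK.
have phii : leb1.-integrable setT (EFin \o phi) by rewrite phiE.
have phiy (y : R) : leb1.-integrable `]-oo, y] (EFin \o phi).
  by apply: integrableS phii => //; exact: measurable_itv.
have := FTC1Ny phiy (open_integrable_locally openT phii).
apply: filterS; first exact: (ae_filter_ringOfSetsType leb1).
move=> x [dPhi _] /andP[ax xb].
pose Phi y := (\int[leb1]_(t in `]-oo, y]) phi t)%R.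
have upE y : a < y -> y < b -> Phi y = lip_up y - lip_up a.
  move=> ay yb; rewrite /Phi /Rintegral.
  under eq_integral do rewrite [_%:E](congr1 (@^~ _) phiE).
  rewrite -FE//.
  rewrite -[nuD _]/(nu (`]-oo, y]%classic `&` `]a, b]%classic)).
  rewrite (_ : _ `&` _ = `]a, y]%classic).
    by rewrite /nu /= lebesgue_stieltjes_itv// ltW.
  apply/seteqP; split=> z /=; rewrite !in_itv/=; first by move=> [-> /andP[->]].
  by move=> /andP[-> zy]; rewrite zy (le_trans zy (ltW yb)).
have -> : f = (fun y => lip_up y - L * y) by apply/funext => y; rewrite /lip_up addrK.
apply: derivable_fsub; last exact: derivable_mull.
have : derivable (fun y => Phi y + lip_up a) x 1 by exact: derivable_addr.
apply: near_eq_derivable; near=> y; rewrite upE ?subrK//; near: y.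
  exact: lt_nbhsr.
exact: lt_nbhsl.
Unshelve. all: end_near. Qed.

Lemma lipschitz_ae_derivable : {ae leb1, forall x, derivable f x 1}.
Proof.
have : {ae leb1, forall x (N : nat), - N%:R < x < N%:R -> derivable f x 1}.
  by apply/ae_foralln => N; exact: lip_derivable_on.
apply: filterS; first exact: (ae_filter_ringOfSetsType leb1).
move=> x h.
by apply: (h (Num.bound `|x|)); rewrite -ltr_norml archi_boundP.
Qed.

End lipschitz_derivable.

(** * Rademacher's theorem *)

Lemma lipschitz_rV_continuous {R : realType} (d : nat) (f : 'rV[R]_d -> R) (L : R) :
  (forall x y, `|f x - f y| <= L * `|x - y|) -> continuous f.
Proof.
move=> fL x; apply/(@cvgrPdist_le _ _ _ (nbhs x)) => e e0.
have L1 : 0 < `|L| + 1 by rewrite ltr_wpDl.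
near=> y.
apply: le_trans (fL _ _) _.
have : `|x - y| <= e / (`|L| + 1).
  near: y; have := @cvgr_dist_le _ _ _ (nbhs x) _ id x (@cvg_id _ (nbhs x)).
  by move=> /(_ _ (e / (`|L| + 1)) (divr_gt0 e0 L1)); apply.
rewrite ler_pdivlMr// mulrC; apply: le_trans.
by rewrite ler_wpM2r// (le_trans (ler_norm L))// lerDl.
Unshelve. all: end_near. Qed.

Lemma Rintegral_supp {R : realType} (d : nat) (K : set 'rV[R]_d) (f : 'rV[R]_d -> R) :
  measurable K -> (forall x, ~ K x -> f x = 0) ->
  (\int[lebesgue_rV d]_x f x)%R = (\int[lebesgue_rV d]_(x in K) f x)%R.
Proof.
move=> mK f0; rewrite [RHS]Rintegral_mkcond; apply: eq_Rintegral => x _.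
by rewrite patchE; case: ifPn => // /negP h; apply: f0 => Kx; apply: h; rewrite inE.
Qed.

Lemma supp_integrable {R : realType} (d : nat) (K : set 'rV[R]_d) (f : 'rV[R]_d -> R) (C : R) :
  measurable K -> (lebesgue_rV d K < +oo)%E -> measurable_fun setT f ->
  (forall x, ~ K x -> f x = 0) -> (forall x, `|f x| <= C) ->
  (lebesgue_rV d).-integrable setT (EFin \o f).
Proof.
move=> mK Kfin mf f0 fC.
have -> : EFin \o f = ((EFin \o f) \_ K)%E.
  apply/funext => x; rewrite patchE; case: ifPn => // /negP h /=.
  by rewrite f0// => Kx; apply: h; rewrite inE.
apply/(integrable_mkcond _ mK); apply: (@bounded_integrable _ _ _ _ C) => //.
exact: measurable_funTS.
Qed.

Lemma Rintegral_conull {R : realType} (d : nat) (H : set 'rV[R]_d) (f : 'rV[R]_d -> R) :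
  measurable H -> lebesgue_rV d (~` H) = 0%E ->
  (lebesgue_rV d).-integrable setT (EFin \o f) ->
  (\int[lebesgue_rV d]_(x in H) f x)%R = (\int[lebesgue_rV d]_x f x)%R.
Proof.
move=> mH H0 fi; rewrite /Rintegral; congr fine.
rewrite [RHS](negligible_integral (measurableC mH) measurableT fi H0).
by rewrite setTD setCK.
Qed.

Lemma cvg_sumr {R : realType} (T I : Type) (F : set_system T) (s : seq I)
    (f : I -> T -> R) (l : I -> R) : Filter F -> (forall i, f i @ F --> l i) ->
  (fun x => \sum_(i <- s) f i x) @ F --> \sum_(i <- s) l i.
Proof.
move=> FF fl; elim: s => [|i s IH].
  by under eq_fun do rewrite big_nil; rewrite big_nil; exact: cvg_cst.
under eq_fun do rewrite big_cons; rewrite big_cons; exact: cvgD.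
Qed.

Section rademacher.
Context {R : realType} {d : nat}.
Local Notation E := 'rV[R]_d.
Local Notation mu := (lebesgue_rV d).
Variables (phi : E -> R) (L : R).
Hypothesis phiL : forall x y, `|phi x - phi y| <= L * `|x - y|.

Lemma dotv_abs_le m (p t : 'rV[R]_m) : `|dotv p t| <= m%:R * (`|p| * `|t|).
Proof.
apply: le_trans (ler_norm_sum _ _ _) _.
have -> : m%:R * (`|p| * `|t|) = \sum_(i < m) `|p| * `|t|.
  by rewrite sumr_const card_ord mulr_natl.
by apply: ler_sum => i _; rewrite normrM ler_pM// rV_norm_coord.
Qed.

Lemma phi_lip_ge0 (v : E) : 0 <= L * `|v|.
Proof. by have := phiL v 0; rewrite subr0; exact: le_trans. Qed.

Lemma phi_continuous : continuous phi.
Proof. exact: lipschitz_rV_continuous phiL. Qed.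

Lemma dotv_continuous m (t : 'rV[R]_m) : continuous (fun p : 'rV[R]_m => dotv p t).
Proof.
move=> p; rewrite /dotv; apply: (@cvg_sumr _ _ _ (nbhs p)) => i.
by apply: cvgM; [exact: coord_continuous|exact: cvg_cst].
Qed.

(** Approximation of [phi] with relative error [e] at all scales up to [r], along the directions
    [t *m V]: a single direction if [V] is a row, all of them if [V] is the identity. The bound [B]
    confines the slope to a compact set, which makes the set closed and hence measurable. *)
Definition lin_approx m (V : 'M[R]_(m, d)) (B e r : R) : set E :=
  [set y | exists2 p : 'rV[R]_m, `|p| <= B & forall t : 'rV[R]_m, `|t| <= r ->
    `|phi (y + t *m V) - phi y - dotv p t| <= e * `|t|].

(** If no slope works at [y], then each slope [p] of the compact ball violates the bound strictly at
    some [t]; this violation persists for slopes near [p] and points near [y], and compactness gives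
    a neighbourhood of [y] common to all slopes. *)
Lemma closed_lin_approx m (V : 'M[R]_(m, d)) (B e r : R) :
  closed (lin_approx V B e r).
Proof.
rewrite -openC openE => y nCy.
pose K := [set p : 'rV[R]_m | `|p| <= B].
have cK : compact K.
  apply: bounded_closed_compact.
    exists B; split; [exact: num_real|move=> C BC p /= pB].
    exact: le_trans pB (ltW BC).
  have -> : K = (fun p : 'rV[R]_m => `|p|) @^-1` [set x | x <= B] by [].
  apply: closed_comp => [p _|]; [exact: norm_continuous|exact: closed_le].
pose good y p := forall t : 'rV[R]_m, `|t| <= r ->
    `|phi (y + t *m V) - phi y - dotv p t| <= e * `|t|.
have := (compact_near_coveringP K).1 cK E (nbhs y) (fun y' p => ~ good y' p) (nbhs_filter y).
have step : forall x, K x ->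
    \forall x' \near x & i \near nbhs y, ~ good i x'.
  move=> p Kp.
  have [t tr ht] : exists2 t : 'rV[R]_m, `|t| <= r &
      e * `|t| < `|phi (y + t *m V) - phi y - dotv p t|.
    apply: contrapT => h; apply: nCy; exists p => // t tr.
    by rewrite leNgt; apply/negP => h'; apply: h; exists t.
  have cf : (fun q : 'rV[R]_m * E => `|phi (q.2 + t *m V) - phi q.2 - dotv q.1 t|)
      @ nbhs (p, y) --> `|phi (y + t *m V) - phi y - dotv p t|.
    apply: cvg_norm; apply: cvgB; first apply: cvgB.
    - apply: continuous_cvg; first exact: phi_continuous.
      by apply: cvgD; [exact: cvg_snd|exact: cvg_cst].
    - by apply: continuous_cvg; [exact: phi_continuous|exact: cvg_snd].
    - apply: (@cvg_comp _ _ _ fst (fun p : 'rV[R]_m => dotv p t) _ (nbhs p)).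
        exact: cvg_fst.
      exact: dotv_continuous.
  have := cvgr_gt _ cf _ ht.
  move=> [[A B']/= [Ap By] AB]; exists (A, B') => // -[p' y'] /= ABp' /(_ _ tr).
  by rewrite leNgt => /negP; apply; exact: (AB (p', y')).
move=> /(_ step); apply: filterS => y' h [p Kp hp]; exact: (h p Kp).
Qed.

Lemma measurable_lin_approx m (V : 'M[R]_(m, d)) (B e r : R) :
  measurable (lin_approx V B e r).
Proof.
rewrite -[X in measurable X]setCK; apply: measurableC.
by apply: measurable_open_rV; rewrite openC; exact: closed_lin_approx.
Qed.

(** Differentiability along [V] in countable form. The slope may change with the precision [k],
    which keeps the set measurable; that the slopes converge is a consequence. *)
Definition lin_diff m (V : 'M[R]_(m, d)) (B : R) : set E :=
  \bigcap_k \bigcup_n lin_approx V B k.+1%:R^-1 n.+1%:R^-1.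

Lemma measurable_lin_diff m (V : 'M[R]_(m, d)) (B : R) : measurable (lin_diff V B).
Proof.
apply: bigcapT_measurable => k; apply: bigcupT_measurable => n.
exact: measurable_lin_approx.
Qed.

Lemma lin_diffP m (V : 'M[R]_(m, d)) (B : R) y : lin_diff V B y <->
  (forall e, 0 < e -> exists2 r, 0 < r & lin_approx V B e r y).
Proof.
split=> [h e e0|h k _].
  have [k _ /(_ _ (leqnn k)) kP] := near_infty_natSinv_lt (PosNum e0).
  have [n _ [p pB hp]] := h k Logic.I.
  exists n.+1%:R^-1; first by rewrite invr_gt0.
  exists p => // t tn; apply: le_trans (hp t tn) _.
  by rewrite ler_wpM2r// ltW.
have [|r r0 [p pB hp]] := h k.+1%:R^-1; first by rewrite invr_gt0.
have [n _ /(_ _ (leqnn n)) nP] := near_infty_natSinv_lt (PosNum r0).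
exists n => //; exists p => // t tn; apply: hp.
by apply: le_trans tn _; exact: ltW.
Qed.

Lemma dotv1 (p t : 'rV[R]_1) : dotv p t = p 0 0 * t 0 0.
Proof. by rewrite /dotv big_ord_recl big_ord0 addr0. Qed.

Lemma rV1_mul (t : 'rV[R]_1) (v : E) : t *m v = t 0 0 *: v.
Proof. by rewrite [t in LHS]mx11_scalar mul_scalar_mx. Qed.

Lemma rV1_norm (t : 'rV[R]_1) : `|t| = `|t 0 0|.
Proof.
apply/eqP; rewrite eq_le rV_norm_coord andbT; apply/rV_norm_le => // i.
by rewrite ord1.
Qed.

Lemma derive_lip_le x v : derivable phi x v -> `|'D_v phi x| <= L * `|v|.
Proof.
move=> /derivable_cvg_seq h.
apply: (ler_cvg_to (cvg_norm h) (cvg_cst (L * `|v|))).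
near=> k; rewrite normrM gtr0_norm// mulrC -ler_pdivlMr//.
apply: le_trans (phiL _ _) _.
by rewrite addrAC subrr add0r normrZ gtr0_norm ?invr_gt0// mulrCA mulrC.
Unshelve. all: end_near. Qed.

Lemma derivable_lin_diff x (v : E) : derivable phi x v ->
  lin_diff (v : 'M[R]_(1, d)) (L * `|v|) x.
Proof.
move=> dv; apply/lin_diffP => e e0.
have : h^-1 *: (phi (h *: v + x) - phi x) @[h --> 0^'] --> 'D_v phi x by exact: dv.
move=> /cvgrPdist_le/(_ e e0) [r /= r0 hr].
exists (r / 2); first exact: divr_gt0.
exists (const_mx ('D_v phi x)); first by rewrite rV1_norm mxE derive_lip_le.
move=> t; rewrite rV1_norm dotv1 rV1_mul mxE => tr.
have [->|t0] := eqVneq (t 0 0) 0.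
  by rewrite scale0r addr0 subrr mulr0 subr0 normr0 mulr0.
have := hr (t 0 0); rewrite /= sub0r normrN => /(_ _ t0).
have lt : `|t 0 0| < r by apply: le_lt_trans tr _; lra.
move=> /(_ lt) h; rewrite [x + _]addrC.
have -> : phi (t 0 0 *: v + x) - phi x - 'D_v phi x * t 0 0 =
  - (t 0 0 * ('D_v phi x - (t 0 0)^-1 * (phi (t 0 0 *: v + x) - phi x))).
  by rewrite mulrBr mulVKf// opprB mulrC.
by rewrite normrN normrM mulrC ler_wpM2r.
Qed.

(** Cauchy criterion: at precision [e / 2] all quotients with small enough step are within [e] of
    the same slope, although this slope depends on [e]. *)
Lemma lin_diff_derivable x (v : E) B :
  lin_diff (v : 'M[R]_(1, d)) B x -> derivable phi x v.
Proof.
move=> /lin_diffP h; apply: cauchy_cvg; apply: cauchy_exP => e e0.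
have e20 : 0 < e / 2 by exact: divr_gt0.
have [r r0 [p pB hp]] := h _ e20.
exists (p 0 0); exists r => //= t; rewrite /= sub0r normrN => tr t0.
rewrite -ball_normE/=.
have := hp (const_mx t); rewrite rV1_norm dotv1 rV1_mul !mxE => /(_ (ltW tr)) {}hp.
rewrite [_ *: v + x]addrC.
have -> : p 0 0 - t^-1 *: (phi (x + t *: v) - phi x) =
  - (t^-1 * (phi (x + t *: v) - phi x - p 0 0 * t)).
  by rewrite mulrBr mulrCA mulVf// mulr1 opprB.
rewrite normrN normrM normfV; apply: (@le_lt_trans _ _ (e / 2)); last by lra.
by rewrite mulrC ler_pdivrMr ?normr_gt0.
Qed.

(** On every line along [v] the function [phi] is Lipschitz in one variable, so the line meets the
    exceptional set in a null set; [null_lines] concludes, the set being measurable. *)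
Lemma mu_nderivable (v : E) :
  mu (~` (lin_diff (v : 'M[R]_(1, d)) (L * `|v|))) = 0%E.
Proof.
apply: (@null_lines _ _ v); first by apply: measurableC; exact: measurable_lin_diff.
move=> x.
pose f t := phi (x + t *: v).
have fL s t : `|f s - f t| <= (L * `|v|) * `|s - t|.
  apply: le_trans (phiL _ _) _.
  by rewrite opprD addrACA subrr add0r -scalerBl normrZ -mulrA [`|v| * _]mulrC.
have [N [mN N0 subN]] := lipschitz_ae_derivable fL.
apply: (subset_measure0 _ mN) => //.
- rewrite -[X in measurable X]setTI.
  have := measurableT_comp (measurable_line v)
        (@pair2_measurable _ _ (measurableTypeR R) 'rV[R]_d x); apply => //.
  by apply: measurableC; exact: measurable_lin_diff.
- move=> t /= nt; apply: subN => /= dft; apply: nt.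
  apply: derivable_lin_diff.
  move: dft; rewrite /derivable/=.
  have -> // : (fun h : R => h^-1 *: (f (h *: 1 + t) - f t)) =
   (fun h => h^-1 *: (phi (h *: v + (x + t *: v)) - phi (x + t *: v))).
  apply/funext => h; congr (_ *: (phi _ - _)).
  by rewrite [h *: 1]mulr1 scalerDl addrCA.
Qed.

Lemma cvg_sub3 (a b c : nat -> R) (la lb lc : R) :
  a @ \oo --> la -> b @ \oo --> lb -> c @ \oo --> lc ->
  (fun k => a k - b k - c k) @ \oo --> la - lb - lc.
Proof. by move=> ha hb hc; apply: cvgB => //; exact: cvgB. Qed.

Definition dir_diff (v : E) : set E := lin_diff (v : 'M[R]_(1, d)) (L * `|v|).

Lemma measurable_dir_diff v : measurable (dir_diff v).
Proof. exact: measurable_lin_diff. Qed.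

(** * Almost everywhere additivity of the directional derivatives *)

Section additivity.
Variables v w : E.

Let H := dir_diff v `&` dir_diff w `&` dir_diff (v + w).
Let mH : measurable H.
Proof. by do 2 (apply: measurableI; last exact: measurable_dir_diff); exact: measurable_dir_diff. Qed.

Let H0 : mu (~` H) = 0%E.
Proof.
rewrite !setCI; apply: null_set_setU; last exact: mu_nderivable.
- by apply: measurableU; apply: measurableC; exact: measurable_dir_diff.
- by apply: measurableC; exact: measurable_dir_diff.
apply: null_set_setU; try exact: mu_nderivable.
- by apply: measurableC; exact: measurable_dir_diff.
- by apply: measurableC; exact: measurable_dir_diff.
Qed.

Let D (u x : E) : R := 'D_u phi x.
Let delta (x : E) : R := D (v + w) x - D v x - D w x.
Let q (k : nat) (x : E) := k.+1%:R * (phi (x + k.+1%:R^-1 *: v) - phi x).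
Let delta_ (k : nat) (x : E) := q k (x + k.+1%:R^-1 *: w) - q k x.

Let q_le k x : `|q k x| <= L * `|v|.
Proof.
rewrite normrM gtr0_norm// mulrC -ler_pdivlMr//; apply: le_trans (phiL _ _) _.
by rewrite addrAC subrr add0r normrZ gtr0_norm ?invr_gt0// mulrCA mulrC.
Qed.

Let q_lip k x y : `|q k x - q k y| <= k.+1%:R * (2 * L) * `|x - y|.
Proof.
rewrite /q -mulrBr normrM gtr0_norm// -mulrA ler_wpM2l//.
have -> : phi (x + k.+1%:R^-1 *: v) - phi x - (phi (y + k.+1%:R^-1 *: v) - phi y) =
  (phi (x + k.+1%:R^-1 *: v) - phi (y + k.+1%:R^-1 *: v)) - (phi x - phi y) by ring.
apply: le_trans (ler_normB _ _) _.
have h1 := phiL (x + k.+1%:R^-1 *: v) (y + k.+1%:R^-1 *: v).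
have h2 := phiL x y.
apply: le_trans (lerD h1 h2) _.
have -> : x + k.+1%:R^-1 *: v - (y + k.+1%:R^-1 *: v) = x - y.
  by rewrite opprD addrACA subrr addr0.
by rewrite -mulrA mulr_natl mulr2n.
Qed.

Let delta_lip k x y : `|delta_ k x - delta_ k y| <= 2 * (k.+1%:R * (2 * L)) * `|x - y|.
Proof.
have -> : delta_ k x - delta_ k y = (q k (x + k.+1%:R^-1 *: w) - q k (y + k.+1%:R^-1 *: w)) -
  (q k x - q k y) by rewrite /delta_; ring.
apply: le_trans (ler_normB _ _) _.
apply: le_trans (lerD (q_lip _ _ _) (q_lip _ _ _)) _.
have -> : x + k.+1%:R^-1 *: w - (y + k.+1%:R^-1 *: w) = x - y.
  by rewrite opprD addrACA subrr addr0.
by rewrite -[leRHS]mulrA [leRHS]mulr_natl mulr2n.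
Qed.

Let delta_le k x : `|delta_ k x| <= 2 * (L * `|v|).
Proof.
apply: le_trans (ler_normB _ _) _.
by rewrite mulr_natl mulr2n lerD.
Qed.

Let mq k : measurable_fun setT (q k).
Proof. by apply: continuous_measurable_rV; exact: lipschitz_rV_continuous (@q_lip k). Qed.

Let mdelta_ k : measurable_fun setT (delta_ k).
Proof. by apply: continuous_measurable_rV; exact: lipschitz_rV_continuous (@delta_lip k). Qed.

Let delta_cvg x : H x -> delta_ k x @[k --> \oo] --> delta x.
Proof.
move=> [[hv hw] hvw].
pose Q (u : E) (k : nat) : R := k.+1%:R * (phi (x + k.+1%:R^-1 *: u) - phi x).
have QD (u : E) : dir_diff u x -> Q u @ \oo --> D u x.
  by move=> hu; exact: derivable_cvg_seq (lin_diff_derivable hu).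
have E : delta_ ^~ x = fun k => Q (v + w) k - Q v k - Q w k.
  apply/funext => k; rewrite /delta_ /q /Q scalerDr [_ *: v + _]addrC addrA.
  by ring.
rewrite E; exact: (cvg_sub3 (QD _ hvw) (QD _ hv) (QD _ hw)).
Qed.

(** Discrete integration by parts: the integral of [zeta * delta_ k] equals that of an increment of
    [zeta] times [q k]. As [zeta] is Lipschitz and [q k] is bounded uniformly in [k], it is O(1/(k +
    1)), while dominated convergence sends it to the integral of [zeta * delta]. *)
Let weak_additive (zeta : E -> R) (C Z M : R) :
  (forall x y, `|zeta x - zeta y| <= C * `|x - y|) ->
  (forall x, `|zeta x| <= Z) -> (forall x, ~ cube 0 M x -> zeta x = 0) ->
  (\int[mu]_(x in H) (zeta x * delta x))%R = 0.
Proof.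
move=> zC zZ z0.
have mz : measurable_fun setT zeta.
  by apply: continuous_measurable_rV; exact: lipschitz_rV_continuous zC.
have Z0 : 0 <= Z by exact: le_trans (normr_ge0 _) (zZ 0).
have mzd k : measurable_fun setT (fun x => zeta x * delta_ k x).
  exact: measurable_funM.
have zd_le k x : `|zeta x * delta_ k x| <= Z * (2 * (L * `|v|)).
  by rewrite normrM ler_pM.
have zd0 k x : ~ cube 0 M x -> zeta x * delta_ k x = 0.
  by move=> h; rewrite z0// mul0r.
have Ki := integrable_cst_indic (Z * (2 * (L * `|v|))) mH (measurable_cube (0 : E) M)
  (lebesgue_rV_cube_lty (0 : E) M).
have [x Hx|k x _|_ hcv] := Rdominated_convergence mH
  (fun k => measurable_funTS (mzd k)) (f := fun x => zeta x * delta x) _ Ki.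
- by apply: cvgM; [exact: cvg_cst|exact: delta_cvg].
- rewrite indicE; case: (boolP (x \in _)) => [_|/negP xM]; first by rewrite mulr1.
  by rewrite zd0 ?normr0 ?mulr0// => h; apply: xM; rewrite inE.
rewrite -(cvg_lim _ hcv)//; apply/cvg_lim => //.
(* Contains the support of [zeta] and those of its translates by the steps used below. *)
pose K := cube (0 : E) (M + `|w|).
have mK : measurable K by exact: measurable_cube.
have Kfin : (mu K < +oo)%E by exact: lebesgue_rV_cube_lty.
pose c := (C * `|w|) * (L * `|v|) * fine (mu K).
have main k : `|(\int[mu]_(x in H) (zeta x * delta_ k x))%R| <= k.+1%:R^-1 * c.
  rewrite (Rintegral_conull mH H0); last first.
    exact: (supp_integrable (measurable_cube (0 : E) M) (lebesgue_rV_cube_lty (0 : E) M)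
      (mzd k) (@zd0 k) (@zd_le k)).
  set h := k.+1%:R^-1 *: w.
  have h_le : `|h| <= `|w|.
    by rewrite normrZ gtr0_norm ?invr_gt0// ler_piMl// invf_le1// ler1n.
  have cubeK x y : cube 0 M x -> `|y| <= `|w| -> K (x + y).
    rewrite /K /cube/= !subr0 => xM yw.
    by apply: le_trans (ler_normD _ _) _; exact: lerD.
  have zK x : ~ K x -> zeta x = 0.
    move=> nK; apply: z0 => h'; apply: nK.
    by rewrite -[x]addr0; apply: cubeK => //; rewrite normr0.
  have zhK x : ~ K x -> zeta (x - h) = 0.
    by move=> nK; apply: z0 => h'; apply: nK; rewrite -[x](subrK h); exact: cubeK.
  pose psi x := zeta (x - h) * q k x.
  have mzh : measurable_fun setT (fun x : E => zeta (x - h)).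
    exact: measurableT_comp mz (measurable_shift _).
  have mpsi : measurable_fun setT psi by exact: measurable_funM.
  have psii : mu.-integrable setT (EFin \o psi).
    apply: (@supp_integrable _ _ K _ (Z * (L * `|v|))) => //.
      by move=> x nK; rewrite /psi zhK// mul0r.
    by move=> x; rewrite normrM ler_pM.
  have zqi : mu.-integrable setT (EFin \o (fun x => zeta x * q k x)).
    apply: (@supp_integrable _ _ K _ (Z * (L * `|v|))) => //.
    - exact: measurable_funM.
    - by move=> x nK; rewrite zK// mul0r.
    - by move=> x; rewrite normrM ler_pM.
  have psihi : mu.-integrable setT (EFin \o (fun x => psi (x + h))).
    exact: (@integrable_shift _ _ h (EFin \o psi)).
  have -> : (\int[mu]_x (zeta x * delta_ k x))%R =
      (\int[mu]_(x in K) ((zeta (x - h) - zeta x) * q k x))%R.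
    rewrite -[RHS]Rintegral_supp//; last by move=> x nK; rewrite zhK// zK// subrr mul0r.
    transitivity (\int[mu]_x (psi (x + h) - zeta x * q k x))%R.
      by apply: eq_Rintegral => x _; rewrite /psi addrK -mulrBr.
    rewrite RintegralB// (Rintegral_shift h mpsi) -RintegralB//.
    by apply: eq_Rintegral => x _; rewrite /psi mulrBl.
  have := @le_norm_Rintegral _ _ K (fun x => (zeta (x - h) - zeta x) * q k x)
    (C * `|h| * (L * `|v|)) mK Kfin.
  move=> /(_ _ _)/le_trans; apply.
  - by apply: measurable_funTS; apply: measurable_funM => //; exact: measurable_funB.
  - move=> x _; rewrite normrM ler_pM//.
    by apply: le_trans (zC _ _) _; rewrite addrAC subrr add0r normrN.
  rewrite /c /h normrZ gtr0_norm ?invr_gt0//.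
  by rewrite [leLHS](_ : _ = k.+1%:R^-1 * (C * `|w| * (L * `|v|) * fine (mu K)))//; ring.
apply/cvgr0Pnorm_le => e e0.
have hc : harmonic k * c @[k --> \oo] --> (0 : R).
  by rewrite -(mul0r c); apply: cvgM; [exact: cvg_harmonic|exact: cvg_cst].
move/cvgr0Pnorm_le : hc => /(_ e e0); apply: filterS => k hk.
apply: le_trans (main k) _; apply: le_trans hk; exact: ler_norm.
Qed.

Let mdelta : measurable_fun H delta.
Proof.
exact: measurable_fun_cvg (fun k => measurable_funTS (mdelta_ k)) delta_cvg.
Qed.

Let delta_le0 x : H x -> `|delta x| <= 2 * (L * `|v|).
Proof.
move=> Hx; apply: (ler_cvg_to (cvg_norm (delta_cvg Hx)) (cvg_cst (2 * (L * `|v|)))).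
by near=> k; exact: delta_le.
Unshelve. all: end_near. Qed.

(* Testing the additivity defect against [chi * delta_ m], which is itself
   Lipschitz with bounded support, avoids any density argument. *)
Let delta_ae0_in (M : nat) : {ae mu, forall x, H x -> `|x| < M%:R -> delta x = 0}.
Proof.
pose chi (x : E) : R := Num.max 0 (M%:R - `|x|).
have chi_ge0 x : 0 <= chi x by rewrite /chi le_max lexx.
have chi_lip x y : `|chi x - chi y| <= 1 * `|x - y|.
  rewrite mul1r /chi.
  have h : `|(M%:R - `|x| : R) - (M%:R - `|y|)| <= `|x - y|.
    have -> : (M%:R - `|x| : R) - (M%:R - `|y|) = `|y| - `|x| by ring.
    by rewrite distrC; exact: ler_dist_dist.
  apply: le_trans h.
  move: (M%:R - `|x|) (M%:R - `|y|) => a b.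
  rewrite /Num.max; case: ltP => a0; case: ltP => b0.
  - by [].
  - by rewrite subr0 !ger0_norm//; lra.
  - by rewrite sub0r normrN [leRHS]distrC !ger0_norm//; lra.
  - by rewrite subrr normr0.
have chi_le x : `|chi x| <= M%:R.
  by rewrite ger0_norm// /chi ge_max ler0n/= gerBl.
have chi0 x : ~ cube 0 M%:R x -> chi x = 0.
  rewrite /cube/= subr0 => /negP; rewrite -ltNge => xM.
  by rewrite /chi max_l// subr_le0 ltW.
pose B := 2 * (L * `|v|).
have B0 : 0 <= B by rewrite mulr_ge0// phi_lip_ge0.
(* The Lipschitz constant of this test function grows with [m], but the integral is exactly 0 for
   each [m], so that the limit, the integral of [chi * delta ^+ 2], is 0 too. *)
have step m : (\int[mu]_(x in H) (chi x * delta_ m x * delta x))%R = 0.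
  apply: (@weak_additive _ (1 * B + M%:R * (2 * (m.+1%:R * (2 * L)))) (M%:R * B) M%:R).
  - move=> x y.
    have -> : chi x * delta_ m x - chi y * delta_ m y =
      (chi x - chi y) * delta_ m x + chi y * (delta_ m x - delta_ m y) by ring.
    apply: le_trans (ler_normD _ _) _; rewrite !normrM mulrDl.
    apply: lerD; first by rewrite mulrAC ler_pM.
    by rewrite -mulrA ler_pM.
  - by move=> x; rewrite normrM ler_pM.
  - by move=> x /chi0 ->; rewrite mul0r.
have mchi : measurable_fun setT chi.
  by apply: continuous_measurable_rV; exact: lipschitz_rV_continuous chi_lip.
have mg m : measurable_fun H (fun x => chi x * delta_ m x * delta x).
  apply: measurable_funM => //; apply: measurable_funM; exact: measurable_funTS.
have Ki := integrable_cst_indic (M%:R * B * B) mH (measurable_cube (0 : E) M%:R)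
  (lebesgue_rV_cube_lty (0 : E) M%:R).
pose g x := chi x * delta x * delta x.
have [x Hx|m x Hx|fi hcv] := Rdominated_convergence mH mg (f := g) _ Ki.
- apply: cvgM; last exact: cvg_cst.
  by apply: cvgM; [exact: cvg_cst|exact: delta_cvg].
- rewrite indicE; case: (boolP (x \in _)) => [_|/negP xM].
    by rewrite mulr1 !normrM ler_pM ?mulr_ge0 ?ler_pM ?delta_le0.
  by rewrite chi0 ?mul0r ?normr0 ?mulr0// => h; apply: xM; rewrite inE.
have I0 : (\int[mu]_(x in H) (chi x * delta x * delta x))%R = 0.
  rewrite -(cvg_lim _ hcv)//; apply: lim_near_cst => //.
  by near=> m; exact: step.
have f0 x : 0 <= g x.
  by rewrite /g -mulrA mulr_ge0// -expr2 sqr_ge0.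
have mf : measurable_fun H (EFin \o g).
  by case/integrableP : fi.
have := (ae_eq_integral_abs mu mH mf).1.
have -> : (\int[mu]_(x in H) `|(EFin \o g) x| = 0)%E.
  transitivity (\int[mu]_(x in H) (g x)%:E)%E.
    by apply: eq_integral => x _ /=; rewrite ger0_norm.
  by rewrite -[LHS]fineK ?integrable_fin_num// -/(Rintegral _ _ _) I0.
move=> /(_ erefl); apply: filterS => x h Hx xM.
have := h Hx => /= -[] /eqP; rewrite mulf_eq0 => /orP[|/eqP//].
rewrite mulf_eq0 => /orP[|/eqP//]; rewrite /chi max_r ?subr_ge0 ?(ltW xM)//.
by rewrite subr_eq0 => /eqP xM'; rewrite -xM' ltxx in xM.
Unshelve. all: end_near. Qed.

Lemma derive_additive_ae : {ae mu, forall x, dir_diff v x -> dir_diff w x ->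
  dir_diff (v + w) x -> 'D_(v + w) phi x = 'D_v phi x + 'D_w phi x}.
Proof.
have : {ae mu, forall x (M : nat), H x -> `|x| < M%:R -> delta x = 0}.
  by apply/ae_foralln => M; exact: delta_ae0_in.
apply: filterS => x h hv hw hvw.
have := h (Num.bound `|x|) (conj (conj hv hw) hvw); rewrite archi_boundP// => /(_ erefl).
by rewrite /delta -addrA -opprD => /eqP; rewrite subr_eq0 => /eqP.
Qed.
End additivity.

Lemma dotvBr m (p a b : 'rV[R]_m) : dotv p (a - b) = dotv p a - dotv p b.
Proof. by rewrite /dotv -sumrB; apply: eq_bigr => i _; rewrite !mxE mulrBr. Qed.

Lemma dotvDr m (p a b : 'rV[R]_m) : dotv p (a + b) = dotv p a + dotv p b.
Proof. by rewrite /dotv -big_split; apply: eq_bigr => i _; rewrite !mxE mulrDr. Qed.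

Lemma dotvZr m (p a : 'rV[R]_m) k : dotv p (k *: a) = k * dotv p a.
Proof. by rewrite /dotv mulr_sumr; apply: eq_bigr => i _; rewrite !mxE mulrCA. Qed.

Lemma dotvC m (p a : 'rV[R]_m) : dotv p a = dotv a p.
Proof. by apply: eq_bigr => i _; rewrite mulrC. Qed.

Lemma dir_diffP v x : dir_diff v x -> forall e, 0 < e -> exists2 r, 0 < r &
  forall s : R, `|s| <= r -> `|phi (x + s *: v) - phi x - s * 'D_v phi x| <= e * `|s|.
Proof.
move=> hv e e0; have dv := lin_diff_derivable hv.
have : h^-1 *: (phi (h *: v + x) - phi x) @[h --> 0^'] --> 'D_v phi x by exact: dv.
move=> /cvgrPdist_le/(_ e e0) [r /= r0 hr].
exists (r / 2); first exact: divr_gt0.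
move=> s sr; have [->|s0] := eqVneq s 0.
  by rewrite scale0r addr0 subrr mul0r subr0 normr0 mulr0.
have := hr s; rewrite /= sub0r normrN => /(_ _ s0).
have ls : `|s| < r by apply: le_lt_trans sr _; lra.
move=> /(_ ls) h; rewrite [x + _]addrC.
have -> : phi (s *: v + x) - phi x - s * 'D_v phi x =
  - (s * ('D_v phi x - s^-1 * (phi (s *: v + x) - phi x))).
  by rewrite mulrBr mulVKf// opprB mulrC.
by rewrite normrN normrM mulrC ler_wpM2r.
Qed.

Lemma deriveZ_dir a v x : dir_diff v x -> dir_diff (a *: v) x ->
  'D_(a *: v) phi x = a * 'D_v phi x.
Proof.
move=> hv hav.
have h1 := derivable_cvg_seq (lin_diff_derivable hav).
suff h2 : k.+1%:R * (phi (x + k.+1%:R^-1 *: (a *: v)) - phi x) @[k --> \oo] --> a * 'D_v phi x.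
  by rewrite -(cvg_lim _ h1)//; apply/cvg_lim.
apply/cvgrPdist_le => e e0.
(* Adding 1 spares a separate treatment of [a = 0]. *)
have a1 : 0 < `|a| + 1 by rewrite ltr_wpDl.
have [r r0 hr] := dir_diffP hv (divr_gt0 e0 a1).
near=> k; have k0 : 0 < k.+1%:R :> R by [].
have ak : `|k.+1%:R^-1 * a| <= r.
  rewrite normrM gtr0_norm ?invr_gt0//.
  have : k.+1%:R^-1 * (`|a| + 1) < r.
    rewrite -ltr_pdivlMr//; near: k.
    exact: near_infty_natSinv_lt (PosNum (divr_gt0 r0 a1)).
  move=> /ltW; apply: le_trans; rewrite ler_wpM2l ?invr_ge0 ?(ltW k0)//.
  by rewrite lerDl.
have := hr _ ak; rewrite scalerA => h.
rewrite distrC.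
have -> : k.+1%:R * (phi (x + (k.+1%:R^-1 * a) *: v) - phi x) - a * 'D_v phi x =
  k.+1%:R * (phi (x + (k.+1%:R^-1 * a) *: v) - phi x - k.+1%:R^-1 * a * 'D_v phi x).
  have aux (b c D : R) : c != 0 -> c * b - a * D = c * (b - c^-1 * a * D).
    by move=> c0; field.
  by apply: aux; rewrite gt_eqF.
rewrite normrM gtr0_norm// mulrC -ler_pdivlMr//.
apply: le_trans h _.
rewrite normrM gtr0_norm ?invr_gt0//.
rewrite [leLHS](_ : _ = e / k.+1%:R * (`|a| / (`|a| + 1))); last by ring.
rewrite ler_piMr ?divr_ge0 ?(ltW e0) ?(ltW k0)//.
by rewrite ler_pdivrMr// mul1r lerDl.
Unshelve. all: end_near. Qed.

(** Rational directions are dense and countably many, so their exceptional null sets can be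
    united. *)
Definition ratv (q : 'rV[rat]_d) : E := map_mx ratr q.

Lemma ratvD q q' : ratv (q + q') = ratv q + ratv q'.
Proof. by apply/rowP => i; rewrite !mxE rmorphD. Qed.

Lemma ratv0 : ratv 0 = 0.
Proof. by apply/rowP => i; rewrite !mxE rmorph0. Qed.

Lemma ratvZ a q : ratv (a *: q) = ratr a *: ratv q.
Proof. by apply/rowP => i; rewrite !mxE rmorphM. Qed.

Lemma ratv_delta i : ratv (delta_mx 0 i) = evec i.
Proof. by apply/rowP => j; rewrite !mxE; case: (_ && _); rewrite ?rmorph0 ?rmorph1. Qed.

Section good_point.
Variable x : E.
Hypothesis hd : forall q, dir_diff (ratv q) x.
Hypothesis hadd : forall q q', 'D_(ratv q + ratv q') phi x = 'D_(ratv q) phi x + 'D_(ratv q') phi x.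

Let derive_ratv q : 'D_(ratv q) phi x = dotv (grad phi x) (ratv q).
Proof.
rewrite [in LHS](row_sum_delta q) /dotv.
elim/big_rec2 : _ => [|i a v _ IH]; first by rewrite ratv0 derive0.
rewrite ratvD hadd IH; congr (_ + _).
rewrite ratvZ deriveZ_dir -?ratvZ// ratv_delta !mxE mulrC; congr (_ * _).
Qed.

(** Along rational directions the derivative is the linear form of the gradient. A direction of the
    unit cube is close to a rational one, and replacing it costs a small multiple of the step
    because [phi] is Lipschitz; compactness of the unit cube then gives one radius for all
    directions. *)
Lemma good_point_lin_diff : lin_diff (1%:M : 'M[R]_(d, d)) `|L| x.
Proof.
apply/lin_diffP => e e0.
pose p := grad phi x.
have pL : `|p| <= `|L|.
  apply/rV_norm_le => // i; rewrite mxE.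
  have := derive_lip_le (lin_diff_derivable (hd (delta_mx 0 i))).
  rewrite ratv_delta => /le_trans; apply.
  apply: (@le_trans _ _ (`|L| * `|evec i|)); first by rewrite ler_wpM2r// ler_norm.
  rewrite ler_piMr//; apply/rV_norm_le => // j.
  by rewrite !mxE; case: (_ && _); rewrite ?normr0 ?normr1.
pose K := cube (0 : E) 1.
have cK : compact K.
  apply: bounded_closed_compact.
    exists 1; split; [exact: num_real|move=> C BC y /=].
    by rewrite /K/cube/= subr0 => /le_trans; apply; exact: ltW.
  have -> : K = (fun y : E => `|y|) @^-1` [set t | t <= 1].
    by apply/seteqP; split => y; rewrite /K/cube/= subr0.
  apply: closed_comp => [y _|]; [exact: norm_continuous|exact: closed_le].
pose good (s : R) (u : E) := `|phi (x + s *: u) - phi x - s * dotv p u| <= e * `|s|.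
(* Lipschitz constants of [phi] and of [dotv p] for the sup norm; the summand 1 makes [A] positive.
   Below, [eta] is such that [A * eta = e / 2]. *)
pose A := `|L| + d%:R * `|p| + 1.
have A0 : 0 < A by rewrite /A ltr_wpDl// addr_ge0// mulr_ge0.
have step u : K u -> \forall u' \near u & s \near nbhs (0 : R), good s u'.
  move=> Ku.
  pose eta := e / 2 / A.
  have eta0 : 0 < eta by rewrite !divr_gt0.
  have eta20 : 0 < eta / 2 by rewrite divr_gt0.
  have [q uq] := rV_rat_approx u eta20.
  have e20 : 0 < e / 2 by rewrite divr_gt0.
  have [r r0 hr] := dir_diffP (hd q) e20.
  exists (ball u (eta / 2), ball 0 r).
    by split; apply: nbhsx_ballx.
  move=> [u' s] /= [uu' sr].
  have u'q : `|u' - ratv q| <= eta.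
    rewrite (_ : u' - ratv q = (u - ratv q) - (u - u')); last first.
      by rewrite opprB [RHS]addrC addrA subrK.
    apply: le_trans (ler_normB _ _) _.
    move: uu'; rewrite -ball_normE/= => /ltW uu'.
    by rewrite (splitr eta) lerD.
  have sr' : `|s| <= r by move: sr; rewrite -ball_normE/= sub0r normrN => /ltW.
  have h1 := hr s sr'.
  have h2 : `|phi (x + s *: u') - phi (x + s *: ratv q)| <= `|L| * (`|s| * eta).
    apply: le_trans (phiL _ _) _; rewrite opprD addrACA subrr add0r -scalerBr normrZ.
    apply: (@le_trans _ _ (`|L| * (`|s| * `|u' - ratv q|))).
      by rewrite ler_wpM2r// ?ler_norm// mulr_ge0.
    by rewrite ler_wpM2l// ler_wpM2l.
  have h3 : `|s * dotv p (ratv q) - s * dotv p u'| <= d%:R * `|p| * (`|s| * eta).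
    rewrite -mulrBr.
    have -> : dotv p (ratv q) - dotv p u' = - dotv p (u' - ratv q).
      by rewrite dotvBr opprB.
    rewrite normrM normrN mulrCA ler_wpM2l//.
    apply: le_trans (dotv_abs_le _ _) _; rewrite -mulrA.
    by rewrite ler_wpM2l// ler_wpM2l.
  rewrite /good (_ : _ - _ = (phi (x + s *: u') - phi (x + s *: ratv q)) +
    (phi (x + s *: ratv q) - phi x - s * dotv p (ratv q)) +
    (s * dotv p (ratv q) - s * dotv p u')); last by ring.
  apply: le_trans (ler_normD _ _) _.
  apply: le_trans (lerD (ler_normD _ _) h3) _.
  rewrite -derive_ratv.
  apply: le_trans (lerD (lerD h2 h1) (lexx _)) _.
  rewrite [leLHS](_ : _ = `|s| * ((`|L| + d%:R * `|p|) * eta + e / 2)); last by ring.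
  rewrite mulrC ler_wpM2r//.
  rewrite [leRHS](splitr e) lerD2r.
  apply: (@le_trans _ _ (A * eta)).
    by rewrite ler_wpM2r ?(ltW eta0)// /A lerDl.
  by rewrite /eta mulrC divfK// gt_eqF.
have := (compact_near_coveringP K).1 cK R (nbhs (0 : R)) good (nbhs_filter _) step.
move=> [r /= r0 hr]; exists (r / 2); first exact: divr_gt0.
exists p => // t tr; rewrite mulmx1.
have [->|t0] := eqVneq t 0.
  rewrite addr0 subrr sub0r normr0 mulr0 normrN.
  by apply: le_trans (dotv_abs_le _ _) _; rewrite normr0 !mulr0.
have nt0 : 0 < `|t| by rewrite normr_gt0.
have tE : t = `|t| *: (`|t|^-1 *: t) by rewrite scalerA divff ?scale1r// gt_eqF.
have := hr `|t|; rewrite /= sub0r normrN normr_id => /(_ _ (`|t|^-1 *: t)).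
have tr' : `|t| < r by apply: le_lt_trans tr _; lra.
move=> /(_ tr'); rewrite /K/cube/= subr0 normrZ normfV normr_id mulVf ?gt_eqF//.
move=> /(_ (lexx _)); rewrite /good -tE normr_id.
have -> // : `|t| * dotv p (`|t|^-1 *: t) = dotv p t.
by rewrite dotvZr mulVKf// gt_eqF.
Qed.
End good_point.

Lemma ae_forall_countable (I : countType) (P : I -> E -> Prop) :
  (forall i, {ae mu, forall x, P i x}) -> {ae mu, forall x i, P i x}.
Proof.
move=> h.
have : {ae mu, forall x (n : nat), if unpickle n is Some i then P i x else True}.
  apply/ae_foralln => n; case: (unpickle n) => [i|]; first exact: h.
  by apply: aeW.
by apply: filterS => x hx i; have := hx (pickle i); rewrite pickleK.
Qed.

Lemma ae_null (A : set E) : mu (~` A) = 0%E -> measurable A -> {ae mu, forall x, A x}.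
Proof. by move=> A0 mA; exists (~` A); split => //; exact: measurableC. Qed.

(** Countably many conditions, one for each rational direction and one for each pair of them, hold
    together almost everywhere, and they make a point good. *)
Lemma rademacher : mu (~` lin_diff (1%:M : 'M[R]_(d, d)) `|L|) = 0%E.
Proof.
have h1 : {ae mu, forall x (q : 'rV[rat]_d), dir_diff (ratv q) x}.
  apply: ae_forall_countable => q; apply: ae_null; first exact: mu_nderivable.
  exact: measurable_dir_diff.
have h2 : {ae mu, forall x (qq : 'rV[rat]_d * 'rV[rat]_d),
    dir_diff (ratv qq.1) x -> dir_diff (ratv qq.2) x ->
    dir_diff (ratv qq.1 + ratv qq.2) x ->
    'D_(ratv qq.1 + ratv qq.2) phi x = 'D_(ratv qq.1) phi x + 'D_(ratv qq.2) phi x}.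
  by apply: ae_forall_countable => -[q q']; exact: derive_additive_ae.
have : {ae mu, forall x, lin_diff (1%:M : 'M[R]_(d, d)) `|L| x}.
  near=> x; apply: good_point_lin_diff.
    by near: x; exact: h1.
  move=> q q'.
  have hx := near h1 x; have hx2 := near h2 x.
  by apply: (hx2 _ (q, q')) => //=; rewrite -?ratvD; exact: hx.
move=> [N [mN N0 subN]].
apply: (subset_measure0 _ mN) => //.
by apply: measurableC; exact: measurable_lin_diff.
Unshelve. all: end_near. Qed.

Lemma lin_approx_coord (B e r : R) i y : lin_approx (1%:M : 'M[R]_(d, d)) B e r y ->
  lin_approx (evec i : 'M[R]_(1, d)) B e r y.
Proof.
move=> [p pB hp]; exists (const_mx (p 0 i)).
  by rewrite rV1_norm mxE (le_trans (rV_norm_coord _ _)).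
move=> t tr.
have nt : `|t 0 0 *: (evec i : E)| = `|t|.
  rewrite normrZ rV1_norm; set n := `|evec i|; suff -> : n = 1 by rewrite mulr1.
  apply/eqP; rewrite eq_le; apply/andP; split.
    apply/rV_norm_le => // j.
    by rewrite !mxE; case: (_ && _); rewrite ?normr0 ?normr1.
  by have := rV_norm_coord (evec i : E) i; rewrite !mxE !eqxx normr1.
have := hp (t 0 0 *: evec i); rewrite nt mulmx1 rV1_mul => /(_ tr).
have -> // : dotv p (t 0 0 *: evec i) = dotv (const_mx (p 0 i)) t.
rewrite dotv1 mxE dotvZr mulrC; congr (_ * _).
rewrite /dotv (bigD1 i)//= big1 ?addr0 => [|j ji].
  by rewrite !mxE !eqxx mulr1.
by rewrite !mxE (negbTE ji) andbF mulr0.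
Qed.

(** The slope [p] valid up to scale [r] need not be the gradient. Along each basis vector,
    comparison with the partial derivative at tiny scales shows that the coordinates differ by at
    most [e], which adds [d%:R * e] to the error. *)
Lemma lin_approx_grad (B e r : R) y : 0 <= e -> 0 < r ->
  lin_diff (1%:M : 'M[R]_(d, d)) B y -> lin_approx (1%:M : 'M[R]_(d, d)) B e r y ->
  forall t, `|t| <= r ->
    `|phi (y + t) - phi y - dotv (grad phi y) t| <= (1 + d%:R) * e * `|t|.
Proof.
move=> e0 r0 hy [p pB hp] t tr.
have grad_p i : `|p 0 i - grad phi y 0 i| <= e.
  rewrite mxE /pderiv.
  have hyi : lin_diff (evec i : 'M[R]_(1, d)) B y.
    by move=> k _; have [n _ hn] := hy k Logic.I; exists n => //; exact: lin_approx_coord.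
  have dvi := lin_diff_derivable hyi.
  apply/ler_addgt0Pr => e' e'0.
  have [s0 s00 hs] := dir_diffP (derivable_lin_diff dvi) e'0.
  pose s := Num.min s0 r.
  have sp : 0 < s by rewrite lt_min s00.
  have ss0 : `|s| <= s0 by rewrite gtr0_norm// ge_min lexx.
  have h1 := hs s ss0.
  have ei1 : `|evec i : E| = 1.
    apply/eqP; rewrite eq_le; apply/andP; split.
      apply/rV_norm_le => // j.
      by rewrite !mxE; case: (_ && _); rewrite ?normr0 ?normr1.
    by have := rV_norm_coord (evec i : E) i; rewrite !mxE !eqxx normr1.
  have := hp (s *: evec i); rewrite normrZ ei1 mulr1 mulmx1.
  have sr : `|s| <= r by rewrite gtr0_norm// ge_min lexx orbT.
  move=> /(_ sr); rewrite dotvZr.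
  have -> : dotv p (evec i) = p 0 i.
    rewrite /dotv (bigD1 i)//= big1 ?addr0 => [|j ji].
      by rewrite !mxE !eqxx mulr1.
    by rewrite !mxE (negbTE ji) andbF mulr0.
  move=> h2; have := lerD h1 h2; rewrite -mulrDl.
  move=> /(le_trans (ler_normB _ _)).
  have aux (a b c D P : R) : a - b - c * D - (a - b - c * P) = c * (P - D) by ring.
  rewrite (aux _ _ _ _ _) normrM mulrC ler_pM2r ?normr_gt0 ?gt_eqF//.
  by rewrite [e' + e]addrC.
have -> : phi (y + t) - phi y - dotv (grad phi y) t =
   (phi (y + t *m 1%:M) - phi y - dotv p t) + dotv (p - grad phi y) t.
  by rewrite mulmx1 ![dotv _ t]dotvC dotvBr; ring.
apply: le_trans (ler_normD _ _) _.
rewrite -mulrA mulrDl mul1r; apply: lerD; first exact: hp.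
apply: le_trans (dotv_abs_le _ _) _; rewrite ler_wpM2l// ler_wpM2r//.
by apply/rV_norm_le => // i; rewrite !mxE; have := grad_p i; rewrite mxE.
Qed.

Lemma lin_diff_differentiable B y : lin_diff (1%:M : 'M[R]_(d, d)) B y ->
  differentiable phi y.
Proof.
move=> hy.
have lin_p : linear (dotv (grad phi y)).
  by move=> a u v; rewrite dotvDr dotvZr.
pose ell : {linear E -> R} := HB.pack (dotv (grad phi y))
  (GRing.isLinear.Build _ _ _ _ (dotv (grad phi y)) lin_p).
have cell : continuous ell.
  suff -> : (ell : E -> R) = (fun t => dotv t (grad phi y)) by exact: dotv_continuous.
  by apply/funext => t; rewrite -[ell t]/(dotv (grad phi y) t) dotvC.
have ellP : forall e, 0 < e -> \forall t \near (0 : E),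
    `|phi (t + y) - (phi y + ell t)| <= e * `|t|.
  move=> _/posnumP[e].
  have d1 : 0 < 1 + d%:R :> R by rewrite ltr_pwDl.
  have [r r0 hr] := (lin_diffP _ _ _).1 hy _ (divr_gt0 [gt0 of e%:num] d1).
  have e0 : 0 <= e%:num / (1 + d%:R) by rewrite divr_ge0// ltW.
  near=> t.
  have tr : `|t| <= r.
    near: t; have := @cvgr0_norm_le _ _ _ (nbhs (0 : E)) _ id (@cvg_id _ (nbhs (0 : E))).
    by apply.
  have := lin_approx_grad e0 r0 hy hr tr.
  rewrite mulrC [_ * (_ / _)]mulrC divfK ?gt_eqF// [e%:num * _]mulrC.
  by rewrite [t + y]addrC opprD addrA [leRHS]mulrC.
have dE : 'd phi y = ell :> (E -> R).
  by apply: diff_unique => //; apply/eqaddoP; exact: ellP.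
apply/diff_locallyP; rewrite dE; split=> //; apply/eqaddoP; exact: ellP.
Unshelve. all: end_near. Qed.
End rademacher.

(** * Localized fluxes *)

Section line_derivative.
Context {R : realType} {d : nat}.
Local Notation E := 'rV[R]_d.
Implicit Types (f : E -> R) (x w : E).

Lemma is_derive_line f x w (t : R) : derivable f (x + t *: w) w ->
  is_derive t (1 : R) (fun s : R => f (x + s *: w)) ('D_w f (x + t *: w)).
Proof.
have qE : (fun h : R => h^-1 *: (f (x + (h *: 1 + t) *: w) - f (x + t *: w))) =
   (fun h => h^-1 *: (f (h *: w + (x + t *: w)) - f (x + t *: w))).
  apply/funext => h; congr (_ *: (f _ - _)).
  by rewrite [h *: 1]mulr1 scalerDl addrCA.
move=> df; split.
  by rewrite /derivable/= qE; exact: df.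
by rewrite /derive/= qE.
Qed.

(** Transfers a directional derivative to one real variable, where the product and chain rules can
    be applied mechanically. *)
Lemma is_derive_along f x w D : is_derive (0 : R) (1 : R) (fun s : R => f (x + s *: w)) D ->
  is_derive x w f D.
Proof.
have qE : (fun h : R => h^-1 *: (f (x + (h *: 1 + 0) *: w) - f (x + 0 *: w))) =
   (fun h => h^-1 *: (f (h *: w + x) - f x)).
  apply/funext => h; congr (_ *: (f _ - f _)); last by rewrite scale0r addr0.
  by rewrite [h *: 1]mulr1 addr0 addrC.
move=> [df dE]; split.
  by move: df; rewrite /derivable/= qE.
by move: dE; rewrite /derive/= qE.
Qed.

Lemma le_line_derivative f x w (C h : R) :
  (forall t, derivable f (x + t *: w) w) ->
  (forall t, `|'D_w f (x + t *: w)| <= C) ->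
  `|f (x + h *: w) - f x| <= C * `|h|.
Proof.
move=> df dC.
pose g (s : R) := f (x + s *: w).
have dg t : is_derive t (1 : R) g ('D_w f (x + t *: w)) by exact: is_derive_line.
have cg : continuous g.
  move=> t; apply: differentiable_continuous.
  by apply/derivable1_diffP; case: (dg t).
have gh : g h = f (x + h *: w) by [].
have g0 : g 0 = f x by rewrite /g scale0r addr0.
rewrite -gh -g0.
have main a b : a <= b -> `|g b - g a| <= C * `|b - a|.
  move=> ab.
  have [t _ ->] := MVT_segment ab (fun t _ => dg t) (continuous_subspaceT cg).
  by rewrite normrM ler_wpM2r.
have [h0|h0] := leP 0 h; first by have := main _ _ h0; rewrite subr0.
by have := main _ _ (ltW h0); rewrite sub0r normrN distrC.
Qed.

End line_derivative.

(** * A bump function of class C^1 with explicit gradient *)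

Section bump.
Context {R : realType} {d : nat}.
Local Notation E := 'rV[R]_d.

Definition sqpos (u : R) : R := (Num.max 0 u) ^+ 2.

Lemma sqpos_taylor (u h : R) :
  `|sqpos (u + h) - sqpos u - 2 * Num.max 0 u * h| <= h ^+ 2.
Proof.
rewrite /sqpos /Num.max; case: ltP => a; case: ltP => b.
- by rewrite (_ : _ - _ = h ^+ 2) ?ger0_norm ?sqr_ge0//; ring.
- rewrite expr0n/= mulr0 mul0r !subr0 ger0_norm ?sqr_ge0//.
  by rewrite lerXn2r ?nnegrE; lra.
- rewrite expr0n/= sub0r -opprD normrN.
  rewrite ler_norml; apply/andP; split; last by nra.
  by have := sqr_ge0 (u + h); nra.
- by rewrite expr0n/= mulr0 mul0r !subr0 normr0 sqr_ge0.
Qed.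

Lemma is_derive_sqpos (u : R) : is_derive u (1 : R) sqpos (2 * Num.max 0 u).
Proof.
have cv : h^-1 *: (sqpos (h *: 1 + u) - sqpos u) @[h --> 0^'] --> 2 * Num.max 0 u.
  apply/cvgrPdist_le => e e0; near=> h.
  have h0 : h != 0 by near: h; exact: nbhs_dnbhs_neq.
  have he : `|h| <= e.
    near: h; apply: nbhs_dnbhs.
    by have := @cvgr0_norm_le _ _ _ (nbhs (0 : R)) _ id (@cvg_id _ (nbhs (0 : R))); apply.
  rewrite [h *: 1]mulr1 [h + u]addrC.
  have -> : 2 * Num.max 0 u - h^-1 *: (sqpos (u + h) - sqpos u) =
     - (h^-1 * (sqpos (u + h) - sqpos u - 2 * Num.max 0 u * h)).
    by rewrite /GRing.scale/=; field.
  rewrite normrN normrM normfV.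
  apply: le_trans he; rewrite ler_pdivrMl ?normr_gt0// -expr2 real_normK ?num_real//.
  exact: sqpos_taylor.
split; first by apply/cvg_ex; exists (2 * Num.max 0 u).
exact: cvg_lim cv.
Unshelve. all: end_near. Qed.

(** Supported in the Euclidean ball of radius [r], of size at most r^4 with gradient of order r^3.
    Squaring the positive part is enough to make it C^1. *)
Definition bump (r : R) (s : E) : R := sqpos (r ^+ 2 - dotv s s).

Lemma dotvv_ge0 (s : E) : 0 <= dotv s s.
Proof. by apply: sumr_ge0 => i _; rewrite -expr2 sqr_ge0. Qed.

Lemma sqr_norm_le_dotv (s : E) : `|s| ^+ 2 <= dotv s s.
Proof.
have h : `|s| <= Num.sqrt (dotv s s).
  apply/rV_norm_le => [|i]; first exact: sqrtr_ge0.
  rewrite -sqrtr_sqr ler_sqrt ?dotvv_ge0// /dotv (bigD1 i)//= -expr2 lerDl.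
  by apply: sumr_ge0 => j _; rewrite -expr2 sqr_ge0.
rewrite -[leRHS](sqr_sqrtr (dotvv_ge0 s)) lerXn2r ?nnegrE ?sqrtr_ge0//.
Qed.

(** Along a line [r ^+ 2 - dotv s s] is a quadratic polynomial [g], and the chain rule with [sqpos]
    applies. *)
Lemma is_derive_bump (r : R) (s w : E) :
  is_derive s w (bump r) (- 4 * Num.max 0 (r ^+ 2 - dotv s s) * dotv s w).
Proof.
apply: is_derive_along.
pose g (t : R) := (r ^+ 2 - dotv s s) + t * (- 2 * dotv s w) + t ^+ 2 * (- dotv w w).
have gE t : r ^+ 2 - dotv (s + t *: w) (s + t *: w) = g t.
  rewrite /g !(dotvDr, dotvZr) [dotv (_ + _) s]dotvC [dotv (_ + _) w]dotvC.
  by rewrite !(dotvDr, dotvZr) [dotv w s]dotvC; ring.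
have -> : (fun t : R => bump r (s + t *: w)) = sqpos \o g.
  by apply/funext => t; rewrite /bump gE.
have dg : is_derive (0 : R) (1 : R) g (- 2 * dotv s w).
  apply: is_derive_eq.
  rewrite /GRing.scale/=; ring.
have := is_derive1_comp (is_derive_sqpos (g 0)) dg.
have -> : 2 * Num.max 0 (g 0) * (- 2 * dotv s w) =
  - 4 * Num.max 0 (r ^+ 2 - dotv s s) * dotv s w; last by [].
by rewrite /g mul0r expr0n/= mul0r !addr0; ring.
Qed.

Lemma bump_ge0 r s : 0 <= bump r s. Proof. exact: sqr_ge0. Qed.

Lemma bump_out r s : 0 <= r -> r < `|s| -> bump r s = 0.
Proof.
move=> r0 rs; rewrite /bump /sqpos max_l ?expr0n//.
rewrite subr_le0; apply: le_trans (sqr_norm_le_dotv s).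
by rewrite lerXn2r ?nnegrE//; exact: ltW.
Qed.

Lemma bump_le r s : `|bump r s| <= r ^+ 4.
Proof.
rewrite ger0_norm ?bump_ge0// /bump /sqpos.
have -> : r ^+ 4 = (r ^+ 2) ^+ 2 by rewrite -exprM.
rewrite lerXn2r ?nnegrE ?sqr_ge0 ?le_max ?lexx// ge_max sqr_ge0/=.
by rewrite gerBl dotvv_ge0.
Qed.

Lemma derive_bump_le r s w : 0 <= r ->
  `|'D_w (bump r) s| <= 4 * d%:R * r ^+ 3 * `|w|.
Proof.
move=> r0; rewrite (derive_val (is_derive := is_derive_bump r s w)).
rewrite !normrM normrN [`|4|]ger0_norm//.
have [h|h] := leP `|s| r; last first.
  rewrite max_l ?normr0 ?mulr0 ?mul0r ?mulr_ge0 ?exprn_ge0//.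
  rewrite subr_le0; apply: le_trans (sqr_norm_le_dotv s).
  by rewrite lerXn2r ?nnegrE//; exact: ltW.
have h1 : `|Num.max 0 (r ^+ 2 - dotv s s)| <= r ^+ 2.
  rewrite ger0_norm ?le_max ?lexx// ge_max sqr_ge0/=.
  by rewrite gerBl dotvv_ge0.
have h2 : `|dotv s w| <= d%:R * (r * `|w|).
  by apply: le_trans (dotv_abs_le _ _) _; rewrite ler_wpM2l// ler_wpM2r.
rewrite [leRHS](_ : _ = 4 * r ^+ 2 * (d%:R * (r * `|w|))); last by ring.
by apply: ler_pM => //; rewrite ?mulr_ge0// ler_wpM2l.
Qed.

(** On this cube [dotv s s] is at most [d%:R] times the square of the radius, hence at most
    [r ^+ 2 / 2]. Using [d.+1] instead of [d] keeps the radius meaningful in dimension 0. *)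
Lemma bump_lb r s : 0 <= r -> `|s| <= r / (2 * d.+1%:R) -> (r ^+ 2 / 2) ^+ 2 <= bump r s.
Proof.
move=> r0 sr; rewrite /bump /sqpos lerXn2r ?nnegrE ?le_max ?lexx//.
  by rewrite divr_ge0 ?sqr_ge0.
apply/orP; right.
have : dotv s s <= r ^+ 2 / 2.
  apply: le_trans (ler_norm _) _; apply: le_trans (dotv_abs_le _ _) _.
  rewrite -expr2.
  have h : `|s| ^+ 2 <= (r / (2 * d.+1%:R)) ^+ 2 by rewrite lerXn2r ?nnegrE// divr_ge0.
  apply: (@le_trans _ _ (d%:R * (r / (2 * d.+1%:R)) ^+ 2)); first by rewrite ler_wpM2l.
  rewrite expr_div_n mulrCA ler_wpM2l ?sqr_ge0//.
  have d1 : d.+1%:R = d%:R + 1 :> R by rewrite -natr1.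
  have d0 : 0 <= d%:R :> R by [].
  rewrite ler_pdivrMr ?exprn_gt0 ?mulr_gt0// d1; nra.
lra.
Qed.

Lemma bumpN r s : bump r (- s) = bump r s.
Proof. by rewrite /bump; congr (sqpos (_ - _)); apply: eq_bigr => i _; rewrite !mxE mulrNN. Qed.

Lemma bump_lipschitz r s w h : 0 <= r ->
  `|bump r (s + h *: w) - bump r s| <= 4 * d%:R * r ^+ 3 * `|w| * `|h|.
Proof.
move=> r0; apply: le_line_derivative => t; last exact: derive_bump_le.
by case: (is_derive_bump r (s + t *: w) w).
Qed.

Lemma bump_continuous r : 0 <= r -> continuous (bump r).
Proof.
move=> r0; apply: (@lipschitz_rV_continuous _ _ _ (4 * d%:R * r ^+ 3)) => x y.
have := @bump_lipschitz r y (x - y) 1 r0.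
by rewrite scale1r subrKC normr1 mulr1.
Qed.
End bump.

(** * Localized fluxes and their average over the centre *)

Section mollified_divergence.
Context {R : realType} {d : nat}.
Local Notation E := 'rV[R]_d.
Local Notation mu := (lebesgue_rV d).

Lemma measurable_derive (f : E -> R) (w : E) : measurable_fun setT f ->
  (forall x, derivable f x w) -> measurable_fun setT ('D_w f).
Proof.
move=> mf df.
have mg (k : nat) : measurable_fun setT
    (fun x : E => k.+1%:R * (f (x + k.+1%:R^-1 *: w) - f x)).
  apply: measurable_funM => //; apply: measurable_funB => //.
  exact: measurableT_comp mf (measurable_shift _).
exact: measurable_fun_cvg mg (fun x _ => derivable_cvg_seq (df x)).
Qed.

Definition bump_mass (r : R) : R := (\int[mu]_x bump r (x : E))%R.
Definition bump_grad (i : 'I_d) (r : R) (s : E) : R := 'D_(evec i) (bump r) s.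

Lemma derivable_bump r (x w : E) : derivable (bump r) x w.
Proof. by case: (is_derive_bump r x w). Qed.

Lemma bump_gradE i r (s : E) :
  bump_grad i r s = - 4 * Num.max 0 (r ^+ 2 - dotv s s) * dotv s (evec i).
Proof. exact: (derive_val (is_derive := is_derive_bump r s (evec i))). Qed.

Lemma bump_gradN i r (s : E) : bump_grad i r (- s) = - bump_grad i r s.
Proof.
rewrite !bump_gradE.
have -> : dotv (- s) (- s) = dotv s s by apply: eq_bigr => j _; rewrite !mxE mulrNN.
have -> : dotv (- s) (evec i) = - dotv s (evec i).
  by rewrite /dotv -sumrN; apply: eq_bigr => j _; rewrite !mxE mulNr.
by rewrite mulrN.
Qed.

Lemma norm_evec (i : 'I_d) : `|evec i : E| = 1.
Proof.
apply/eqP; rewrite eq_le; apply/andP; split.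
  apply/rV_norm_le => // j.
  by rewrite !mxE; case: (_ && _); rewrite ?normr0 ?normr1.
by have := rV_norm_coord (evec i : E) i; rewrite !mxE !eqxx normr1.
Qed.

Variable r : R.
Hypothesis r0 : 0 <= r.

Lemma bump_grad_le i s : `|bump_grad i r s| <= 4 * d%:R * r ^+ 3.
Proof. by have := derive_bump_le s (evec i) r0; rewrite norm_evec mulr1. Qed.

Lemma bump_grad_out i s : r < `|s| -> bump_grad i r s = 0.
Proof.
move=> rs; rewrite bump_gradE max_l ?mulr0 ?mul0r//.
rewrite subr_le0; apply: le_trans (sqr_norm_le_dotv s).
by rewrite lerXn2r ?nnegrE//; exact: ltW.
Qed.

Lemma measurable_bump : measurable_fun setT (bump r : E -> R).
Proof. by apply: continuous_measurable_rV; exact: bump_continuous. Qed.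

Lemma measurable_bump_grad i : measurable_fun setT (bump_grad i r).
Proof.
apply: measurable_derive; first exact: measurable_bump.
by move=> x; exact: derivable_bump.
Qed.

Lemma notin_cube0 (z : E) (s : R) x : ~ cube z s x -> s < `|x - z|.
Proof. by rewrite /cube/= => /negP; rewrite -ltNge. Qed.

Lemma bump_integrable : mu.-integrable setT (EFin \o (bump r : E -> R)).
Proof.
apply: (supp_integrable (measurable_cube (0 : E) r) (lebesgue_rV_cube_lty (0 : E) r)
  measurable_bump _ (fun x => bump_le r x)) => x /notin_cube0; rewrite subr0.
exact: bump_out.
Qed.

Lemma bump_grad_integrable i : mu.-integrable setT (EFin \o bump_grad i r).
Proof.
apply: (supp_integrable (measurable_cube (0 : E) r) (lebesgue_rV_cube_lty (0 : E) r)
  (measurable_bump_grad i) _ (bump_grad_le i)) => x /notin_cube0; rewrite subr0.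
exact: bump_grad_out.
Qed.

Lemma Rintegral_bump_grad i : (\int[mu]_x bump_grad i r x)%R = 0.
Proof.
apply: (@Rintegral_derive0 _ _ _ _ 0 r (4 * d%:R * r ^+ 3 * `|evec i : E|)) => //.
- exact: bump_integrable.
- by move=> x /notin_cube0; rewrite subr0; exact: bump_out.
- by move=> x; exact: derivable_bump.
- by move=> x h; exact: bump_lipschitz.
Qed.

Lemma Rintegral_bump_refl x : (\int[mu]_z bump r (x - z : E))%R = bump_mass r.
Proof.
rewrite /bump_mass -(Rintegral_shift (- x) measurable_bump).
by apply: eq_Rintegral => z _; rewrite -bumpN opprB.
Qed.

Lemma Rintegral_bump_grad_refl i x : (\int[mu]_z bump_grad i r (x - z))%R = 0.
Proof.
transitivity (\int[mu]_z (- 1 * bump_grad i r (z - x)))%R.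
  by apply: eq_Rintegral => z _; rewrite mulN1r -bump_gradN opprB.
rewrite RintegralZl//.
  by rewrite (Rintegral_shift (- x) (measurable_bump_grad i)) Rintegral_bump_grad mulr0.
exact: (integrable_shift (- x) (bump_grad_integrable i)).
Qed.

Section domain.
Variables (Omega : set E) (B C : R) (G : 'I_d -> E -> R).
Hypothesis mO : measurable Omega.
Hypothesis OB : Omega `<=` cube 0 B.
Hypothesis mG : forall i, measurable_fun Omega (G i).
Hypothesis mDG : forall i, measurable_fun Omega (pderiv i (G i)).
Hypothesis GC : forall i x, Omega x -> `|G i x| <= C.
Hypothesis DGC : forall i x, Omega x -> `|pderiv i (G i) x| <= C.

Definition divG (x : E) : R := \sum_i pderiv i (G i) x.

(* The integral over [Omega] of [div (bump r (. - z) G)]. *)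
Definition local_flux (z : E) : R :=
  (\int[mu]_(x in Omega) (bump r (x - z) * divG x +
     \sum_i bump_grad i r (x - z) * G i x))%R.

Let D0 := divG \_ Omega.
Let G0 i := G i \_ Omega.
(** The integrand of [local_flux], extended by 0 outside [Omega] and seen as a function of the pair
    of the point and the centre: bounded with bounded support, hence integrable on the product. *)
Let Gam (p : E * E) : R := bump r (p.1 - p.2) * D0 p.1 +
  \sum_i bump_grad i r (p.1 - p.2) * G0 i p.1.

Let mdivG : measurable_fun Omega divG.
Proof. by apply: measurable_sum => i; exact: mDG. Qed.

Let mD0 : measurable_fun setT D0.
Proof. exact: (measurable_restrictT _ mO).1. Qed.

Let mG0 i : measurable_fun setT (G0 i).
Proof. exact: (measurable_restrictT _ mO).1. Qed.

Let mdiff : measurable_fun setT (fun p : E * E => p.1 - p.2).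
Proof.
apply: measurable_fun_rV => i; under eq_fun do rewrite !mxE.
apply: measurable_funB.
  exact: (measurableT_comp (measurable_coord i) measurable_fst).
exact: (measurableT_comp (measurable_coord i) measurable_snd).
Qed.

Let mGam : measurable_fun setT Gam.
Proof.
apply: measurable_funD.
  apply: measurable_funM.
    exact: measurableT_comp measurable_bump mdiff.
  exact: measurableT_comp mD0 measurable_fst.
apply: measurable_sum => i; apply: measurable_funM.
  exact: measurableT_comp (measurable_bump_grad i) mdiff.
exact: measurableT_comp (mG0 i) measurable_fst.
Qed.

Lemma divG_le x : Omega x -> `|divG x| <= d%:R * C.
Proof.
move=> Ox; apply: le_trans (ler_norm_sum _ _ _) _.
have -> : d%:R * C = \sum_(i < d) C by rewrite sumr_const card_ord mulr_natl.
by apply: ler_sum => i _; exact: DGC.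
Qed.

Definition flux_bound : R := r ^+ 4 * (d%:R * C) + d%:R * (4 * d%:R * r ^+ 3 * C).

Hypothesis C0 : 0 <= C.

Lemma flux_integrand_le z x : Omega x -> `|bump r (x - z) * divG x +
     \sum_i bump_grad i r (x - z) * G i x| <= flux_bound.
Proof.
move=> Ox; apply: le_trans (ler_normD _ _) _; apply: lerD.
  by rewrite normrM ler_pM ?bump_le ?divG_le.
apply: le_trans (ler_norm_sum _ _ _) _.
have -> : d%:R * (4 * d%:R * r ^+ 3 * C) = \sum_(i < d) (4 * d%:R * r ^+ 3 * C).
  by rewrite sumr_const card_ord mulr_natl.
by apply: ler_sum => i _; rewrite normrM ler_pM ?bump_grad_le ?GC.
Qed.

Let GamE x z : Gam (x, z) = (fun x => bump r (x - z) * divG x +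
     \sum_i bump_grad i r (x - z) * G i x) \_ Omega x.
Proof.
rewrite /Gam /D0 /G0/= patchE; under eq_bigr do rewrite patchE.
rewrite patchE; case: ifPn => // _.
by rewrite mulr0 add0r big1// => i _; rewrite mulr0.
Qed.

Let fb0 : 0 <= flux_bound.
Proof. by rewrite addr_ge0// !mulr_ge0 ?exprn_ge0. Qed.

Let Gam_le p : `|Gam p| <= flux_bound.
Proof.
case: p => x z; rewrite GamE patchE; case: ifPn => [|_]; last by rewrite normr0.
by rewrite inE => Ox; exact: flux_integrand_le.
Qed.

Let Kz := cube (0 : E) (B + r).
Let K := cube (0 : E) B `*` Kz.

Let Gam0 p : ~ K p -> Gam p = 0.
Proof.
case: p => x z nK; rewrite GamE patchE; case: ifPn => //; rewrite inE => Ox.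
have xz : r < `|x - z|.
  rewrite ltNge; apply/negP => xz; apply: nK; split=> /=; first exact: OB.
  have := OB Ox; rewrite /Kz /cube/= !subr0 => xB.
  rewrite (_ : z = x - (x - z)); last by rewrite opprB addrC subrK.
  by apply: le_trans (ler_normB _ _) _; exact: lerD.
rewrite bump_out// mul0r add0r big1// => i _.
by rewrite bump_grad_out// mul0r.
Qed.

Let mK : measurable K.
Proof. by apply: measurableX; exact: measurable_cube. Qed.

Let Kfin : ((mu \x mu) K < +oo)%E.
Proof.
rewrite /K product_measure1E; [|exact: measurable_cube|exact: measurable_cube].
rewrite lte_mul_pinfty//; last exact: lebesgue_rV_cube_lty.
by rewrite ge0_fin_numE// lebesgue_rV_cube_lty.
Qed.

Let Gami : (mu \x mu)%E.-integrable setT (EFin \o Gam).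
Proof.
have -> : EFin \o Gam = ((EFin \o Gam) \_ K)%E.
  apply/funext => p; rewrite patchE; case: ifPn => // /negP h /=.
  by rewrite Gam0// => Kp; apply: h; rewrite inE.
apply/(integrable_mkcond _ mK); apply: measurable_bounded_integrable => //.
- exact: measurable_funTS.
- exists flux_bound; split; first exact: num_real.
  by move=> M hM x Kx /=; apply: le_trans (ltW hM).
Qed.

Let Gamxi z : mu.-integrable setT (EFin \o (fun x => Gam (x, z))).
Proof.
apply: (supp_integrable (measurable_cube (0 : E) B) (lebesgue_rV_cube_lty (0 : E) B)
  _ _ (fun x => Gam_le (x, z))).
  exact: measurableT_comp mGam (pair2_measurable z).
by move=> x nB; apply: Gam0 => -[].
Qed.

Let Gamzi x : mu.-integrable setT (EFin \o (fun z => Gam (x, z))).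
Proof.
apply: (supp_integrable (measurable_cube (0 : E) (B + r)) (lebesgue_rV_cube_lty (0 : E) (B + r))
  _ _ (fun z => Gam_le (x, z))).
  exact: measurableT_comp mGam (pair1_measurable x).
by move=> z nB; apply: Gam0 => -[].
Qed.

Let local_fluxE z : (local_flux z)%:E = (\int[mu]_x (Gam (x, z))%:E)%E.
Proof.
rewrite /local_flux Rintegral_mkcond /Rintegral fineK.
  by apply: eq_integral => x _; rewrite GamE.
under eq_integral do rewrite -GamE.
exact: (integrable_fin_num measurableT (Gamxi z)).
Qed.

(** In the centre variable the bump integrates to its mass and its partial derivatives integrate to
    0, so only the divergence survives. *)
Let Gam_intz x : (\int[mu]_z (Gam (x, z))%:E)%E = (bump_mass r * D0 x)%:E.
Proof.
rewrite -[LHS]fineK; last exact: (integrable_fin_num measurableT (Gamzi x)).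
congr EFin; rewrite -[LHS]/((\int[mu]_z Gam (x, z))%R).
have bi : mu.-integrable setT (EFin \o (fun z : E => bump r (x - z))).
  apply: eq_integrable (integrable_shift (- x) bump_integrable) => // z _ /=.
  by rewrite -bumpN opprB.
have bgi i : mu.-integrable setT (EFin \o (fun z : E => bump_grad i r (x - z))).
  have := integrable_funZ measurableT (- 1) (integrable_shift (- x) (bump_grad_integrable i)).
  by apply: eq_integrable => // z _ /=; rewrite mulN1r -bump_gradN opprB.
have bi' : mu.-integrable setT (EFin \o (fun z : E => D0 x * bump r (x - z))).
  exact: integrable_funZ.
have bgi' i : mu.-integrable setT (EFin \o (fun z : E => G0 i x * bump_grad i r (x - z))).
  exact: integrable_funZ.
transitivity (\int[mu]_z (D0 x * bump r (x - z) + \sum_i G0 i x * bump_grad i r (x - z)))%R.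
  apply: eq_Rintegral => z _; rewrite /Gam/= mulrC; congr (_ + _).
  by apply: eq_bigr => i _; rewrite mulrC.
rewrite RintegralD//; last exact: integrable_fun_sum.
rewrite RintegralZl// Rintegral_bump_refl mulrC Rintegral_sum// big1 ?addr0// => i _.
by rewrite RintegralZl// Rintegral_bump_grad_refl mulr0.
Qed.

(** Fubini, with [Gam_intz] for the integral over the centres: this is where the local fluxes give
    back the global quantity. *)
Lemma integral_local_flux : (\int[mu]_z (local_flux z)%:E)%E =
  (bump_mass r * (\int[mu]_(x in Omega) divG x)%R)%:E.
Proof.
under eq_integral do rewrite local_fluxE.
rewrite -(Fubini Gami) /=.
under eq_integral do rewrite Gam_intz.
have Ofin : (mu Omega < +oo)%E by exact: sub_cube_lty OB.
have Di : mu.-integrable setT (EFin \o D0).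
  rewrite /D0 -restrict_EFin; apply/(integrable_mkcond _ mO).
  by apply: bounded_integrable mO Ofin mdivG divG_le.
rewrite -[LHS]fineK; last first.
  by apply: integrable_fin_num => //; exact: (integrable_funZ measurableT (bump_mass r) Di).
congr EFin; rewrite Rintegral_mkcond -RintegralZl//.
Qed.

Lemma measurable_local_flux : measurable_fun setT local_flux.
Proof.
apply/measurable_EFinP.
have -> : EFin \o local_flux = (fun z => \int[mu]_x (Gam (x, z))%:E)%E.
  by apply/funext => z /=; rewrite local_fluxE.
exact: (measurable_fubini_G Gami).
Qed.

Lemma le_integral_local_flux (b : E -> \bar R) : measurable_fun setT b ->
  (forall z, `|local_flux z|%:E <= b z)%E ->
  ((bump_mass r * `|(\int[mu]_(x in Omega) divG x)%R|)%:E <= \int[mu]_z b z)%E.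
Proof.
move=> mb fb.
have m0 : 0 <= bump_mass r by apply: Rintegral_ge0 => x _; exact: bump_ge0.
rewrite -[bump_mass r]ger0_norm// -normrM -abse_EFin -integral_local_flux.
have mf : measurable_fun setT (EFin \o local_flux).
  by apply/measurable_EFinP; exact: measurable_local_flux.
apply: le_trans (le_abse_integral mu measurableT mf) _.
apply: ge0_le_integral => //.
- exact: measurableT_comp.
- by move=> z _ /=; exact: fb.
Qed.
End domain.
End mollified_divergence.

(** * Estimates of a single localized flux *)

Section flux_estimates.
Context {R : realType} {d : nat}.
Local Notation E := 'rV[R]_d.
Local Notation mu := (lebesgue_rV d).

(** By [bump_lb] the bump is at least [r ^+ 4 / 4] on a cube of side [r / d.+1%:R]. *)
Lemma bump_mass_lb (r : R) : 0 <= r ->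
  r ^+ 4 / 4 * (r / d.+1%:R) ^+ d <= bump_mass (d := d) r.
Proof.
move=> r0; pose s := r / (2 * d.+1%:R).
have s0 : 0 <= s by rewrite divr_ge0.
have mK := measurable_cube (0 : E) s.
have Kfin := lebesgue_rV_cube_lty (0 : E) s.
have -> : r ^+ 4 / 4 * (r / d.+1%:R) ^+ d = (\int[mu]_x ((r ^+ 2 / 2) ^+ 2 * \1_(cube (0 : E) s) x))%R.
  rewrite RintegralZl//; last first.
    have := integrable_cst_indic 1 measurableT mK Kfin.
    by apply: eq_integrable => // x _; rewrite /= mul1r.
  rewrite /Rintegral integral_indic//= setIT lebesgue_rV_cube//=.
  congr (_ * _ ^+ _); first by field.
  by rewrite /s invfM mulrCA mulVKf.
apply: le_Rintegral => //.
- exact: integrable_cst_indic.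
- exact: bump_integrable.
move=> x _; rewrite indicE; case: (boolP (x \in _)) => [|_]; last by rewrite mulr0 bump_ge0.
by rewrite inE /cube/= subr0 mulr1; exact: bump_lb.
Qed.

Lemma is_derive_translate (f : E -> R) (z x w : E) : derivable f (x - z) w ->
  is_derive x w (fun y => f (y - z)) ('D_w f (x - z)).
Proof.
have qE : (fun h : R => h^-1 *: (f (h *: w + x - z) - f (x - z))) =
   (fun h => h^-1 *: (f (h *: w + (x - z)) - f (x - z))).
  by apply/funext => h; rewrite addrA.
move=> df; split.
  by rewrite /derivable/= qE; exact: df.
by rewrite /derive/= qE.
Qed.

Variables (r : R) (Omega : set E) (B C : R) (G : 'I_d -> E -> R).
Hypothesis r0 : 0 <= r.
Hypothesis oO : open Omega.
Hypothesis OB : Omega `<=` cube 0 B.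
Hypothesis dG : forall i x, Omega x -> derivable (G i) x (evec i).
Hypothesis mG : forall i, measurable_fun Omega (G i).
Hypothesis mDG : forall i, measurable_fun Omega (pderiv i (G i)).
Hypothesis C0 : 0 <= C.
Hypothesis GC : forall i x, Omega x -> `|G i x| <= C.
Hypothesis DGC : forall i x, Omega x -> `|pderiv i (G i) x| <= C.

Let mO : measurable Omega. Proof. exact: measurable_open_rV. Qed.
Let mdivG : measurable_fun Omega (divG G).
Proof. by apply: measurable_sum => i; exact: mDG. Qed.

Let mshift (f : E -> R) z : measurable_fun setT f -> measurable_fun setT (fun x : E => f (x - z)).
Proof. by move=> mf; exact: measurableT_comp mf (measurable_shift _). Qed.

Definition flux_integrand (z x : E) : R :=
  bump r (x - z) * divG G x + \sum_i bump_grad i r (x - z) * G i x.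

Let mflux z : measurable_fun Omega (flux_integrand z).
Proof.
apply: measurable_funD.
  by apply: measurable_funM => //; apply: measurable_funTS; apply: mshift; exact: measurable_bump.
apply: measurable_sum => i; apply: measurable_funM => //.
by apply: measurable_funTS; apply: mshift; exact: measurable_bump_grad.
Qed.

Let flux_out z x : ~ cube z r x -> flux_integrand z x = 0.
Proof.
move=> /notin_cube0 h; rewrite /flux_integrand bump_out// mul0r add0r big1// => i _.
by rewrite bump_grad_out// mul0r.
Qed.

Let local_flux_cube z : local_flux r Omega G z =
  (\int[mu]_(x in cube z r `&` Omega) flux_integrand z x)%R.
Proof.
rewrite setIC Rintegral_mkcondr; apply: eq_Rintegral => x _.
rewrite patchE; case: ifPn => // /negP; rewrite inE => h.
exact: flux_out.
Qed.

Let fine_le_cube z (A : set E) : measurable A -> A `<=` cube z r ->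
  fine (mu A) <= (2 * r) ^+ d.
Proof.
move=> mA Az; rewrite -[leRHS]/(fine ((2 * r) ^+ d)%:E) -(lebesgue_rV_cube z r0).
apply: fine_le; last by apply: le_measure => //; rewrite inE//; exact: measurable_cube.
- rewrite ge0_fin_numE//; apply: le_lt_trans (lebesgue_rV_cube_lty z r).
  by apply: le_measure => //; rewrite inE//; exact: measurable_cube.
- by rewrite ge0_fin_numE//; exact: lebesgue_rV_cube_lty.
Qed.

(** The crude bound, size of the integrand times volume of the cube, of order r^(d + 3) for small
    [r]. It serves at the centres where nothing is known about the tangent plane. *)
Lemma local_flux_le z : `|local_flux r Omega G z| <= flux_bound (d := d) r C * (2 * r) ^+ d.
Proof.
rewrite local_flux_cube.
have mA : measurable (cube z r `&` Omega) by apply: measurableI => //; exact: measurable_cube.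
have Az : cube z r `&` Omega `<=` cube z r by move=> x [].
apply: (@le_trans _ _ (flux_bound (d := d) r C * fine (mu (cube z r `&` Omega)))).
  apply: le_norm_Rintegral => //; first exact: sub_cube_lty Az.
    exact: measurable_funS (mflux z).
  by move=> x [_ Ox]; exact: (@flux_integrand_le _ _ _ r0 Omega C G).
rewrite ler_wpM2l//; last exact: (@fine_le_cube z).
by rewrite addr_ge0// !mulr_ge0 ?exprn_ge0.
Qed.

Lemma local_flux_out z : (forall x, cube z r x -> ~ Omega x) -> local_flux r Omega G z = 0.
Proof.
move=> h; rewrite local_flux_cube (_ : _ `&` _ = set0) ?Rintegral_set0//.
by apply/seteqP; split=> x //= -[/h].
Qed.

(** The product of bump and field, extended by 0, is derivable along the coordinates on the whole
    space, and the integral of such a partial derivative vanishes. *)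
Lemma local_flux_in z : cube z r `<=` Omega -> local_flux r Omega G z = 0.
Proof.
move=> zO.
pose f i x := bump r (x - z) * G i x.
have fout i x : r < `|x - z| -> \near x, f i x = 0.
  move=> rx; near=> y; rewrite /f bump_out ?mul0r//.
  near: y; apply: (@cvgr_gt _ _ (nbhs x) _ (fun y => `|y - z|) `|x - z|) => //.
  by apply: cvg_norm; apply: cvgB; [exact: cvg_id|exact: cvg_cst].
have dfin i x : Omega x -> is_derive x (evec i) (f i)
    (bump r (x - z) * pderiv i (G i) x + bump_grad i r (x - z) * G i x).
  move=> Ox; have h1 := is_derive_translate (@derivable_bump R d r (x - z) (evec i)).
  have h2 : is_derive x (evec i) (G i) (pderiv i (G i) x) by apply: DeriveDef => //; exact: dG.
  have [h3 h4] := is_deriveM h1 h2; split; first exact: h3.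
  by rewrite [LHS]h4 /GRing.scale/= [G i x * _]mulrC.
have dfout i x : r < `|x - z| -> is_derive x (evec i) (f i) 0.
  move=> rx; have dc : is_derive x (evec i) (cst (0 : R) : E -> R) 0 by apply: is_derive_cst.
  by apply: near_eq_is_derive dc; apply: filterS (fout i x rx) => y ->.
(* Two overlapping cases: the product rule works in [Omega], and at distance more than [r] from [z]
   the product vanishes in a neighbourhood, whatever the values of [G] there. *)
have dichot x : Omega x \/ r < `|x - z|.
  have [xr|] := leP `|x - z| r; [left; exact: zO|by right].
have df i x : derivable (f i) x (evec i).
  by case: (dichot x) => [/(dfin i)|/(dfout i)] [].
have DfO i x : Omega x -> 'D_(evec i) (f i) x =
    bump r (x - z) * pderiv i (G i) x + bump_grad i r (x - z) * G i x.
  by move=> /(dfin i) h; exact: derive_val.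
have Df0 i x : ~ Omega x -> 'D_(evec i) (f i) x = 0.
  by move=> nO; case: (dichot x) => // /(dfout i) h; exact: derive_val.
have Dfle i x : `|'D_(evec i) (f i) x| <= r ^+ 4 * C + 4 * d%:R * r ^+ 3 * C.
  have [Ox|nO] := pselect (Omega x); last first.
    by rewrite Df0// normr0 addr_ge0// !mulr_ge0 ?exprn_ge0.
  rewrite DfO//; apply: le_trans (ler_normD _ _) _; apply: lerD.
    by rewrite normrM ler_pM ?bump_le ?DGC.
  by rewrite normrM ler_pM ?bump_grad_le ?GC.
have mf i : measurable_fun setT (f i).
  have -> : f i = fun x => bump r (x - z) * (G i \_ Omega) x.
    apply/funext => x; rewrite /f patchE; case: ifPn => // /negP; rewrite inE => nO.
    by case: (dichot x) => // rx; rewrite bump_out// !mul0r.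
  apply: measurable_funM; first by apply: mshift; exact: measurable_bump.
  exact: (measurable_restrictT _ mO).1.
have f0 i x : ~ cube z r x -> f i x = 0.
  by move=> /notin_cube0 h; rewrite /f bump_out// mul0r.
have fle i x : `|f i x| <= r ^+ 4 * C.
  have [Ox|nO] := pselect (Omega x); first by rewrite normrM ler_pM ?bump_le ?GC.
  case: (dichot x) => // rx; rewrite /f bump_out// mul0r normr0.
  by rewrite mulr_ge0// exprn_ge0.
have fi i : mu.-integrable setT (EFin \o f i).
  exact: supp_integrable (measurable_cube z r) (lebesgue_rV_cube_lty z r) (mf i) (f0 i) (fle i).
have int0 i : (\int[mu]_x 'D_(evec i) (f i) x)%R = 0.
  apply: (Rintegral_derive0 (fi i) (f0 i) (df i)) => // x h.
  by apply: le_line_derivative => t; [exact: df|exact: Dfle].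
have Di i : mu.-integrable setT (EFin \o ('D_(evec i) (f i))).
  apply: (supp_integrable (measurable_cube z r) (lebesgue_rV_cube_lty z r)
    (measurable_derive (mf i) (df i)) _ (Dfle i)) => x /notin_cube0 /(dfout i) h.
  exact: derive_val.
have -> : local_flux r Omega G z = (\int[mu]_x \sum_i 'D_(evec i) (f i) x)%R.
  rewrite /local_flux Rintegral_mkcond; apply: eq_Rintegral => x _.
  rewrite patchE; case: ifPn => [|/negP]; rewrite inE => Ox.
    rewrite /divG mulr_sumr -big_split; apply: eq_bigr => i _.
    by rewrite DfO.
  by rewrite big1// => i _; exact: Df0.
by rewrite Rintegral_sum// big1.
Unshelve. all: end_near. Qed.

Lemma dotv_evec (s : E) i : dotv s (evec i) = s 0 i.
Proof.
rewrite /dotv (bigD1 i)//= big1 ?addr0 => [|j ji].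
  by rewrite !mxE !eqxx mulr1.
by rewrite !mxE (negbTE ji) andbF mulr0.
Qed.

Lemma norm_le1_unit (e : E) : dotv e e = 1 -> `|e| <= 1.
Proof. by move=> e1; rewrite -(@ler_pXn2r _ 2) ?nnegrE// expr1n -e1 sqr_norm_le_dotv. Qed.

Section good_point_flux.
Variables (z e p g : E) (a eps om : R).
Hypothesis r_gt0 : 0 < r.
Hypothesis eps0 : 0 <= eps.
Hypothesis om0 : 0 <= om.
Hypothesis e1 : dotv e e = 1.
Hypothesis pe : dotv p e = 0.
Hypothesis gm : dotv g (e - p) = 0.
Hypothesis gC : `|g| <= C.
Hypothesis Gg : forall x i, cube z r x -> Omega x -> `|G i x - g 0 i| <= om.
Hypothesis Oin : forall x, cube z r x -> Omega x -> dotv (x - z) (e - p) - a <= eps * r.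
Hypothesis Oout : forall x, cube z r x -> ~ Omega x -> - (eps * r) <= dotv (x - z) (e - p) - a.

(** Unnormalised normal of the approximating hyperplane. With this normalisation [dotv m e = 1], so
    the distance to the hyperplane measured along [e] is read off directly. *)
Let m := e - p.
Let H := [set x : E | dotv (x - z) m < a].
Let slab := cube z r `&` [set x : E | `|dotv (x - z) m - a| <= eps * r].
Let bg (x : E) : R := 'D_g (bump r) (x - z).

Let me1 : dotv m e = 1.
Proof. by rewrite dotvC /m dotvBr e1 dotvC pe subr0. Qed.

Let cont_m : continuous (fun x : E => dotv (x - z) m).
Proof.
have -> : (fun x : E => dotv (x - z) m) = (fun x => dotv x m - dotv z m).
  by apply/funext => x; rewrite dotvC dotvBr ![dotv m _]dotvC.
move=> x; apply: (@cvgB _ _ _ (nbhs x)); last exact: cvg_cst.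
exact: dotv_continuous.
Qed.

Let mm : measurable_fun setT (fun x : E => dotv (x - z) m).
Proof. exact: continuous_measurable_rV. Qed.

Let mH : measurable H.
Proof.
apply: measurable_open_rV.
have -> : H = (fun x : E => dotv (x - z) m) @^-1` [set t | t < a] by [].
by apply: open_comp => //; exact: open_lt.
Qed.

Let mslab : measurable slab.
Proof.
apply: measurableI; first exact: measurable_cube.
have -> : [set x : E | `|dotv (x - z) m - a| <= eps * r] =
  (fun x : E => dotv (x - z) m : measurableTypeR R) @^-1` `[a - eps * r, a + eps * r]%classic.
  by apply/seteqP; split=> x /=; rewrite in_itv/= ler_distl.
by rewrite -[X in measurable X]setTI; exact: mm.
Qed.

(** A line along [e] meets the slab in length at most [2 * (eps * r)], because [dotv m e = 1].
    [measure_le_lines] with segments of length [r] applies; a segment that reaches the slab starts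
    in [cube z (2 * r)]. *)
Let slab_le : fine (mu slab) <= 2 * eps * (4 * r) ^+ d.
Proof.
have er0 : 0 <= 2 * (eps * r) by rewrite !mulr_ge0.
have h : (r%:E * mu slab <= (2 * (eps * r))%:E * mu (cube z (2 * r)))%E.
  apply: (@measure_le_lines _ _ e) => //; first exact: measurable_cube.
    move=> x t /andP[t0 tr] [xt _]; rewrite /cube/=.
    rewrite (_ : x - z = x + t *: e - z - t *: e); last by rewrite addrAC addrK.
    apply: le_trans (ler_normB _ _) _; rewrite mulrDl mul1r; apply: lerD => //.
    rewrite normrZ ger0_norm//; apply: le_trans tr; rewrite ler_piMr//.
    exact: norm_le1_unit.
  move=> x _; pose b := a - dotv (x - z) m.
  have -> : (2 * (eps * r))%:E = lebesgue_measure `[b - eps * r, b + eps * r]%classic.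
    rewrite lebesgue_measure_itvcc; first by congr EFin; ring.
    by rewrite lerD2l ge0_cp ?mulr_ge0.
  apply: le_measure; rewrite ?inE; [|exact: measurable_itv|].
    have -> : [set t : R | 0 <= t <= r /\ slab (x + t *: e)] =
        `[0, r]%classic `&` [set t : R | slab (x + t *: e)].
      by apply/seteqP; split => t /=; rewrite in_itv.
    apply: measurableI; first exact: measurable_itv.
    rewrite -[X in measurable X]setTI.
    have := measurableT_comp (measurable_line e)
        (@pair2_measurable _ _ (measurableTypeR R) 'rV[R]_d x); exact.
  move=> t [_ [_ /=]]; rewrite in_itv/= -ler_distl.
  have -> : x + t *: e - z = x - z + t *: e by rewrite addrAC.
  rewrite dotvC dotvDr dotvZr me1 mulr1 dotvC.
  by congr (`|_| <= _); rewrite /b; ring.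
have r20 : 0 <= 2 * r by rewrite mulr_ge0.
rewrite lebesgue_rV_cube// in h.
have sfin : mu slab \is a fin_num.
  rewrite ge0_fin_numE//; apply: (@sub_cube_lty _ _ z r) => //.
  by move=> x [].
rewrite -(fineK sfin) -!EFinM lee_fin in h.
rewrite -(ler_pM2l r_gt0); apply: le_trans h _.
rewrite [leRHS](_ : _ = 2 * (eps * r) * (4 * r) ^+ d); last by ring.
by rewrite ler_wpM2l// lerXn2r ?nnegrE ?mulr_ge0//; lra.
Qed.

Let bgE x : bg x = \sum_i bump_grad i r (x - z) * g 0 i.
Proof.
rewrite /bg (derive_val (is_derive := is_derive_bump r (x - z) g)).
rewrite {2}/dotv mulr_sumr; apply: eq_bigr => i _.
by rewrite bump_gradE dotv_evec mulrA.
Qed.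

Let bg_le x : `|bg x| <= 4 * d%:R * r ^+ 3 * C.
Proof.
apply: le_trans (derive_bump_le _ _ r0) _.
by rewrite ler_wpM2l// !mulr_ge0 ?exprn_ge0.
Qed.

Let bg_out x : ~ cube z r x -> bg x = 0.
Proof.
move=> h; rewrite bgE big1// => i _.
by rewrite bump_grad_out ?mul0r//; exact: notin_cube0.
Qed.

Let mbg : measurable_fun setT bg.
Proof.
apply: (@mshift ('D_g (bump r))); apply: measurable_derive; first exact: measurable_bump.
by move=> x; exact: derivable_bump.
Qed.

Let bgi : mu.-integrable setT (EFin \o bg).
Proof.
exact: supp_integrable (measurable_cube z r) (lebesgue_rV_cube_lty z r) mbg bg_out bg_le.
Qed.

Let int_bg_H : (\int[mu]_(x in H) bg x)%R = 0.
Proof.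
pose f (x : E) := bump r (x - z).
have DfE : bg = 'D_g f.
  apply/funext => x; have h := is_derive_translate (@derivable_bump R d r (x - z) g).
  by symmetry; exact: derive_val.
have mf : measurable_fun setT f by apply: mshift; exact: measurable_bump.
have fi : mu.-integrable setT (EFin \o f).
  exact: (integrable_shift (- z) (bump_integrable r0)).
rewrite DfE.
apply: (@Rintegral_derive0 _ _ f g z r (4 * d%:R * r ^+ 3 * `|g|)) => //.
- by move=> x /notin_cube0; exact: bump_out.
- by move=> x; case: (is_derive_translate (@derivable_bump R d r (x - z) g)).
- move=> x h; rewrite /f (_ : x + h *: g - z = x - z + h *: g); last by rewrite addrAC.
  exact: bump_lipschitz.
- move=> x h; rewrite /H/= (_ : x + h *: g - z = x - z + h *: g); last by rewrite addrAC.
  have -> // : dotv (x - z + h *: g) m = dotv (x - z) m.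
  by rewrite [LHS]dotvC dotvDr dotvZr [dotv m g]dotvC gm mulr0 addr0 dotvC.
Qed.

(** Inside [cube z r] the sets [Omega] and [H] differ only within the slab, by [Oin] and [Oout]. As
    the integral over [H] is 0, only an integral over the slab remains. *)
Let int_bg_Omega : `|(\int[mu]_(x in Omega) bg x)%R| <=
  4 * d%:R * r ^+ 3 * C * (2 * eps * (4 * r) ^+ d).
Proof.
have bgO (A : set E) : measurable A -> mu.-integrable setT (EFin \o (bg \_ A)).
  move=> mA; rewrite -restrict_EFin; apply/(integrable_mkcond _ mA).
  exact: (integrableS measurableT).
have -> : (\int[mu]_(x in Omega) bg x)%R = (\int[mu]_x ((bg \_ Omega) x - (bg \_ H) x))%R.
  rewrite RintegralB//; [|exact: bgO..].
  by rewrite -!Rintegral_mkcond int_bg_H subr0.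
rewrite (@Rintegral_supp _ _ slab)//; last first.
  move=> x nslab; rewrite !patchE.
  have [xz|xz] := pselect (cube z r x); last first.
    by rewrite !bg_out//; case: ifPn; case: ifPn; rewrite subrr.
  case: ifPn; rewrite ?inE => Ox; case: ifPn; rewrite ?inE => Hx; rewrite ?subrr//.
    exfalso; apply: nslab; split => //=; rewrite ler_norml.
    have /negP := Hx; rewrite inE /H/= => /negP; rewrite -leNgt => h.
    rewrite Oin// andbT; apply: (@le_trans _ _ 0); last by rewrite subr_ge0.
    by rewrite oppr_le0 mulr_ge0.
  exfalso; apply: nslab; split => //=; rewrite ler_norml.
  have /negP := Ox; rewrite inE => h.
  rewrite Oout//=; apply: (@le_trans _ _ 0); last by rewrite mulr_ge0.
  by rewrite subr_le0 ltW.
apply: (@le_trans _ _ (4 * d%:R * r ^+ 3 * C * fine (mu slab))).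
  apply: le_norm_Rintegral => //.
  - by apply: (@sub_cube_lty _ _ z r) => // x [].
  - apply: measurable_funTS; apply: measurable_funB.
      by apply: (measurable_restrictT _ _).1 => //; exact: measurable_funTS.
    by apply: (measurable_restrictT _ _).1 => //; exact: measurable_funTS.
  move=> x _; rewrite !patchE.
  by case: ifPn => _; case: ifPn => _; rewrite ?subrr ?subr0 ?sub0r ?normrN ?normr0 ?mulr_ge0 ?exprn_ge0.
by rewrite ler_wpM2l// !mulr_ge0 ?exprn_ge0.
Qed.

(* Near [z] the set [Omega] lies within [eps * r] of the half-space [dotv (x - z) (e - p) < a]
   and [G] is close to [g]; for the half-space and the constant field [g], which is
   tangent to it, the flux vanishes by translation invariance along [g]. *)
Lemma local_flux_good : `|local_flux r Omega G z| <=
  (r ^+ 4 * (d%:R * C) + d%:R * (4 * d%:R * r ^+ 3 * om)) * (2 * r) ^+ d +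
  4 * d%:R * r ^+ 3 * C * (2 * eps * (4 * r) ^+ d).
Proof.
(* What remains once [G] is frozen to [g]: the divergence term, of order r^4, and the oscillation of
   [G], of order [om] times r^3. *)
pose f1 x := flux_integrand z x - bg x.
have f1E x : f1 x = bump r (x - z) * divG G x +
    \sum_i bump_grad i r (x - z) * (G i x - g 0 i).
  rewrite /f1 /flux_integrand bgE -addrA; congr (_ + _).
  by rewrite -sumrB; apply: eq_bigr => i _; rewrite mulrBr.
have mf1 : measurable_fun Omega f1.
  by apply: measurable_funB => //; exact: measurable_funTS.
have f1out x : ~ cube z r x -> f1 x = 0.
  by move=> h; rewrite /f1 flux_out// bg_out// subrr.
pose c1 := r ^+ 4 * (d%:R * C) + d%:R * (4 * d%:R * r ^+ 3 * om).
have c10 : 0 <= c1 by rewrite addr_ge0// !mulr_ge0 ?exprn_ge0.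
have f1le x : cube z r x -> Omega x -> `|f1 x| <= c1.
  move=> xz Ox; rewrite f1E; apply: le_trans (ler_normD _ _) _; apply: lerD.
    by rewrite normrM ler_pM ?bump_le//; exact: (@divG_le _ _ Omega).
  apply: le_trans (ler_norm_sum _ _ _) _.
  have -> : d%:R * (4 * d%:R * r ^+ 3 * om) = \sum_(i < d) (4 * d%:R * r ^+ 3 * om).
    by rewrite sumr_const card_ord mulr_natl.
  by apply: ler_sum => i _; rewrite normrM ler_pM ?bump_grad_le ?Gg.
have mA : measurable (cube z r `&` Omega) by apply: measurableI => //; exact: measurable_cube.
have Az : cube z r `&` Omega `<=` cube z r by move=> x [].
have f1c : (\int[mu]_(x in Omega) f1 x)%R = (\int[mu]_(x in cube z r `&` Omega) f1 x)%R.
  rewrite setIC Rintegral_mkcondr; apply: eq_Rintegral => x _.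
  by rewrite patchE; case: ifPn => // /negP; rewrite inE => /f1out.
have int_f1 : `|(\int[mu]_(x in Omega) f1 x)%R| <= c1 * (2 * r) ^+ d.
  rewrite f1c; apply: (@le_trans _ _ (c1 * fine (mu (cube z r `&` Omega)))).
    apply: le_norm_Rintegral => //; first exact: sub_cube_lty Az.
      exact: measurable_funS mf1.
    by move=> x [xz Ox]; exact: f1le.
  by rewrite ler_wpM2l//; exact: (@fine_le_cube z).
have f1i : mu.-integrable Omega (EFin \o f1).
  apply/(integrable_mkcond _ mO).
  have -> : ((EFin \o f1) \_ Omega)%E = EFin \o (f1 \_ Omega) by rewrite restrict_EFin.
  apply: (supp_integrable (measurable_cube z r) (lebesgue_rV_cube_lty z r) (C := c1)).
  - by apply: (measurable_restrictT _ _).1.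
  - by move=> x h; rewrite patchE; case: ifPn => // _; exact: f1out.
  - move=> x; rewrite patchE; case: ifPn; rewrite ?inE ?normr0// => Ox.
    by have [xz|xz] := pselect (cube z r x); [exact: f1le|rewrite f1out// normr0].
have -> : local_flux r Omega G z = (\int[mu]_(x in Omega) f1 x)%R + (\int[mu]_(x in Omega) bg x)%R.
  rewrite -RintegralD//; last exact: (integrableS measurableT).
  by apply: eq_Rintegral => x _; rewrite /f1 subrK.
apply: le_trans (ler_normD _ _) _; exact: lerD.
Qed.
End good_point_flux.
End flux_estimates.

(** * Divergence theorem on a Lipschitz domain *)

(** Heine's theorem for continuity relative to [K]: compactness in its near-covering form, with the
    radius of continuity at each point halved so that the neighbours of nearby points are still
    controlled. *)
Lemma compact_unif_continuous (R : realType) (V : normedModType R) (K : set V) (f : V -> R) :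
  compact K -> {within K, continuous f} -> forall e, 0 < e ->
  exists2 del, 0 < del & forall x y, K x -> K y -> `|x - y| <= del -> `|f x - f y| <= e.
Proof.
move=> cK cf e e0.
have e20 : 0 < e / 2 by rewrite divr_gt0.
pose P (del : R) x := forall y, K y -> `|x - y| <= del -> `|f x - f y| <= e.
have : near_covering_within K by apply/near_covering_withinP/compact_near_coveringP.
move=> /(_ R (nbhs (0 : R)) P (nbhs_filter _)).
have step x : K x -> \forall x' \near x & i \near nbhs (0 : R), K x' -> P i x'.
  move=> Kx.
  have /subspace_continuousP/(_ x Kx)/cvgrPdist_le/(_ _ e20) := cf.
  rewrite /prop_near1 /within/= => /nbhs_ballP[rho /= rho0 hrho].
  have hr y : K y -> `|x - y| < rho -> `|f x - f y| <= e / 2.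
    by move=> Ky xy; apply: (hrho y) => //=; rewrite -ball_normE.
  have rho20 : 0 < rho / 2 by rewrite divr_gt0.
  exists (ball x (rho / 2), ball 0 (rho / 2)); first by split; exact: nbhsx_ballx.
  move=> [x' i] /= [xx' ii] Kx' y Ky x'y.
  move: xx' ii; rewrite -!ball_normE/= sub0r normrN => xx' ii.
  have ii' : i < rho / 2 by apply: le_lt_trans (ler_norm _) ii.
  have h1 := hr x' Kx' (lt_trans xx' _); have h2 := hr y Ky.
  have xy : `|x - y| < rho.
    rewrite -(subrKA x') (splitr rho); apply: le_lt_trans (ler_normD _ _) _.
    by apply: ltrD => //; exact: le_lt_trans ii'.
  rewrite -(subrKA (f x)) (splitr e); apply: le_trans (ler_normD _ _) _.
  apply: lerD; last exact: h2.
  rewrite distrC; apply: h1; rewrite [ltRHS](splitr rho) ltrDr//.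
move=> /(_ step) [del /= del0 h]; exists (del / 2); first by rewrite divr_gt0.
move=> x y Kx Ky xy; apply: (h (del / 2)) => //=.
by rewrite sub0r normrN gtr0_norm ?divr_gt0//; lra.
Qed.

Lemma compact_cont_bounded (R : realType) (V : normedModType R) (K : set V) (f : V -> R) :
  compact K -> {within K, continuous f} -> exists2 C, 0 <= C & forall x, K x -> `|f x| <= C.
Proof.
move=> cK cf; have /compact_bounded[M [_ hM]] := continuous_compact cf cK.
exists (`|M| + 1); first by rewrite addr_ge0.
move=> x Kx; apply: (hM (`|M| + 1)); last by exists x.
by rewrite (le_lt_trans (ler_norm M))// ltrDl.
Qed.

Lemma compact_cube (R : realType) (n : nat) (z : 'rV[R]_n) s : compact (cube z s).
Proof.
apply: bounded_closed_compact.
  exists (`|z| + s); split; [exact: num_real|move=> M hM y /= yz].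
  apply: le_trans (ltW hM); rewrite -(subrK z y) addrC.
  by apply: le_trans (ler_normD _ _) _; rewrite lerD2l.
have -> : cube z s = (fun y : 'rV[R]_n => `|y - z|) @^-1` [set t | t <= s] by [].
apply: closed_comp => [y _|]; last exact: closed_le.
apply: (@cvg_norm _ _ _ (nbhs y)).
by apply: (@cvgB _ _ _ (nbhs y)); [exact: cvg_id|exact: cvg_cst].
Qed.

Lemma compact_closure_cube (R : realType) (n : nat) (A : set 'rV[R]_n) B :
  A `<=` cube 0 B -> compact (closure A).
Proof.
move=> AB; apply: (subclosed_compact _ (@compact_cube R n 0 B)); first exact: closed_closure.
have cC : closed (cube (0 : 'rV[R]_n) B).
  by apply: compact_closed; [exact: norm_hausdorff|exact: compact_cube].
by rewrite (closure_id (cube (0 : 'rV[R]_n) B)).1//; exact: closure_subset.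
Qed.
Section neumann_divergence.
Context {R : realType} {d : nat}.
Local Notation E := 'rV[R]_d.
Local Notation mu := (lebesgue_rV d).

Lemma enorm_le (x : E) : enorm x <= d%:R * `|x|.
Proof.
have h : dotv x x <= (d%:R * `|x|) ^+ 2.
  apply: le_trans (ler_norm _) _; apply: le_trans (dotv_abs_le _ _) _.
  rewrite -expr2 exprMn ler_wpM2r ?sqr_ge0//.
  by rewrite -natrX ler_nat; case: (d) => // n; rewrite expnS expn1 leq_pmull.
rewrite -(@ger0_norm _ (d%:R * `|x|)) ?mulr_ge0// -sqrtr_sqr.
by rewrite ler_sqrt ?sqr_ge0.
Qed.

Lemma lipschitz_enorm_sup (phi : E -> R) (L : R) :
  (forall y z, `|phi y - phi z| <= L * enorm (y - z)) ->
  forall y z, `|phi y - phi z| <= (`|L| * d%:R) * `|y - z|.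
Proof.
move=> h y z; apply: le_trans (h y z) _.
apply: (@le_trans _ _ (`|L| * enorm (y - z))).
  by rewrite ler_wpM2r ?ler_norm// sqrtr_ge0.
by rewrite -mulrA ler_wpM2l// enorm_le.
Qed.

Lemma enorm1_dotv (e : E) : enorm e = 1 -> dotv e e = 1.
Proof.
by move=> e1; rewrite -[LHS](sqr_sqrtr (dotvv_ge0 e)) -[Num.sqrt _]/(enorm e) e1 expr1n.
Qed.

Section invariance.
Variables (phi : E -> R) (e : E).
Hypothesis phie : forall y a, phi (y + a *: e) = phi y.

(** Good points form a union of lines along [e]. Hence a point close to the boundary is as good as
    the point of the graph on the same line, and good and bad sets can be measured along these
    lines. *)
Lemma lin_approx_shift m (V : 'M[R]_(m, d)) (B eps r : R) y a :
  lin_approx phi V B eps r y -> lin_approx phi V B eps r (y + a *: e).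
Proof.
move=> [p pB hp]; exists p => // t tr.
have -> : y + a *: e + t *m V = y + t *m V + a *: e by rewrite addrAC.
by rewrite !phie; exact: hp.
Qed.

Lemma lin_diff_shift m (V : 'M[R]_(m, d)) (B : R) y a :
  lin_diff phi V B y -> lin_diff phi V B (y + a *: e).
Proof. by move=> h k _; have [n _ hn] := h k Logic.I; exists n => //; exact: lin_approx_shift. Qed.

Lemma grad_shift y a : grad phi (y + a *: e) = grad phi y.
Proof.
apply/rowP => i; rewrite !mxE /pderiv /derive.
suff -> : (fun h : R => h^-1 *: ((phi \o shift (y + a *: e)) (h *: evec i) - phi (y + a *: e)))
  = (fun h : R => h^-1 *: ((phi \o shift y) (h *: evec i) - phi y)) by [].
by apply/funext => h /=; rewrite addrA !phie.
Qed.
End invariance.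

Variables (Omega : set E) (B C : R) (G Gh : 'I_d -> E -> R).
Hypothesis oO : open Omega.
Hypothesis OB : Omega `<=` cube 0 B.
Hypothesis dG : forall i x, Omega x -> derivable (G i) x (evec i).
Hypothesis mG : forall i, measurable_fun Omega (G i).
Hypothesis mDG : forall i, measurable_fun Omega (pderiv i (G i)).
Hypothesis C0 : 0 <= C.
Hypothesis GC : forall i x, Omega x -> `|G i x| <= C.
Hypothesis DGC : forall i x, Omega x -> `|pderiv i (G i) x| <= C.
Hypothesis cGh : forall i, {within closure Omega, continuous (Gh i)}.
Hypothesis GhE : forall i x, Omega x -> G i x = Gh i x.
Hypothesis GhC : forall i x, closure Omega x -> `|Gh i x| <= C.
Hypothesis Gh_normal : forall x0 n, outer_normal Omega x0 n -> \sum_i Gh i x0 * n 0 i = 0.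

Let compact_closure : compact (closure Omega) := compact_closure_cube OB.

(** * Fluxes near the boundary within one Lipschitz chart *)

Section chart.
Variables (x0 e : E) (phi : E -> R).
Hypothesis chart : lipschitz_graph_at Omega x0 e phi.

Let e1 : dotv e e = 1. Proof. by case: chart => h _ _ _; exact: enorm1_dotv. Qed.
Let e_le1 : `|e| <= 1. Proof. exact: norm_le1_unit. Qed.
Let phie y a : phi (y + a *: e) = phi y. Proof. by case: chart. Qed.

Lemma chart_lip : exists2 L, 0 <= L & forall y z, `|phi y - phi z| <= L * `|y - z|.
Proof.
case: chart => _ _ [L h] _; exists (`|L| * d%:R); first by rewrite mulr_ge0.
exact: lipschitz_enorm_sup.
Qed.

Lemma chart_radius : exists2 R1, 0 < R1 &
  forall y, `|y - x0| <= R1 -> (Omega y <-> dotv y e < phi y).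
Proof.
case: chart => _ _ _; rewrite /prop_near1 => /nbhs_ballP[s /= s0 h].
exists (s / 2); first by rewrite divr_gt0.
move=> y ys; apply: h; rewrite -ball_normE/= distrC.
by apply: le_lt_trans ys _; lra.
Qed.

(** Strictly below the graph a point belongs to [Omega]; strictly above it, so do all its
    neighbours, which are then outside [Omega], and the point is not in the closure. *)
Lemma boundary_graph R1 y : 0 < R1 ->
  (forall y, `|y - x0| <= R1 -> (Omega y <-> dotv y e < phi y)) ->
  `|y - x0| < R1 -> boundary Omega y -> dotv y e = phi y.
Proof.
move=> R10 hR yR [cly nOy].
have [L L0 phiL] := chart_lip.
apply/eqP; rewrite eq_le; apply/andP; split; last first.
  by rewrite leNgt; apply/negP => h; apply: nOy; apply/hR => //; exact: ltW.
rewrite leNgt; apply/negP => h.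
have cf : continuous (fun y => dotv y e - phi y).
  move=> u; apply: (@cvgB _ _ _ (nbhs u)); first exact: dotv_continuous.
  exact: lipschitz_rV_continuous phiL _.
have pos : 0 < dotv y e - phi y by rewrite subr_gt0.
have near1 : \forall u \near y, 0 < dotv u e - phi u by exact: (cvgr_gt _ (cf y) _ pos).
have near2 : \forall u \near y, `|u - x0| < R1.
  have cn : (fun u : E => `|u - x0|) @ nbhs y --> `|y - x0|.
    apply: (@cvg_norm _ _ _ (nbhs y)).
    by apply: (@cvgB _ _ _ (nbhs y)); [exact: cvg_id|exact: cvg_cst].
  exact: (cvgr_lt _ cn _ yR).
have [u [Ou [u1 u2]]] := cly _ (filterI near1 near2).
have := (hR u (ltW u2)).1 Ou; move: u1; rewrite /= subr_gt0 => a b.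
by have := lt_trans a b; rewrite ltxx.
Qed.

(** Moving down from the graph along [e] by an arbitrarily small [t] enters [Omega], since [phi]
    does not change along [e]. *)
Lemma graph_boundary R1 y : 0 < R1 ->
  (forall y, `|y - x0| <= R1 -> (Omega y <-> dotv y e < phi y)) ->
  `|y - x0| < R1 -> dotv y e = phi y -> boundary Omega y.
Proof.
move=> R10 hR yR yphi; split; last first.
  by move=> /(hR y (ltW yR)); rewrite yphi ltxx.
move=> U /nbhs_ballP[s /= s0 sU].
pose t := Num.min (s / 2) ((R1 - `|y - x0|) / 2).
have t0 : 0 < t by rewrite lt_min !divr_gt0// subr_gt0.
have ts : t <= s / 2 by rewrite ge_min lexx.
have tR : t <= (R1 - `|y - x0|) / 2 by rewrite ge_min lexx orbT.
exists (y + (- t) *: e).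
have nte : `|(- t) *: e| <= t by rewrite normrZ normrN gtr0_norm// ler_piMr// ltW.
split.
  apply/hR.
    rewrite addrAC; apply: le_trans (ler_normD _ _) _.
    move: yR nte tR; lra.
  by rewrite phie -yphi dotvC dotvDr dotvZr e1 [dotv e y]dotvC; lra.
apply: sU; rewrite -ball_normE/= opprD addrA subrr add0r normrN.
by apply: le_lt_trans nte _; lra.
Qed.
(** [phi] has no increment along [e], so its linear part there is bounded by every approximation
    error. *)
Lemma grad_invariant (L Bd : R) z : (forall y w, `|phi y - phi w| <= L * `|y - w|) ->
  lin_diff phi (1%:M : 'M[R]_d) Bd z -> dotv (grad phi z) e = 0.
Proof.
move=> phiL hz.
have h k : `|dotv (grad phi z) e| <= (1 + d%:R) * k.+1%:R^-1.
  have [n _ hn] := hz k Logic.I.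
  have n0 : 0 < n.+1%:R^-1 :> R by rewrite invr_gt0.
  have tn : `|n.+1%:R^-1 *: e| <= n.+1%:R^-1.
    by rewrite normrZ gtr0_norm// ler_piMr// ltW.
  have k0 : 0 <= k.+1%:R^-1 :> R by rewrite invr_ge0.
  have := lin_approx_grad phiL k0 n0 hz hn tn.
  rewrite phie subrr sub0r normrN dotvZr normrM gtr0_norm// => h.
  have : n.+1%:R^-1 * `|dotv (grad phi z) e| <= n.+1%:R^-1 * ((1 + d%:R) * k.+1%:R^-1).
    apply: le_trans h _; rewrite [leRHS]mulrC ler_wpM2l//.
  by rewrite ler_pM2l.
apply/eqP; rewrite -normr_le0; apply/ler_addgt0Pr => q q0; rewrite add0r.
have [k kq] : exists k, (1 + d%:R) / q < k.+1%:R.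
  by exists (Num.truncn ((1 + d%:R) / q)); rewrite Num.Theory.truncnS_gt.
apply: le_trans (h k) _; rewrite ler_pdivrMr// mulrC -ler_pdivrMr//; exact: ltW.
Qed.

Lemma local_flux_near_boundary (L R1 z0 r eps rr om : R) (z : E) :
  (forall y w, `|phi y - phi w| <= L * `|y - w|) -> 
  (forall y, `|y - x0| <= R1 -> (Omega y <-> dotv y e < phi y)) ->
  0 < r -> r <= rr -> 0 <= eps -> 0 <= om -> 0 <= z0 ->
  `|z - x0| <= R1 / 2 -> `|dotv z e - phi z| <= z0 * r -> (z0 + 1) * r <= R1 / 4 ->
  lin_diff phi (1%:M : 'M[R]_d) `|L| z -> lin_approx phi (1%:M : 'M[R]_d) `|L| eps rr z ->
  (forall i x y, closure Omega x -> closure Omega y -> `|x - y| <= (z0 + 1) * r ->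
     `|Gh i x - Gh i y| <= om) ->
  `|local_flux r Omega G z| <=
   (r ^+ 4 * (d%:R * C) + d%:R * (4 * d%:R * r ^+ 3 * om)) * (2 * r) ^+ d +
   4 * d%:R * r ^+ 3 * C * (2 * ((1 + d%:R) * eps) * (4 * r) ^+ d).
Proof.
move=> phiL hR r0 rrr eps0 om0 z00 zx ze zr hd ha Gu.
have z0r : 0 <= z0 * r by rewrite mulr_ge0// ltW.
have R10 : 0 < R1 by move: zr; rewrite mulrDl mul1r; move: r0 z0r; lra.
(* Signed height of the graph over [z]; it is also the offset of the approximating half-space. *)
pose a := phi z - dotv z e; pose x1 := z + a *: e; pose p := grad phi z.
have aA : `|a| <= z0 * r by rewrite /a distrC.
have x1z : `|x1 - z| <= z0 * r.
  rewrite /x1 addrAC subrr add0r normrZ; apply: le_trans _ aA.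
  by rewrite ler_piMr.
have x1R : `|x1 - x0| < R1.
  rewrite -(subrK z x1) -addrA; apply: le_lt_trans (ler_normD _ _) _.
  move: zr; rewrite mulrDl mul1r; move: r0 x1z zx R10; lra.
have x1b : boundary Omega x1.
  apply: (graph_boundary R10 hR) => //.
  by rewrite dotvC dotvDr dotvZr e1 mulr1 dotvC phie /a addrC subrK.
have pe : dotv p e = 0 by exact: grad_invariant phiL hd.
have n1 : outer_normal Omega x1 ((enorm (e - p))^-1 *: (e - p)).
  split => //; exists e, phi; split.
  - case: chart => h1 h2 h3 _; split => //; rewrite /prop_near1.
    apply/nbhs_ballP; exists (R1 - `|x1 - x0|) => /=; first by rewrite subr_gt0.
    move=> y; rewrite -ball_normE/= distrC => yx; apply: hR.
    rewrite -(subrK x1 y) -addrA; apply: le_trans (ler_normD _ _) _.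
    by move: yx; lra.
  - apply: (lin_diff_differentiable phiL (B := `|L|)).
    exact: lin_diff_shift.
  - by rewrite grad_shift.
pose g : E := \row_i Gh i x1.
have gm : dotv g (e - p) = 0.
  have := Gh_normal n1.
  have -> : \sum_i Gh i x1 * ((enorm (e - p))^-1 *: (e - p)) 0 i =
      (enorm (e - p))^-1 * dotv g (e - p).
    rewrite /dotv mulr_sumr; apply: eq_bigr => i _.
    by rewrite !mxE mulrCA.
  move/eqP; rewrite mulf_eq0 invr_eq0 => /orP[/eqP|/eqP//].
  (* The normal does not vanish: [p] is orthogonal to the unit vector [e], so the square of its
     length is [1 + dotv p p]. *)
  rewrite /enorm => /eqP; rewrite sqrtr_eq0 => h.
  have : dotv (e - p) (e - p) = 1 + dotv p p.
    rewrite dotvBr [dotv _ e]dotvC [dotv _ p]dotvC !dotvBr e1 pe [dotv e p]dotvC pe.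
    by rewrite subr0 sub0r opprK.
  move=> hh; move: h; rewrite hh => h; have := dotvv_ge0 p.
  by move: h; lra.
have gC : `|g| <= C.
  apply/(rV_norm_le _ C0) => i; rewrite mxE; apply: GhC.
  by case: x1b.
apply: (@local_flux_good _ _ r Omega C G _ _ _ _ _ _ z e p g a) => //.
- exact: ltW.
- by rewrite mulr_ge0// addr_ge0.
- move=> x i xz Ox; rewrite mxE GhE//; apply: Gu.
  + exact: subset_closure.
  + by case: x1b.
  + rewrite -(subrK z x) -addrA; apply: le_trans (ler_normD _ _) _.
    by move: xz x1z; rewrite /cube/= [`|z - x1|]distrC mulrDl mul1r; lra.
- move=> x xz Ox.
  have xR : `|x - x0| <= R1.
    rewrite -(subrK z x) -addrA; apply: le_trans (ler_normD _ _) _.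
    by move: xz zx zr z0r; rewrite /cube/= mulrDl mul1r; lra.
  have h := (hR x xR).1 Ox.
  have tr : `|x - z| <= rr by apply: le_trans rrr; exact: xz.
  have := lin_approx_grad phiL eps0 (lt_le_trans r0 rrr) hd ha tr.
  rewrite addrCA subrr addr0 => /(le_trans (ler_norm _)) hh.
  have hr : (1 + d%:R) * eps * `|x - z| <= (1 + d%:R) * eps * r.
    by rewrite ler_wpM2l// mulr_ge0// addr_ge0.
  (* The first difference is negative in [Omega], and the parenthesis is the error of the linear
     approximation at [z]. *)
  have -> : dotv (x - z) (e - p) - a = dotv x e - phi x + (phi x - phi z - dotv p (x - z)).
    rewrite dotvBr ![dotv (x - z) _]dotvC !dotvBr /a ![dotv e _]dotvC; lra.
  by move: hh hr h; rewrite -/p; lra.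
- move=> x xz Ox.
  have xR : `|x - x0| <= R1.
    rewrite -(subrK z x) -addrA; apply: le_trans (ler_normD _ _) _.
    by move: xz zx zr z0r; rewrite /cube/= mulrDl mul1r; lra.
  have h : phi x <= dotv x e by rewrite leNgt; apply/negP => h; apply: Ox; apply/hR.
  have tr : `|x - z| <= rr by apply: le_trans rrr; exact: xz.
  have := lin_approx_grad phiL eps0 (lt_le_trans r0 rrr) hd ha tr.
  rewrite addrCA subrr addr0 distrC => /(le_trans (ler_norm _)) hh.
  have hr : (1 + d%:R) * eps * `|x - z| <= (1 + d%:R) * eps * r.
    by rewrite ler_wpM2l// mulr_ge0// addr_ge0.
  have -> : dotv (x - z) (e - p) - a = dotv x e - phi x - (dotv p (x - z) - (phi x - phi z)).
    rewrite dotvBr ![dotv (x - z) _]dotvC !dotvBr /a ![dotv e _]dotvC; lra.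
  by move: hh hr h; rewrite -/p; lra.
Qed.
Section strip.
Variables (L R1 z0 : R).
Hypothesis phiL : forall y w, `|phi y - phi w| <= L * `|y - w|.
Hypothesis R10 : 0 < R1.
Hypothesis z00 : 0 <= z0.

Definition strip r : set E :=
  cube x0 (R1 / 2) `&` [set z | `|dotv z e - phi z| <= z0 * r].

Lemma measurable_strip r : measurable (strip r).
Proof.
apply: measurableI; first exact: measurable_cube.
have mf : measurable_fun setT (fun z : E => dotv z e - phi z : measurableTypeR R).
  apply: continuous_measurable_rV => x.
  apply: (@cvgB _ _ _ (nbhs x)); first exact: dotv_continuous.
  exact: lipschitz_rV_continuous phiL _.
have -> : [set z : E | `|dotv z e - phi z| <= z0 * r] =
  (fun z : E => dotv z e - phi z : measurableTypeR R) @^-1` `[- (z0 * r), z0 * r]%classic.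
  by apply/seteqP; split=> x /=; rewrite in_itv/= ler_norml.
by rewrite -[X in measurable X]setTI; exact: mf.
Qed.

(** A line along [e] meets the strip in length at most [2 * (z0 * r)], and a segment of length
    [R1 / 2] ending in the strip starts in [cube x0 R1]. Since [A] is invariant along [e], its
    measure comes out as a factor: the whole space gives a layer of measure O(r), a small [A] a
    small fraction of it. *)
Lemma strip_le r (A : set E) : 0 <= r -> measurable A ->
  (forall y a, A y -> A (y + a *: e)) ->
  (mu (strip r `&` A) <= (4 * z0 * r / R1)%:E * mu (A `&` cube x0 R1))%E.
Proof.
move=> r0 mA Ae.
have h : ((R1 / 2)%:E * mu (strip r `&` A) <= (2 * (z0 * r))%:E * mu (A `&` cube x0 R1))%E.
  apply: (@measure_le_lines _ _ e) => //.
  - by rewrite divr_ge0// ltW.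
  - by rewrite !mulr_ge0.
  - by apply: measurableI => //; exact: measurable_strip.
  - by apply: measurableI => //; exact: measurable_cube.
  - move=> x t /andP[t0 tT] [[c1 c2] hA]; split.
      by have := Ae _ (- t) hA; rewrite -addrA -scalerDl subrr scale0r addr0.
    have -> : x = x + t *: e - t *: e by rewrite addrK.
    move: c1; rewrite /cube/= => c1; rewrite addrAC; apply: le_trans (ler_normB _ _) _.
    have : `|t *: e| <= t by rewrite normrZ ger0_norm// ler_piMr.
    by move: c1 tT; lra.
  - move=> x _; pose a := phi x - dotv x e.
    have sub : [set t | 0 <= t <= R1 / 2 /\ (strip r `&` A) (x + t *: e)] `<=`
        `[a - z0 * r, a + z0 * r]%classic.
      move=> t [_ [[_ /= h] _]]; rewrite in_itv/= -ler_distl /a.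
      move: h; rewrite phie dotvC dotvDr dotvZr e1 dotvC mulr1.
      by have -> : dotv x e + t - phi x = t - (phi x - dotv x e) by lra.
    apply: (@le_trans _ _ (lebesgue_measure `[a - z0 * r, a + z0 * r]%classic)).
      have mS : measurable (strip r `&` A) by apply: measurableI => //; exact: measurable_strip.
      apply: le_measure => //; rewrite inE//.
      have -> : [set t | 0 <= t <= R1 / 2 /\ (strip r `&` A) (x + t *: e)] =
        `[0, R1 / 2]%classic `&` ((fun t : R => x + t *: e) @^-1` (strip r `&` A)).
        by apply/seteqP; split=> t /=; rewrite in_itv/=.
      apply: measurableI => //; rewrite -[X in measurable X]setTI.
      have ml : measurable_fun setT (fun t : measurableTypeR R => x + (t : R) *: e : E).
        by have := measurableT_comp (measurable_line e)
          (@pair2_measurable _ _ (measurableTypeR R) E x); exact.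
      exact: (ml measurableT _ mS).
    have zr : 0 <= z0 * r by rewrite mulr_ge0.
    by rewrite lebesgue_measure_itvcc ?lee_fin; move: zr; lra.
have R1h : 0 < R1 / 2 by rewrite divr_gt0.
rewrite -(@lee_pmul2l _ (R1 / 2)%:E)//.
apply: le_trans h _; rewrite muleA -EFinM.
have -> // : R1 / 2 * (4 * z0 * r / R1) = 2 * (z0 * r).
by field; rewrite gt_eqF.
Qed.

(** The failure of approximation at the fixed scale [n.+1%:R^-1], and not at the running scale [r]:
    one set of small measure then serves all small [r]. *)
Definition bad k n : set E :=
  ~` (lin_diff phi (1%:M : 'M[R]_d) `|L| `&`
      lin_approx phi (1%:M : 'M[R]_d) `|L| k.+1%:R^-1 n.+1%:R^-1).

Lemma measurable_bad k n : measurable (bad k n).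
Proof.
apply: measurableC; apply: measurableI.
  exact: (measurable_lin_diff phiL).
exact: (measurable_lin_approx phiL).
Qed.

Lemma bad_shift k n y a : bad k n y -> bad k n (y + a *: e).
Proof.
move=> h [h1 h2]; apply: h; rewrite -(addrK (a *: e) y) -scaleNr; split.
  exact: lin_diff_shift.
exact: lin_approx_shift.
Qed.

(** The sets decrease with [n], and a point of their intersection is not differentiable, so the
    intersection is null by Rademacher; finite measure in the cube gives continuity from above. *)
Lemma bad_cvg k : (mu (bad k n `&` cube x0 R1) @[n --> \oo] --> 0)%E.
Proof.
have E0 : mu (\bigcap_n (bad k n `&` cube x0 R1)) = 0%E.
  apply/eqP; rewrite eq_le measure_ge0 andbT -(rademacher phiL).
  apply: le_measure.
  - rewrite inE; apply: bigcapT_measurable => n; apply: measurableI; first exact: measurable_bad.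
    exact: measurable_cube.
  - by rewrite inE; apply: measurableC; exact: (measurable_lin_diff phiL).
  - move=> y h hd; have [n _ hn] := hd k Logic.I.
    by have [hb _] := h n Logic.I; apply: hb.
rewrite -E0; apply: nonincreasing_cvg_mu.
- apply: (@le_lt_trans _ _ (mu (cube x0 R1))); last exact: lebesgue_rV_cube_lty.
  apply: le_measure => //; rewrite inE; last exact: measurable_cube.
  by apply: measurableI; [exact: measurable_bad|exact: measurable_cube].
- by move=> n; apply: measurableI; [exact: measurable_bad|exact: measurable_cube].
- apply: bigcapT_measurable => n.
  by apply: measurableI; [exact: measurable_bad|exact: measurable_cube].
- move=> n m nm; apply/subsetPset => y [hb hc]; split => // -[hd [p pB hp]]; apply: hb; split=> //.
  exists p => // t tm; apply: hp; apply: le_trans tm _.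
  by rewrite lef_pV2 ?posrE// ler_nat ltnS.
Qed.
End strip.
Lemma Gh_modulus (om : R) : 0 < om -> exists2 del, 0 < del &
  forall i x y, closure Omega x -> closure Omega y -> `|x - y| <= del -> `|Gh i x - Gh i y| <= om.
Proof.
move=> om0.
have h i : exists del, 0 < del /\ forall x y, closure Omega x -> closure Omega y ->
    `|x - y| <= del -> `|Gh i x - Gh i y| <= om.
  have [del d0 hd] := compact_unif_continuous compact_closure (@cGh i) om0.
  by exists del.
have [del hdel] := choice h.
(* The default value 1 keeps the minimum positive, also for an empty range. *)
exists (\big[Num.min/1]_i del i).
  by apply: lt_bigmin => // i _; have [] := hdel i.
move=> i x y cx cy xy; apply: (hdel i).2 => //.
by apply: le_trans xy _; apply: bigmin_le_cond.
Qed.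

(* The majorant [b] is [local_flux_le] on the bad points of the strip and
   [local_flux_near_boundary] on the rest of it. *)
Lemma chart_estimate : exists2 R2, 0 < R2 & forall eta, 0 < eta -> exists2 r1, 0 < r1 &
  forall r, 0 < r -> r <= r1 -> exists b : E -> \bar R,
  [/\ measurable_fun setT b, forall z, (0 <= b z)%E,
      (\int[mu]_z b z <= (eta * r ^+ (d + 4))%:E)%E &
      forall z y, boundary Omega y -> `|y - x0| <= R2 -> `|z - y| <= r ->
        (`|local_flux r Omega G z|%:E <= b z)%E].
Proof.
have [L L0 phiL] := chart_lip; have [R1 R10 hR] := chart_radius.
(* With [r <= R1 / 4], centres within [r] of these boundary points stay in the cube of radius
   [R1 / 2] of the strip. *)
exists (R1 / 4); first by rewrite divr_gt0.
move=> eta eta0.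
(* A centre within [r] of the graph has height at most [z0 * r]: [d%:R] for the variation of
   [dotv _ e], [L] for that of [phi]. *)
pose z0 : R := d%:R + L.
have z00 : 0 <= z0 by rewrite addr_ge0.
pose M : R := 4 * z0 / R1.
have M0 : 0 <= M by rewrite divr_ge0// ?mulr_ge0// ltW.
pose W : R := (2 * R1) ^+ d.
have W0 : 0 <= W by rewrite exprn_ge0// mulr_ge0// ltW.
(* Once [r <= 1] and [r <= eps], the crude flux is at most [K1 * r ^+ (d + 3)] and the flux at good
   centres at most [K2 * eps * r ^+ (d + 3)]; the strip has measure at most [M * r * W]. *)
pose K1 : R := (d%:R * C + 4 * d%:R ^+ 2 * C) * 2 ^+ d.
have K10 : 0 <= K1 by rewrite mulr_ge0// addr_ge0// !mulr_ge0// sqr_ge0.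
pose K2 : R := (d%:R * C + 4 * d%:R ^+ 2) * 2 ^+ d + 8 * d%:R * (1 + d%:R) * C * 4 ^+ d.
have K20 : 0 <= K2.
  rewrite addr_ge0//; last by rewrite !mulr_ge0// ?addr_ge0// exprn_ge0.
  by rewrite mulr_ge0 ?exprn_ge0// addr_ge0// !mulr_ge0// sqr_ge0.
(* The order of choice matters: [k], hence [eps], brings the good centres below half of [eta]; then
   [del] and [n] do so for the bad ones, whose definition involves [k]; only then is [r]
   restricted. *)
have [k kq] : exists k, M * K2 * W * 2 / eta < k.+1%:R.
  by exists (Num.truncn (M * K2 * W * 2 / eta)); rewrite Num.Theory.truncnS_gt.
pose eps : R := k.+1%:R^-1.
have eps0 : 0 < eps by rewrite invr_gt0.
have epsE : M * K2 * W * eps <= eta / 2.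
  by rewrite /eps ler_pdivrMr//; move: kq; rewrite ltr_pdivrMr//; lra.
pose del : R := eta / (2 * (M * K1 + 1)).
have MK : 0 < 2 * (M * K1 + 1) by rewrite mulr_gt0// ltr_wpDl// mulr_ge0.
have del0 : 0 < del by rewrite divr_gt0.
have delE : M * K1 * del <= eta / 2.
  by rewrite /del mulrA ler_pdivrMr//; move: eta0; lra.
have [n nbad] : exists n, (mu (bad L k n `&` cube x0 R1) <= del%:E)%E.
  have cv := bad_cvg R1 phiL k.
  have : \forall n \near \oo, (mu (bad L k n `&` cube x0 R1) < del%:E)%E.
    apply: (cv [set x | (x < del%:E)%E]); apply: open_nbhs_nbhs; split.
      exact: open_ereal_lt_ereal.
    by rewrite /= lte_fin.
  by move=> [n _ hn]; exists n; apply/ltW/hn => /=.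
have [u u0 hu] := Gh_modulus eps0.
(* In this order: comparison of powers of [r], scale of the linear approximation, modulus of
   continuity of [Gh], room inside the chart. *)
pose r1 := Num.min (Num.min 1 eps) (Num.min n.+1%:R^-1 (Num.min (u / (z0 + 1)) (R1 / 4 / (z0 + 1)))).
have z01 : 0 < z0 + 1 by rewrite ltr_wpDl.
exists r1.
  by rewrite !lt_min ltr01 eps0 invr_gt0 !divr_gt0// ltr0n.
move=> r r0; rewrite !le_min => /andP[/andP[r_1 r_eps] /andP[r_n /andP[r_u r_R]]].
rewrite ler_pdivlMr// mulrC in r_u.
rewrite ler_pdivlMr// mulrC in r_R.
pose c1 := flux_bound (d := d) r C * (2 * r) ^+ d.
pose c2 := (r ^+ 4 * (d%:R * C) + d%:R * (4 * d%:R * r ^+ 3 * eps)) * (2 * r) ^+ d +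
   4 * d%:R * r ^+ 3 * C * (2 * ((1 + d%:R) * eps) * (4 * r) ^+ d).
have c10 : 0 <= c1.
  by rewrite /c1 /flux_bound mulr_ge0 ?exprn_ge0 ?addr_ge0 ?mulr_ge0 ?exprn_ge0// ltW.
have c20 : 0 <= c2.
  by rewrite /c2 !(addr_ge0, mulr_ge0, exprn_ge0)// ltW.
have c1E : c1 <= K1 * r ^+ (d + 3).
  rewrite /c1 /flux_bound /K1 exprMn exprD.
  have rr : 0 <= r ^+ 3 - r ^+ 4 by rewrite subr_ge0 exprS ler_piMl// exprn_ge0// ltW.
  move: (exprn_ge0 d (ltW r0)) (exprn_ge0 d (ler0n R 2)).
  move: (r ^+ d) (2 ^+ d) => X Y X0 Y0.
  have : 0 <= d%:R * C * (r ^+ 3 - r ^+ 4) * (X * Y) by rewrite !mulr_ge0.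
  by move: (d%:R : R) => D; lra.
have c2E : c2 <= K2 * eps * r ^+ (d + 3).
  rewrite /c2 /K2 !exprMn exprD.
  have rr : 0 <= r ^+ 3 * eps - r ^+ 4.
    by rewrite subr_ge0 exprSr ler_wpM2l// exprn_ge0// ltW.
  move: (exprn_ge0 d (ltW r0)) (exprn_ge0 d (ler0n R 2)).
  move: (r ^+ d) (2 ^+ d) (4 ^+ d) => X Y Z X0 Y0.
  have : 0 <= d%:R * C * (r ^+ 3 * eps - r ^+ 4) * (X * Y) by rewrite !mulr_ge0.
  by move: (d%:R : R) (eps) => D ep; lra.
have mS := measurable_strip R1 z0 phiL r.
have mB := measurable_bad phiL k n.
have mSB : measurable (strip R1 z0 r `&` bad L k n) by exact: measurableI.
pose b z := ((c1%:E * (\1_(strip R1 z0 r `&` bad L k n) z)%:E) + (c2%:E * (\1_(strip R1 z0 r) z)%:E))%E.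
have m1 (A : set E) (a : R) : measurable A -> measurable_fun setT (fun z => a%:E * (\1_A z)%:E : \bar R)%E.
  move=> mA; apply/measurable_EFinP; apply: measurable_funM; first exact: measurable_cst.
  exact: measurable_indic.
have b10 (A : set E) (a : R) z : 0 <= a -> (0 <= a%:E * (\1_A z)%:E)%E.
  by move=> a0; rewrite -EFinM lee_fin mulr_ge0.
exists b; split.
- by apply: emeasurable_funD; exact: m1.
- by move=> z; rewrite adde_ge0// b10.
- have I (A : set E) (a : R) : measurable A -> 0 <= a ->
     (\int[mu]_z (a%:E * (\1_A z)%:E) = a%:E * mu A)%E.
    move=> mA a0; rewrite ge0_integralZl_EFin//; last first.
      by apply/measurable_EFinP; exact: measurable_indic.
    by rewrite integral_indic// setIT.
  rewrite ge0_integralD//; try exact: m1; try by move=> z _; exact: b10.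
  rewrite !I//.
  have r_0 := ltW r0.
  have S1 : (mu (strip R1 z0 r `&` bad L k n) <= (M * r * del)%:E)%E.
    apply: le_trans (strip_le phiL R10 z00 r_0 mB (@bad_shift L k n)) _.
    have -> : M * r * del = 4 * z0 * r / R1 * del by rewrite /M; ring.
    by rewrite [leRHS]EFinM lee_wpmul2l// lee_fin divr_ge0 ?mulr_ge0// ltW.
  have S2 : (mu (strip R1 z0 r) <= (M * r * W)%:E)%E.
    have := strip_le phiL R10 z00 r_0 measurableT (fun _ _ _ => Logic.I).
    rewrite setIT setTI lebesgue_rV_cube; last exact: ltW.
    by rewrite -EFinM; have -> : M * r * W = 4 * z0 * r / R1 * W by rewrite /M; ring.
  apply: (@le_trans _ _ ((c1 * (M * r * del))%:E + (c2 * (M * r * W))%:E)%E).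
    by rewrite (EFinM c1) (EFinM c2) leeD// lee_wpmul2l// lee_fin.
  rewrite -EFinD lee_fin.
  apply: (@le_trans _ _ ((K1 * r ^+ (d + 3)) * (M * r * del) + (K2 * eps * r ^+ (d + 3)) * (M * r * W))).
    have h1 : 0 <= M * r * del by apply: mulr_ge0; [exact: mulr_ge0|exact: ltW].
    have h2 : 0 <= M * r * W by apply: mulr_ge0 => //; exact: mulr_ge0.
    by apply: lerD; exact: ler_wpM2r.
  rewrite !exprD exprS.
  have X0 := exprn_ge0 (d + 4) r_0.
  have : 0 <= r ^+ (d + 4) * (eta / 2 - M * K1 * del) by rewrite mulr_ge0// subr_ge0.
  have : 0 <= r ^+ (d + 4) * (eta / 2 - M * K2 * W * eps) by rewrite mulr_ge0// subr_ge0.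
  rewrite !exprD exprS; move: (r ^+ d) => X; lra.
- move=> z y yb yx zy.
  have zS : strip R1 z0 r z.
    have zr : 0 <= z0 * r by apply: mulr_ge0 => //; exact: ltW.
    have r4 : r <= R1 / 4 by move: r_R zr; rewrite mulrDl mul1r; lra.
    split.
      rewrite /cube/= -(subrK y z) -addrA; apply: le_trans (ler_normD _ _) _.
      by move: zy yx r4; lra.
    have yp : dotv y e = phi y.
      apply: (boundary_graph R10 hR) => //; apply: le_lt_trans yx _.
      by rewrite gtr_pMr// invf_lt1 ?ltr1n.
    rewrite /=; have -> : dotv z e - phi z = dotv e (z - y) + (phi y - phi z).
      by rewrite dotvBr ![dotv e _]dotvC yp; lra.
    apply: le_trans (ler_normD _ _) _; rewrite mulrDl; apply: lerD.
      apply: le_trans (dotv_abs_le _ _) _; rewrite ler_wpM2l//.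
      apply: le_trans zy; exact: ler_piMl.
    by apply: le_trans (phiL _ _) _; rewrite ler_wpM2l// distrC.
  have [zb|zb] := pselect (bad L k n z).
    apply: (@le_trans _ _ c1%:E).
      by rewrite lee_fin; apply: local_flux_le => //; exact: ltW.
    rewrite /b indicE mem_set// mule1 leeDl// b10//.
  move/contrapT : zb => [z1 z2].
  apply: (@le_trans _ _ c2%:E); last first.
    by rewrite /b [in X in (_ + X)%E]indicE mem_set// mule1 leeDr// b10.
  rewrite lee_fin; case: zS => zS1 zS2.
  apply: (local_flux_near_boundary phiL hR r0 r_n (ltW eps0) (ltW eps0) z00 zS1 zS2 r_R z1 z2).
  by move=> i x w cx cw xw; apply: hu => //; exact: le_trans r_u.
Qed.
End chart.

(** A segment in the cube from a point of [Omega] to a point outside would meet [Omega] in a set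
    that is relatively open and, as the boundary is avoided, relatively closed, against the
    connectedness of the segment. *)
Lemma cube_boundary (z : E) r : (forall y, cube z r y -> ~ boundary Omega y) ->
  cube z r `<=` Omega \/ (forall x, cube z r x -> ~ Omega x).
Proof.
move=> h; apply: contrapT => /not_orP[/nonsubset[w [wz nOw]] h2]; apply: h2 => x xz Ox.
pose f (t : R) : E := x + t *: (w - x).
have cf : continuous f.
  move=> t; apply: (@cvgD _ _ _ (nbhs t)); first exact: cvg_cst.
  by apply: (@cvgZr_tmp _ _ _ (nbhs t)) => //; exact: cvg_id.
have fz t : `[0, 1]%classic t -> cube z r (f t).
  rewrite /= in_itv/= => /andP[t0 t1]; rewrite /cube/=.
  have -> : f t - z = (1 - t) *: (x - z) + t *: (w - z).
    by rewrite /f !scalerBr !scalerBl !scale1r; apply/rowP => i; rewrite !mxE; lra.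
  apply: le_trans (ler_normD _ _) _; rewrite !normrZ (ger0_norm t0) ger0_norm ?subr_ge0//.
  have h1 : (1 - t) * `|x - z| <= (1 - t) * r by rewrite ler_wpM2l// subr_ge0.
  have h2 : t * `|w - z| <= t * r by rewrite ler_wpM2l.
  by move: h1 h2; lra.
have key := @segment_connected R 0 1 (`[0, 1]%classic `&` f @^-1` Omega).
have E1 : `[0, 1]%classic `&` f @^-1` Omega = `[0, 1]%classic.
  apply: key.
  - by exists 0; split => /=; rewrite ?in_itv/= ?lexx ?ler01// /f scale0r addr0.
  - by exists (f @^-1` Omega) => //; exact: open_comp.
  - exists (f @^-1` closure Omega).
      by apply: closed_comp => //; exact: closed_closure.
    apply/seteqP; split => t [t1 /= t2]; split => //=; first exact: subset_closure.
    by apply: contrapT => nO; exact: (h _ (fz _ t1)).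
apply: nOw; have : `[0, 1]%classic (1 : R) by rewrite /= in_itv/= lexx ler01.
by rewrite -E1 => -[_ /=]; rewrite /f scale1r addrC subrK.
Qed.

(** The fluxes centred within [r] of [A] contribute o(r^(d + 4)). Stated by majorants on the whole
    space, so that a finite union of sets is handled by adding them, without measuring
    neighbourhoods of [A]. *)
Definition flux_negligible (A : set E) := forall eta, 0 < eta -> exists2 r1, 0 < r1 &
  forall r, 0 < r -> r <= r1 -> exists b : E -> \bar R,
  [/\ measurable_fun setT b, forall z, (0 <= b z)%E,
      (\int[mu]_z b z <= (eta * r ^+ (d + 4))%:E)%E &
      forall z y, A y -> `|z - y| <= r -> (`|local_flux r Omega G z|%:E <= b z)%E].

Lemma flux_negligible0 : flux_negligible set0.
Proof.
move=> eta eta0; exists 1 => // r r0 _; exists (cst 0%E); split => //.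
by rewrite integral0 lee_fin mulr_ge0 ?exprn_ge0// ltW.
Qed.

Lemma flux_negligibleU A A' : flux_negligible A -> flux_negligible A' ->
  flux_negligible (A `|` A').
Proof.
move=> h h' eta eta0; have eta20 : 0 < eta / 2 by rewrite divr_gt0.
have [r1 r10 h1] := h _ eta20; have [r2 r20 h2] := h' _ eta20.
exists (Num.min r1 r2); first by rewrite lt_min r10 r20.
move=> r r0; rewrite le_min => /andP[rr1 rr2].
have [b [mb b0 ib bb]] := h1 r r0 rr1; have [b' [mb' b0' ib' bb']] := h2 r r0 rr2.
exists (fun z => b z + b' z)%E; split.
- exact: emeasurable_funD.
- by move=> z; rewrite adde_ge0.
- rewrite ge0_integralD//.
  have -> : eta * r ^+ (d + 4) = eta / 2 * r ^+ (d + 4) + eta / 2 * r ^+ (d + 4) by lra.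
  by rewrite EFinD leeD.
- move=> z y [yA|yA] zy.
    by apply: le_trans (bb z y yA zy) _; rewrite leeDl.
  by apply: le_trans (bb' z y yA zy) _; rewrite leeDr.
Qed.

Hypothesis charts : forall x0, boundary Omega x0 ->
  exists e phi, lipschitz_graph_at Omega x0 e phi.

(** The boundary is compact: finitely many of the balls given by [chart_estimate] cover it, and
    negligibility passes to finite unions. *)
Lemma flux_negligible_boundary : flux_negligible (boundary Omega).
Proof.
have loc x : exists R2, 0 < R2 /\
    flux_negligible [set y | boundary Omega y /\ boundary Omega x /\ `|y - x| <= R2].
  have [bx|nbx] := pselect (boundary Omega x); last first.
    (* Default radius at points off the boundary, where the set is empty; it makes the radius a
       total function for [choice]. *)
    exists 1; split => // eta eta0.
    have [r1 r10 h1] := flux_negligible0 eta0; exists r1 => // r r0 rr1.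
    have [b [mb b0 ib _]] := h1 r r0 rr1; exists b; split => //.
    by move=> z y [_ [/nbx]].
  have [e [phi ch]] := charts bx.
  have [R2 R20 hR2] := chart_estimate ch.
  exists R2; split => // eta eta0; have [r1 r10 h1] := hR2 _ eta0.
  exists r1 => // r r0 rr1; have [b [mb b0 ib bb]] := h1 r r0 rr1.
  by exists b; split => // z y [yb [_ yx]] zy; exact: (bb z y yb yx zy).
have [R2 hR2] := choice loc.
have cb : compact (boundary Omega).
  rewrite /boundary setDE.
  by apply: compact_closedI => //; exact: open_closedC.
move: cb; rewrite compact_cover => /(_ E (boundary Omega) (fun x => ball x (R2 x))).
case=> [x _||s sb hs].
- exact: ball_open.
- by move=> x bx; exists x => //; apply: ballxx; exact: (hR2 x).1.
have main (l : seq E) : flux_negligible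
    [set y | boundary Omega y /\ exists2 x, x \in l & boundary Omega x /\ `|y - x| <= R2 x].
  elim: l => [|x l IH].
    by rewrite (_ : [set y | _] = set0); [exact: flux_negligible0|apply/seteqP; split => // y [_ []]].
  rewrite (_ : [set y | _] = [set y | boundary Omega y /\ boundary Omega x /\ `|y - x| <= R2 x]
     `|` [set y | boundary Omega y /\ exists2 x, x \in l & boundary Omega x /\ `|y - x| <= R2 x]).
    by apply: flux_negligibleU => //; exact: (hR2 x).2.
  apply/seteqP; split => y.
    move=> [yb [x']]; rewrite inE => /orP[/eqP -> [? ?]|x'l ?]; first by left.
    by right; split => //; exists x'.
  move=> [[yb ?]|[yb [x' x'l ?]]]; split => //; first by exists x => //; rewrite mem_head.
  by exists x' => //; rewrite inE x'l orbT.
rewrite (_ : boundary Omega = [set y | boundary Omega y /\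
   exists2 x, x \in finmap.enum_fset s & boundary Omega x /\ `|y - x| <= R2 x]); first exact: main.
apply/seteqP; split => [y yb|y []//]; split => //.
have [x xs yx] := hs y yb; exists x; first exact: xs.
split; first by have := sb x xs; rewrite inE.
by move: yx; rewrite -ball_normE/= distrC => /ltW.
Qed.

(** The fluxes vanish at centres farther than [r] from the boundary, and the others contribute
    o(r^(d + 4)), whereas the mass of the bump is at least [kap * r ^+ (d + 4)]. *)
Lemma neumann_divergence : (\int[mu]_(x in Omega) divG G x)%R = 0.
Proof.
pose I := (\int[mu]_(x in Omega) divG G x)%R.
(* The constant of [bump_mass_lb]. *)
pose kap : R := (4 * d.+1%:R ^+ d)^-1.
have kap0 : 0 < kap by rewrite invr_gt0 mulr_gt0// exprn_gt0.
have key eta : 0 < eta -> kap * `|I| <= eta.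
  move=> eta0; have [r1 r10 h1] := flux_negligible_boundary eta0.
  have [b [mb b0 ib bb]] := h1 r1 r10 (lexx _).
  have r1_0 := ltW r10.
  have mO : measurable Omega by exact: measurable_open_rV.
  have bb' z : (`|local_flux r1 Omega G z|%:E <= b z)%E.
    have [[y [yb zy]]|nb] := pselect (exists y, boundary Omega y /\ `|z - y| <= r1).
      exact: bb yb zy.
    have [cO|cO] : cube z r1 `<=` Omega \/ (forall x, cube z r1 x -> ~ Omega x).
    - by apply: cube_boundary => y yz yb; apply: nb; exists y; split => //; rewrite distrC.
    - by rewrite (local_flux_in r1_0 oO dG mG C0 GC DGC cO) normr0.
    - by rewrite (local_flux_out G r1_0 cO) normr0.
  have := le_trans (le_integral_local_flux r1_0 mO OB mG mDG GC DGC C0 mb bb') ib.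
  rewrite lee_fin -/I => h2.
  have h3 := bump_mass_lb (d := d) r1_0.
  have X0 : 0 < r1 ^+ (d + 4) by rewrite exprn_gt0.
  rewrite -(ler_pM2r X0); apply: le_trans h2.
  rewrite mulrAC ler_wpM2r//; apply: le_trans h3.
  rewrite /kap exprD expr_div_n invfM; move: (r1 ^+ d) (d.+1%:R ^+ d) => X Y.
  by move: (Y^-1) => Z; lra.
apply/eqP; rewrite -normr_le0.
have : kap * `|I| <= 0 by apply/ler_addgt0Pr => q q0; rewrite add0r key.
by rewrite pmulr_rle0.
Qed.
End neumann_divergence.

(** * Functions continuous up to the boundary of the space-time cylinder *)

Section space_time.
Context {R : realType} {d : nat}.
Local Notation E := 'rV[R]_d.
Local Notation mu := (lebesgue_rV d).
Implicit Types (f g : E -> R -> R).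

Variables (Omega : set E) (B : R).
Hypothesis oO : open Omega.
Hypothesis OB : Omega `<=` cube 0 B.

Let mO : measurable Omega. Proof. exact: measurable_open_rV. Qed.
Let muO : (mu Omega < +oo)%E. Proof. exact: sub_cube_lty OB. Qed.

Definition cylinder : set (E * R) := closure Omega `*` [set t : R | 0 <= t].

Definition cyl_continuous f := forall p, cylinder p ->
  f q.1 q.2 @[q --> within cylinder (nbhs p)] --> f p.1 p.2.

(** The closure of the part with positive times contains the face at time 0; functions continuous up
    to this closure thus acquire values there, where the evolution equation itself says nothing. *)
Lemma cylinder_closure : cylinder `<=` closure (Omega `*` [set t : R | 0 < t]).
Proof.
move=> [x t] [/= clx t0] U [[V W] /= [Vx Wt] VW].
have [y [Oy Vy]] := clx _ Vx.
have /nbhs_ballP[s /= s0 sW] := Wt.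
exists (y, t + s / 2); split; first by split => //=; rewrite ltr_wpDl// divr_gt0.
apply: VW; split => //=; apply: sW; rewrite -ball_normE/= opprD addrA subrr add0r normrN.
by rewrite gtr0_norm ?divr_gt0//; lra.
Qed.

Lemma cyl_continuousP f : cyl_continuous f <->
  {within cylinder, continuous (fun p : E * R => f p.1 p.2)}.
Proof. by rewrite subspace_continuousP. Qed.

Lemma within_cylinder (A : set (E * R)) (F : E * R -> R) : cylinder `<=` A ->
  {within A, continuous F} -> cyl_continuous (fun x t => F (x, t)).
Proof.
move=> sA cF; apply/cyl_continuousP.
have -> : (fun p : E * R => F (p.1, p.2)) = F by apply/funext => -[].
exact: continuous_subspaceW cF.
Qed.

Lemma up_to_closure_ext f : 
  continuous_up_to_closure (Omega `*` [set t : R | 0 <= t]) (fun p => f p.1 p.2) ->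
  exists2 g, cyl_continuous g & forall x t, Omega x -> 0 <= t -> f x t = g x t.
Proof.
move=> [F cF FE]; exists (fun x t => F (x, t)); last by move=> x t Ox t0; rewrite -FE.
apply: within_cylinder cF; apply: subset_trans cylinder_closure _; apply: closure_subset.
by move=> -[x t] [/= Ox t0]; split => //=; exact: ltW.
Qed.

Lemma up_to_closure_ext0 f : 
  continuous_up_to_closure (Omega `*` [set t : R | 0 < t]) (fun p => f p.1 p.2) ->
  exists2 g, cyl_continuous g & forall x t, Omega x -> 0 < t -> f x t = g x t.
Proof.
move=> [F cF FE]; exists (fun x t => F (x, t)); last by move=> x t Ox t0; rewrite -FE.
exact: within_cylinder cylinder_closure cF.
Qed.

Lemma cyl_continuous_cst (a : R) : cyl_continuous (fun _ _ => a).
Proof. by move=> p _; exact: cvg_cst. Qed.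

Lemma cyl_continuousD f g : cyl_continuous f -> cyl_continuous g ->
  cyl_continuous (fun x t => f x t + g x t).
Proof. by move=> cf cg p cp; apply: cvgD; [exact: cf|exact: cg]. Qed.

Lemma cyl_continuousB f g : cyl_continuous f -> cyl_continuous g ->
  cyl_continuous (fun x t => f x t - g x t).
Proof. by move=> cf cg p cp; apply: cvgB; [exact: cf|exact: cg]. Qed.

Lemma cyl_continuousM f g : cyl_continuous f -> cyl_continuous g ->
  cyl_continuous (fun x t => f x t * g x t).
Proof. by move=> cf cg p cp; apply: cvgM; [exact: cf|exact: cg]. Qed.

Lemma cyl_continuous_sum (F : 'I_d -> E -> R -> R) : (forall i, cyl_continuous (F i)) ->
  cyl_continuous (fun x t => \sum_i F i x t).
Proof. by move=> cF p cp; apply: cvg_sumr => i; exact: cF. Qed.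

Lemma cyl_continuous_comp (phi : R -> R) f : 
  (forall x t, closure Omega x -> 0 <= t -> {for f x t, continuous phi}) ->
  cyl_continuous f -> cyl_continuous (fun x t => phi (f x t)).
Proof.
move=> cphi cf p [p1 p2].
exact: (cvg_comp _ _ (cf p (conj p1 p2)) (cphi _ _ p1 p2)).
Qed.

(** Freezing the time of one factor brings mixed products such as [c x t' * rho x t] under the same
    continuity and integrability lemmas. *)
Lemma cyl_continuous_at f t0 : 0 <= t0 -> cyl_continuous f ->
  cyl_continuous (fun x _ => f x t0).
Proof.
move=> t00 cf [x t] [/= clx t_0] V Vf.
have [[U W] /= [Ux Wt] UW] := cf (x, t0) (conj clx t00) V Vf.
exists (U, setT) => //=; first by split => //; exact: filterT.
move=> [y s] [/= Uy _] [/= cly _]; apply: (UW (y, t0)) => //; split => //=.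
exact: nbhs_singleton.
Qed.

Lemma cyl_slice f t : 0 <= t -> cyl_continuous f ->
  {within closure Omega, continuous (f^~ t)}.
Proof.
move=> t_0 cf; apply/subspace_continuousP => x clx V Vf.
have [[U W] /= [Ux Wt] UW] := cf (x, t) (conj clx t_0) V Vf.
move: Ux; apply: filterS => y Uy cly.
apply: (UW (y, t)) => //; split => //=; exact: nbhs_singleton.
Qed.

Let compact_slab (T : R) : compact (closure Omega `*` `[0, T]%classic).
Proof. by apply: compact_setX; [exact: compact_closure_cube OB|exact: segment_compact]. Qed.

Let slab_sub (T : R) : closure Omega `*` `[0, T]%classic `<=` cylinder.
Proof. by move=> [x t] [/= cx]; rewrite in_itv/= => /andP[t0 _]. Qed.

Lemma cyl_unif f T e : cyl_continuous f -> 0 < e -> exists2 del, 0 < del &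
  forall x y t s, closure Omega x -> closure Omega y -> 0 <= t <= T -> 0 <= s <= T ->
    `|x - y| <= del -> `|t - s| <= del -> `|f x t - f y s| <= e.
Proof.
move=> /cyl_continuousP cf e0.
have [del d0 h] := compact_unif_continuous (@compact_slab T)
   (continuous_subspaceW (@slab_sub T) cf) e0.
exists del => // x y t s cx cy tT sT xy ts.
apply: (h (x, t) (y, s)); try by split => //=; rewrite in_itv.
by rewrite prod_normE/= ge_max xy ts.
Qed.

Lemma cyl_bounded f T : cyl_continuous f -> exists2 K, 0 <= K &
  forall x t, closure Omega x -> 0 <= t <= T -> `|f x t| <= K.
Proof.
move=> /cyl_continuousP cf.
have [K K0 h] := compact_cont_bounded (@compact_slab T)
   (continuous_subspaceW (@slab_sub T) cf).
exists K => // x t cx tT; apply: (h (x, t)); by split => //=; rewrite in_itv.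
Qed.

Lemma measurable_within_closure (u : E -> R) : {within closure Omega, continuous u} ->
  measurable_fun Omega u.
Proof.
move=> cu; apply: continuous_in_measurable_rV => // x; rewrite inE => Ox.
have := continuous_subspaceW (@subset_closure _ Omega) cu.
by rewrite continuous_open_subspace// => /(_ x); rewrite inE; apply.
Qed.

Lemma cyl_measurable f t : cyl_continuous f -> 0 <= t -> measurable_fun Omega (f^~ t).
Proof. by move=> cf t0; apply: measurable_within_closure; exact: cyl_slice. Qed.

Lemma cyl_integrable f t : cyl_continuous f -> 0 <= t ->
  mu.-integrable Omega (EFin \o f^~ t).
Proof.
move=> cf t0; have [K K0 h] := cyl_bounded t cf.
apply: (@bounded_integrable _ _ _ _ K) => //; first exact: cyl_measurable.
by move=> x Ox; apply: h; [exact: subset_closure|rewrite t0 lexx].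
Qed.

Lemma cyl_Rintegral_cvg f t e : cyl_continuous f -> 0 <= t -> 0 < e ->
  exists2 del, 0 < del & forall s, 0 <= s -> `|s - t| <= del ->
    `|(\int[mu]_(x in Omega) f x s)%R - (\int[mu]_(x in Omega) f x t)%R| <= e.
Proof.
move=> cf t0 e0.
have M0 : 0 < fine (mu Omega) + 1 by rewrite ltr_wpDl// fine_ge0.
have e1 : 0 < e / (fine (mu Omega) + 1) by rewrite divr_gt0.
have [del d0 h] := cyl_unif (t + 1) cf e1.
exists (Num.min del 1); first by rewrite lt_min d0 ltr01.
move=> s s0; rewrite le_min => /andP[sd s1].
rewrite -RintegralB//; try exact: cyl_integrable.
apply: le_trans (@le_norm_Rintegral _ _ _ _ (e / (fine (mu Omega) + 1)) _ _ _ _) _ => //.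
- by apply: cyl_measurable (cyl_continuousB cf (cyl_continuous_at t0 cf)) s0.
- move=> x Ox; have cx := subset_closure Ox.
  have st : s <= t + 1 by move: s1; rewrite ler_distl => /andP[].
  by apply: h => //; rewrite ?subrr ?normr0 ?s0 ?t0 ?lerDl//; exact: ltW.
- by rewrite mulrAC ler_pdivrMr// ler_wpM2l// ?lerDl// ltW.
Qed.
End space_time.

Section quotient.
Context {R : realType} {d : nat}.
Local Notation E := 'rV[R]_d.
Variables (Omega : set E) (B : R).
Hypothesis OB : Omega `<=` cube 0 B.
Implicit Types (f g u : E -> R -> R).

Lemma cyl_time u x : closure Omega x -> cyl_continuous Omega u ->
  {within [set t | 0 <= t], continuous (u x)}.
Proof.
move=> clx cu; apply/subspace_continuousP => t t0 V Vf.
have [[U W] /= [Ux Wt] UW] := cu (x, t) (conj clx t0) V Vf.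
move: Wt; apply: filterS => s Ws s0.
apply: (UW (x, s)) => //; split => //=; exact: nbhs_singleton.
Qed.

(** By the mean value theorem the quotient is a value of [g] at a time between [t] and [t + h], and
    [g] is uniformly continuous on bounded slabs. Derivability at interior times and continuity at
    the end points suffice, so [t = 0] is included. *)
Lemma cyl_difference_quotient u g (t e : R) : cyl_continuous Omega u -> cyl_continuous Omega g ->
  (forall x (s : R), Omega x -> 0 < s -> is_derive s (1 : R) (u x) (g x s)) -> 0 <= t -> 0 < e ->
  exists2 del, 0 < del & forall h, h != 0 -> `|h| <= del -> 0 <= t + h ->
    forall x, Omega x -> `|h^-1 * (u x (t + h) - u x t) - g x t| <= e.
Proof.
move=> cu cg du t0 e0.
have [del d0 hd] := cyl_unif OB (t + 1) cg e0.
exists (Num.min del 1); first by rewrite lt_min d0 ltr01.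
move=> h h0; rewrite le_min => /andP[hdel h1] th x Ox.
have clx := subset_closure Ox.
have mvt a b : 0 <= a -> a < b -> exists2 c, a < c < b & u x b - u x a = g x c * (b - a).
  move=> a0 ab.
  have dab y : y \in `]a, b[ -> is_derive y 1 (u x) (g x y).
    by rewrite in_itv/= => /andP[ay _]; apply: du => //; exact: le_lt_trans ay.
  have cab : {within `[a, b], continuous (u x)}.
    apply: continuous_subspaceW (cyl_time clx cu) => y /=.
    by rewrite in_itv/= => /andP[ay _]; exact: le_trans ay.
  by have [c cab' ->] := MVT ab dab cab; exists c => //; move: cab'; rewrite in_itv.
have [c [c0 ct] ->] : exists2 c, 0 <= c <= t + 1 /\ `|c - t| <= del & h^-1 * (u x (t + h) - u x t) = g x c.
  have [hn|hp] := ltP h 0.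
  - have [c /andP[c1 c2] uc] := mvt (t + h) t th ltac:(lra).
    exists c; first by rewrite ler_distl; move: hdel; rewrite ler_norml => /andP[? _]; split; apply/andP; split; lra.
    have -> : u x (t + h) - u x t = g x c * h by move: uc; lra.
    by rewrite mulrC mulfK.
  - have hp' : 0 < h by rewrite lt_neqAle eq_sym h0.
    have [c /andP[c1 c2] uc] := mvt t (t + h) t0 ltac:(lra).
    move: hdel h1; rewrite !ger0_norm// => hdel h1.
    exists c; first by rewrite ler_distl; split; apply/andP; split; lra.
    by rewrite uc addrAC subrr add0r mulrC mulfK.
apply: hd => //; first by apply/andP; split; lra.
by rewrite subrr normr0 ltW.
Qed.
End quotient.

(** * Derivative of the energy *)

Section energy_derivative.
Context {R : realType} {d : nat}.
Local Notation E := 'rV[R]_d.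
Local Notation mu := (lebesgue_rV d).
Variables (Omega : set E) (B : R).
Hypothesis oO : open Omega.
Hypothesis OB : Omega `<=` cube 0 B.
Variables (rho c gt : E -> R -> R).
Hypothesis crho : cyl_continuous Omega rho.
Hypothesis cc : cyl_continuous Omega c.
Hypothesis cgt : cyl_continuous Omega gt.
Hypothesis rho_gt0 : forall x t, closure Omega x -> 0 <= t -> 0 < rho x t.
Hypothesis drho : forall x (t : R), Omega x -> 0 < t -> is_derive t (1 : R) (rho x) (gt x t).
Hypothesis sym : forall t t', 0 <= t -> 0 <= t' ->
  (\int[mu]_(x in Omega) (c x t' * rho x t))%R = (\int[mu]_(x in Omega) (c x t * rho x t'))%R.

Lemma cyl_ln : cyl_continuous Omega (fun x t => ln (rho x t)).
Proof.
by apply: cyl_continuous_comp => // x t cx t0; apply: continuous_ln; exact: rho_gt0.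
Qed.

Let ent x t := rho x t * (ln (rho x t) - 1) + 1.

Let cent : cyl_continuous Omega ent.
Proof.
apply: cyl_continuousD; last exact: cyl_continuous_cst.
apply: cyl_continuousM => //; apply: cyl_continuousB; last exact: cyl_continuous_cst.
exact: cyl_ln.
Qed.

Let dent x (t : R) : Omega x -> 0 < t ->
  is_derive t (1 : R) (ent x) (ln (rho x t) * gt x t).
Proof.
move=> Ox t0; have r0 : 0 < rho x t by apply: rho_gt0; [exact: subset_closure|exact: ltW].
have dr := drho Ox t0.
have dl : is_derive t (1 : R) (fun s => ln (rho x s)) ((rho x t)^-1 * gt x t).
  have := is_derive1_ln r0 => dl.
  exact: (@is_derive1_comp _ (@ln R) (rho x) t _ _ dl dr).
rewrite /ent; apply: is_derive_eq.
rewrite /GRing.scale/= subr0 addr0.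
have : rho x t * (rho x t)^-1 = 1 by rewrite mulfV// gt_eqF.
by rewrite mulrA => ->; rewrite mul1r; lra.
Qed.

Let mO : measurable Omega. Proof. exact: measurable_open_rV. Qed.

Let muO : (mu Omega < +oo)%E. Proof. exact: sub_cube_lty OB. Qed.

Lemma energyE s : 0 <= s -> energy Omega (rho^~ s) (c^~ s) =
  (\int[mu]_(x in Omega) ent x s)%R - 2^-1 * (\int[mu]_(x in Omega) (c x s * rho x s))%R.
Proof.
move=> s0; congr (_ - _); apply: eq_Rintegral => x; rewrite inE => Ox.
by rewrite /entropy gt_eqF//; apply: rho_gt0 => //; exact: subset_closure.
Qed.

(** The two mixed terms inserted into [F] have equal integrals by [sym] and cancel. With them the
    interaction part becomes the sum of the potentials times the increment of [rho] alone. *)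
Lemma energy_difference s t k : 0 <= s -> 0 <= t ->
  let F x := k * (ent x s - ent x t
    - 2^-1 * (c x s * rho x s - c x s * rho x t + (c x t * rho x s - c x t * rho x t))) in
  mu.-integrable Omega (EFin \o F) /\
  k * (energy Omega (rho^~ s) (c^~ s) - energy Omega (rho^~ t) (c^~ t)) =
  (\int[mu]_(x in Omega) F x)%R.
Proof.
move=> s0 t0 F.
have i1 := cyl_integrable oO OB cent s0.
have i2 := cyl_integrable oO OB cent t0.
have i3 := cyl_integrable oO OB (cyl_continuousM cc crho) s0.
have i4 := cyl_integrable oO OB (cyl_continuousM (cyl_continuous_at s0 cc) crho) t0.
have i5 := cyl_integrable oO OB (cyl_continuousM (cyl_continuous_at t0 cc) crho) s0.
have i6 := cyl_integrable oO OB (cyl_continuousM cc crho) t0.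
have iA := integrable_funB mO i1 i2.
have iB := integrable_funB mO i3 i4.
have iC := integrable_funB mO i5 i6.
have iD := integrable_funD mO iB iC.
have iE := integrable_funZ mO 2^-1 iD.
have iG := integrable_funB mO iA iE.
have iF := integrable_funZ mO k iG.
split; first exact: iF.
rewrite !energyE// /F (RintegralZl k mO iG) (RintegralB mO iA iE) (RintegralB mO i1 i2).
rewrite (RintegralZl 2^-1 mO iD) (RintegralD mO iB iC) (RintegralB mO i3 i4) (RintegralB mO i5 i6).
by rewrite (sym t0 s0); congr (_ * _); lra.
Qed.

Lemma energy_is_derive t : 0 <= t ->
  h^-1 * (energy Omega (rho^~ (t + h)) (c^~ (t + h)) - energy Omega (rho^~ t) (c^~ t))
    @[h --> within [set h | 0 <= t + h] (0 : R)^'] -->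
  (\int[mu]_(x in Omega) ((ln (rho x t) - c x t) * gt x t))%R.
Proof.
move=> t0.
apply/cvgrPdist_le => e e0.
have M0 : 0 < fine (mu Omega) + 1 by rewrite ltr_wpDl// fine_ge0.
have [K1 K10 hK1] := cyl_bounded OB (t + 1) cc.
have [K2 K20 hK2] := cyl_bounded OB (t + 1) cgt.
(* The four error terms below are at most [eta], [eta], [eta * K2] and [K1 * eta], and [1 + 2 * K]
   dominates the sum of these coefficients. *)
pose K := K1 + K2 + 1.
pose eta := Num.min 1 (e / (fine (mu Omega) + 1) / (1 + 2 * K)).
have K0 : 0 < 1 + 2 * K by rewrite /K; lra.
have eta0 : 0 < eta by rewrite lt_min ltr01 !divr_gt0.
have eta1 : eta <= 1 by rewrite ge_min lexx.
have etaE : eta * (1 + 2 * K) <= e / (fine (mu Omega) + 1).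
  by rewrite -ler_pdivlMr// ge_min lexx orbT.
have clng : cyl_continuous Omega (fun x t => ln (rho x t) * gt x t).
  by apply: cyl_continuousM => //; exact: cyl_ln.
have [d1 d10 h1] := cyl_difference_quotient OB cent clng dent t0 eta0.
have [d2 d20 h2] := cyl_difference_quotient OB crho cgt drho t0 eta0.
have [d3 d30 h3] := cyl_unif OB (t + 1) cc eta0.
apply/nbhs_ballP; exists (Num.min (Num.min d1 d2) (Num.min d3 1)) => /=.
  by rewrite !lt_min d10 d20 d30 ltr01.
move=> h; rewrite -ball_normE/= sub0r normrN !lt_min => /andP[/andP[hd1 hd2] /andP[hd3 hd4]] h0 th.
have [iF ->] := energy_difference h^-1 th t0.
have i7 := cyl_integrable oO OB (cyl_continuousM (cyl_continuousB cyl_ln cc) cgt) t0.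
rewrite -(RintegralB mO i7 iF).
apply: le_trans (@le_norm_Rintegral _ _ _ _ (e / (fine (mu Omega) + 1)) _ _ _ _) _ => //.
- by have /measurable_int/measurable_EFinP := integrable_funB mO i7 iF.
- move=> x Ox; have cx := subset_closure Ox.
  have q1 := h1 h h0 (ltW hd1) th x Ox; have q2 := h2 h h0 (ltW hd2) th x Ox.
  have tt : 0 <= t <= t + 1 by rewrite t0 lerDl ler01.
  have tht : 0 <= t + h <= t + 1.
    by rewrite th lerD2l; apply: le_trans (ltW hd4); exact: ler_norm.
  have q3 : `|c x (t + h) - c x t| <= eta.
    by apply: h3 => //; rewrite ?subrr ?normr0 ?(ltW d30)// addrAC subrr add0r ltW.
  have q4 := hK1 x t cx tt; have q5 := hK2 x t cx tt.
  (* In this form the increment of [c] only multiplies bounded quantities and is never divided by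
     [h]: its uniform continuity is enough. *)
  have -> : (ln (rho x t) - c x t) * gt x t - h^-1 *
      (ent x (t + h) - ent x t - 2^-1 * (c x (t + h) * rho x (t + h) - c x (t + h) * rho x t
        + (c x t * rho x (t + h) - c x t * rho x t))) =
    - (h^-1 * (ent x (t + h) - ent x t) - ln (rho x t) * gt x t)
    + 2^-1 * (c x (t + h) - c x t) * (h^-1 * (rho x (t + h) - rho x t) - gt x t)
    + 2^-1 * (c x (t + h) - c x t) * gt x t
    + c x t * (h^-1 * (rho x (t + h) - rho x t) - gt x t).
    by lra.
  apply: le_trans _ etaE.
  move: q1 q2; move: (_ - ln (rho x t) * gt x t) (_ - gt x t) => a b q1 q2.
  have n1 : `|2^-1 * (c x (t + h) - c x t) * b| <= eta * 1.
    rewrite normrM ler_pM//; last exact: le_trans eta1.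
    rewrite normrM ger0_norm//; apply: le_trans q3; apply: ler_piMl => //.
    by rewrite invf_le1// ler1n.
  have n2 : `|2^-1 * (c x (t + h) - c x t) * gt x t| <= eta * K2.
    rewrite normrM ler_pM//.
    rewrite normrM ger0_norm//; apply: le_trans q3; apply: ler_piMl => //.
    by rewrite invf_le1// ler1n.
  have n3 : `|c x t * b| <= K1 * eta by rewrite normrM ler_pM.
  apply: le_trans (ler_normD _ _) _; apply: (@le_trans _ _ (eta + eta * 1 + eta * K2 + K1 * eta)).
    apply: lerD => //; apply: le_trans (ler_normD _ _) _; apply: lerD => //.
    by apply: le_trans (ler_normD _ _) _; rewrite normrN; apply: lerD.
  have : 0 <= eta * (K1 + K2) by rewrite mulr_ge0 ?addr_ge0// ltW.
  by rewrite /K; move: eta0; lra.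
- by rewrite mulrAC ler_pdivrMr// ler_wpM2l// ?lerDl// ltW.
Qed.
End energy_derivative.

(** * Symmetry of the fractional Neumann Laplacian *)

Section fractional_symmetry.
Context {R : realType} {d : nat}.
Local Notation E := 'rV[R]_d.
Local Notation mu := (lebesgue_rV d).
Variable Omega : set E.
Hypothesis mO : measurable Omega.
Implicit Types (u v w f : E -> R).

Lemma L2_mul_integrable u v : in_Lp Omega 2%:E u -> in_Lp Omega 2%:E v ->
  mu.-integrable Omega (EFin \o (fun x => u x * v x)).
Proof.
move=> u2 v2; have /Lfun1_integrable h := Lfun2_mul_Lfun1 u2 v2.
have E0 : EFin \o (u \_ Omega \* v \_ Omega) = (EFin \o (fun x => u x * v x)) \_ Omega.
  by apply/funext => x; rewrite /= !patchE; case: ifP => // _; rewrite mul0r.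
move: h; rewrite E0 => /(integrable_restrict mu mO measurableT).
by rewrite setTI.
Qed.

Lemma L2_linear a u v : in_Lp Omega 2%:E u -> in_Lp Omega 2%:E v ->
  in_Lp Omega 2%:E (fun x => a * u x + v x).
Proof.
move=> u2 v2; rewrite /in_Lp.
have p1 : (1 <= 2%:E :> \bar R)%E by rewrite lee_fin ler1n.
have [_ h] := Lfun_submod_closed mu p1.
suff -> : (fun x : E => a * u x + v x) \_ Omega = a *: (u \_ Omega) + v \_ Omega by exact: h.
apply/funext => x; rewrite -[RHS]/(a * (u \_ Omega) x + (v \_ Omega) x) !patchE.
by case: ifP => // _; rewrite -[point]/(0 : R) mulr0 addr0.
Qed.

Lemma L2_sub_sum f (psi : nat -> E -> R) (a : nat -> R) n : in_Lp Omega 2%:E f ->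
  (forall k, in_Lp Omega 2%:E (psi k)) ->
  in_Lp Omega 2%:E (fun x => f x - \sum_(1 <= k < n) a k * psi k x).
Proof.
move=> f2 psi2; elim: n => [|n IH].
  by under eq_fun do rewrite big_geq// subr0.
have [n0|n1] := leqP n 0.
  by under eq_fun do rewrite big_geq// subr0.
have -> : (fun x => f x - \sum_(1 <= k < n.+1) a k * psi k x) =
    (fun x => - a n * psi n x + (f x - \sum_(1 <= k < n) a k * psi k x)).
  by apply/funext => x; rewrite big_nat_recr//=; lra.
exact: L2_linear.
Qed.

(** Young's inequality with weight [del] in place of Cauchy-Schwarz: the product is at most half of
    g^2 / del + del * w^2, integrated termwise. *)
Lemma inner_cvg0 (g : nat -> E -> R) w : (forall n, in_Lp Omega 2%:E (g n)) ->
  in_Lp Omega 2%:E w ->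
  (\int[mu]_(x in Omega) g n x ^+ 2)%R @[n --> \oo] --> (0 : R) ->
  (\int[mu]_(x in Omega) (g n x * w x))%R @[n --> \oo] --> (0 : R).
Proof.
move=> g2 w2 gcv; apply/cvgr0Pnorm_le => e e0.
pose W := (\int[mu]_(x in Omega) (w x * w x))%R.
have W0 : 0 <= W by apply: Rintegral_ge0 => x _; rewrite -expr2 sqr_ge0.
(* Makes the term with [w] at most half of [e]; the threshold [e * del] for the squares of [g n]
   does the same for the other term. *)
pose del := e / (W + 1).
have del0 : 0 < del by rewrite divr_gt0// ltr_wpDl.
have delW : del * W <= e by rewrite mulrAC ler_pdivrMr ?ltr_wpDl// ler_wpM2l ?lerDl// ltW.
have ed : 0 < e * del by rewrite mulr_gt0.
have /cvgr0Pnorm_le/(_ _ ed) := gcv; apply: filterS => n.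
have i1 := L2_mul_integrable (g2 n) w2.
have i2 := L2_mul_integrable (g2 n) (g2 n).
have i3 := L2_mul_integrable w2 w2.
have -> : (\int[mu]_(x in Omega) g n x ^+ 2)%R = (\int[mu]_(x in Omega) (g n x * g n x))%R.
  by apply: eq_Rintegral => x _; rewrite expr2.
move=> /(le_trans (ler_norm _)) h.
have i4 := integrable_funZ mO (2^-1 * del^-1) i2.
have i5 := integrable_funZ mO (2^-1 * del) i3.
have i6 := integrable_funD mO i4 i5.
apply: le_trans (le_normr_Rintegral mO i1) _.
apply: le_trans (le_Rintegral mO _ i6 _) _.
- exact: integrable_norm.
- move=> x _ /=.
  have : 0 <= del^-1 * (`|g n x| - del * `|w x|) ^+ 2 by rewrite mulr_ge0 ?sqr_ge0// invr_ge0 ltW.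
  have q1 : g n x * g n x = `|g n x| ^+ 2 by rewrite -expr2 real_normK// num_real.
  have q2 : w x * w x = `|w x| ^+ 2 by rewrite -expr2 real_normK// num_real.
  rewrite q1 q2 normrM; have : del^-1 * del = 1 by rewrite mulVf// gt_eqF.
  move: (del^-1) (`|g n x|) (`|w x|) => di a b h1 h2.
  have : di * del * (a * b) = a * b by rewrite h1 mul1r.
  have : di * del * (del * b ^+ 2) = del * b ^+ 2 by rewrite h1 mul1r.
  by move: h2; lra.
- rewrite (RintegralD mO i4 i5) (RintegralZl _ mO i2) (RintegralZl _ mO i3) -/W.
  have : 2^-1 * del^-1 * (\int[mu]_(x in Omega) (g n x * g n x))%R <= 2^-1 * e.
    rewrite -mulrA ler_pM2l ?invr_gt0// mulrC ler_pdivrMr//.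
  by move: delW; lra.
Qed.

Variables (lambda : nat -> R) (psi : nat -> E -> R) (s : R).
Hypothesis psi2 : forall k, in_Lp Omega 2%:E (psi k).

(** The L^2 convergence of the series is paired with [w] by [inner_cvg0]. The partial sums obtained
    are symmetric in the coefficients of [u] and [w]. *)
Lemma frac_inner_cvg u f w : frac_neumann_laplacian Omega lambda psi s u f ->
  in_Lp Omega 2%:E w ->
  \sum_(1 <= k < n) lambda k `^ s * inner Omega u (psi k) * inner Omega w (psi k)
    @[n --> \oo] --> inner Omega f w.
Proof.
move=> [u2 _ _ f2 fs] w2.
have g2 n := L2_sub_sum (fun k => lambda k `^ s * inner Omega u (psi k)) n f2 psi2.
have h := inner_cvg0 g2 w2 fs.
have -> : (fun n => \sum_(1 <= k < n) lambda k `^ s * inner Omega u (psi k) * inner Omega w (psi k)) =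
  (fun n => inner Omega f w - (\int[mu]_(x in Omega) ((f x - \sum_(1 <= k < n) lambda k `^ s * inner Omega u (psi k) * psi k x) * w x))%R).
  apply/funext => n; rewrite /inner.
  have i1 := L2_mul_integrable f2 w2.
  have i2 k := L2_mul_integrable w2 (psi2 k).
  have i3 k := integrable_funZ mO (lambda k `^ s * inner Omega u (psi k)) (i2 k).
  have i4 := integrable_fun_sum mO (index_iota 1 n) (P := predT) (fun k _ => i3 k).
  have -> : (\int[mu]_(x in Omega) ((f x - \sum_(1 <= k < n) lambda k `^ s * inner Omega u (psi k) * psi k x) * w x))%R
    = (\int[mu]_(x in Omega) (f x * w x - \sum_(1 <= k < n) lambda k `^ s * inner Omega u (psi k) * (w x * psi k x)))%R.
    apply: eq_Rintegral => x _; rewrite mulrBl; congr (_ - _); rewrite mulr_suml.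
    by apply: eq_bigr => k _; rewrite -!mulrA [w x * _]mulrC.
  rewrite (RintegralB mO i1 i4) opprB addrC subrK Rintegral_sum//.
  by apply: eq_bigr => k _; rewrite (RintegralZl _ mO (i2 k)).
by rewrite -[X in _ --> X]subr0; apply: cvgB => //; exact: cvg_cst.
Qed.

(** Both pairings are limits of the same partial sums. *)
Lemma frac_inner_sym u f w g : frac_neumann_laplacian Omega lambda psi s u f ->
  frac_neumann_laplacian Omega lambda psi s w g -> inner Omega f w = inner Omega g u.
Proof.
move=> uf wg.
rewrite -(cvg_lim (@Rhausdorff R) (frac_inner_cvg uf (frac_L2 wg))).
rewrite -(cvg_lim (@Rhausdorff R) (frac_inner_cvg wg (frac_L2 uf))).
suff -> : (fun n => \sum_(1 <= k < n) lambda k `^ s * inner Omega u (psi k) * inner Omega w (psi k)) =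
  (fun n => \sum_(1 <= k < n) lambda k `^ s * inner Omega w (psi k) * inner Omega u (psi k)) by [].
by apply/funext => n; apply: eq_bigr => k _; rewrite mulrAC.
Qed.
End fractional_symmetry.

Lemma is_derive_ln_comp (R : realType) (a : R -> R) (t da : R) : is_derive t (1 : R) a da -> 0 < a t ->
  is_derive t (1 : R) (fun s => ln (a s)) (da / a t).
Proof.
move=> ha a0; have dl := is_derive1_ln a0; rewrite mulrC.
exact: (@is_derive1_comp _ (@ln R) a t _ _ dl ha).
Qed.

(** One component of the field to which the divergence theorem is applied, restricted to a
    coordinate line: [a] and [b] stand for [u] and [w], [p] and [q] for their partial
    derivatives. *)
Lemma is_derive_flux (R : realType) (a b p q : R -> R) (t da db dp dq : R) :
  is_derive t (1 : R) a da -> is_derive t (1 : R) b db -> is_derive t (1 : R) p dp ->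
  is_derive t (1 : R) q dq -> 0 < a t ->
  is_derive t (1 : R) (fun s => (ln (a s) - b s) * (p s - a s * q s))
    ((da / a t - db) * (p t - a t * q t) + (ln (a t) - b t) * (dp - (da * q t + a t * dq))).
Proof.
move=> ha hb hp hq a0; have hl := is_derive_ln_comp ha a0.
apply: is_derive_eq; rewrite /GRing.scale/=; lra.
Qed.

(** * Dissipation *)

Section dissipation.
Context {R : realType} {d : nat}.
Local Notation E := 'rV[R]_d.
Local Notation mu := (lebesgue_rV d).
Variables (Omega : set E) (B : R).
Hypothesis oO : open Omega.
Hypothesis OB : Omega `<=` cube 0 B.
Hypothesis charts : forall x0, boundary Omega x0 ->
  exists e phi, lipschitz_graph_at Omega x0 e phi.

Let mO : measurable Omega. Proof. exact: measurable_open_rV. Qed.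
Let muO : (mu Omega < +oo)%E. Proof. exact: sub_cube_lty OB. Qed.

(** Continuity relative to the closure in filter form, to which the limit rules apply directly. *)
Let ctn (f : E -> R) := forall x, closure Omega x ->
  f y @[y --> within (closure Omega) (nbhs x)] --> f x.

Let ctnP f : ctn f -> {within closure Omega, continuous f}.
Proof. by move=> h; apply/subspace_continuousP. Qed.

Let ctn_bounded f : ctn f -> exists2 C, 0 <= C & forall x, closure Omega x -> `|f x| <= C.
Proof. by move=> /ctnP cf; exact: compact_cont_bounded (compact_closure_cube OB) cf. Qed.

Let ctn_integrable f : ctn f -> mu.-integrable Omega (EFin \o f).
Proof.
move=> cf; have [C C0 h] := ctn_bounded cf.
apply: (@bounded_integrable _ _ _ _ C) => //; first exact: measurable_within_closure (ctnP cf).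
by move=> x Ox; apply: h; exact: subset_closure.
Qed.

(** The Neumann condition is a limit from inside [Omega], while the extensions [ru] have a limit
    from the closure. The two expressions agree on [Omega], which accumulates at [x0], so the limits
    coincide. *)
Lemma neumann_trace u (ru : 'I_d -> E -> R) : neumann_condition Omega u ->
  (forall i, ctn (ru i)) -> (forall i x, Omega x -> pderiv i u x = ru i x) ->
  forall x0 n, outer_normal Omega x0 n -> \sum_i ru i x0 * n 0 i = 0.
Proof.
move=> nu cru ruE x0 n on; have h1 := nu _ _ on.
have clx0 : closure Omega x0 by case: on => -[].
have h2 : \sum_i ru i y * n 0 i @[y --> within (closure Omega) (nbhs x0)] --> \sum_i ru i x0 * n 0 i.
  by apply: cvg_sumr => i; apply: cvgM; [exact: cru|exact: cvg_cst].
apply/eqP; rewrite -normr_le0; apply/ler_addgt0Pr => e e0; rewrite add0r.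
have e20 : 0 < e / 2 by rewrite divr_gt0.
have g1 : nbhs x0 [set y | Omega y -> ball (0 : R) (e / 2) (dotv (grad u y) n)].
  exact: h1 _ (nbhsx_ballx (0 : R) (e / 2) e20).
have g2 : nbhs x0 [set y | closure Omega y ->
    ball (\sum_i ru i x0 * n 0 i) (e / 2) (\sum_i ru i y * n 0 i)].
  exact: h2 _ (nbhsx_ballx _ (e / 2) e20).
have [y [Oy [y1 y2]]] := clx0 _ (filterI g1 g2).
have yE : dotv (grad u y) n = \sum_i ru i y * n 0 i.
  by apply: eq_bigr => i _; rewrite mxE ruE.
have := y1 Oy; have := y2 (subset_closure Oy).
rewrite -!ball_normE/= yE sub0r normrN => a b.
rewrite -[X in `|X|](subrK (\sum_i ru i y * n 0 i)); apply: le_trans (ler_normD _ _) _.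
by move: a b; lra.
Qed.

Variables (u w : E -> R) (ru rw suu sww : 'I_d -> E -> R).
Hypothesis cu : ctn u.
Hypothesis cw : ctn w.
Hypothesis u_gt0 : forall x, closure Omega x -> 0 < u x.
Hypothesis cru : forall i, ctn (ru i).
Hypothesis crw : forall i, ctn (rw i).
Hypothesis csu : forall i, ctn (suu i).
Hypothesis csw : forall i, ctn (sww i).
Hypothesis du : forall i x, Omega x -> derivable u x (evec i).
Hypothesis dw : forall i x, Omega x -> derivable w x (evec i).
Hypothesis ruE : forall i x, Omega x -> pderiv i u x = ru i x.
Hypothesis rwE : forall i x, Omega x -> pderiv i w x = rw i x.
Hypothesis ddu : forall i x, Omega x -> derivable (pderiv i u) x (evec i).
Hypothesis ddw : forall i x, Omega x -> derivable (pderiv i w) x (evec i).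
Hypothesis suE : forall i x, Omega x -> pderiv i (pderiv i u) x = suu i x.
Hypothesis swE : forall i x, Omega x -> pderiv i (pderiv i w) x = sww i x.
Hypothesis nu : neumann_condition Omega u.
Hypothesis nw : neumann_condition Omega w.

(** With V = ln u - w, the second factor is u times the partial derivative of V, so [G] is V u grad
    V. Its divergence is the dissipation density plus V div(u grad V), and the latter divergence is
    the right-hand side of the evolution equation. *)
Let G i x := (ln (u x) - w x) * (pderiv i u x - u x * pderiv i w x).
Let Gh i x := (ln (u x) - w x) * (ru i x - u x * rw i x).
(** The partial derivative of [G i], written with the extensions so that it is continuous, hence
    bounded, on the closure. *)
Let H i x := (ru i x / u x - rw i x) * (ru i x - u x * rw i x) +
  (ln (u x) - w x) * (suu i x - (ru i x * rw i x + u x * sww i x)).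

Let line (f : E -> R) i x : derivable f x (evec i) ->
  is_derive (0 : R) (1 : R) (fun s : R => f (x + s *: evec i)) (pderiv i f x).
Proof.
move=> df; have := @is_derive_line R d f x (evec i) 0.
by rewrite scale0r addr0; apply.
Qed.

Let dG i x : Omega x -> is_derive x (evec i) (G i) (H i x).
Proof.
move=> Ox; apply: is_derive_along.
have u0 : 0 < u (x + 0 *: evec i) by rewrite scale0r addr0; apply: u_gt0; exact: subset_closure.
have := is_derive_flux (line (@du i x Ox)) (line (@dw i x Ox)) (line (@ddu i x Ox)) (line (@ddw i x Ox)) u0.
by rewrite /G /H scale0r addr0 !ruE ?rwE ?suE ?swE.
Qed.

Let dV i x : Omega x -> is_derive x (evec i) (fun y => ln (u y) - w y) (ru i x / u x - rw i x).
Proof.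
move=> Ox; apply: is_derive_along.
have u0 : 0 < u (x + 0 *: evec i) by rewrite scale0r addr0; apply: u_gt0; exact: subset_closure.
have h1 := is_derive_ln_comp (line (@du i x Ox)) u0.
have h2 := line (@dw i x Ox).
apply: is_derive_eq.
by rewrite scale0r addr0 ruE ?rwE.
Qed.

Let cln : ctn (fun x => ln (u x)).
Proof.
move=> x clx; apply: (cvg_comp _ _ (cu clx)); apply: continuous_ln; exact: u_gt0.
Qed.

Let cV : ctn (fun x => ln (u x) - w x).
Proof. by move=> x clx; apply: cvgB; [exact: cln|exact: cw]. Qed.

Let cF i : ctn (fun x => ru i x - u x * rw i x).
Proof.
by move=> x clx; apply: cvgB; [exact: cru|apply: cvgM; [exact: cu|exact: crw]].
Qed.

Let cGh i : ctn (Gh i).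
Proof. by move=> x clx; apply: cvgM; [exact: cV|exact: cF]. Qed.

Let cgradV i : ctn (fun x => ru i x / u x - rw i x).
Proof.
move=> x clx; apply: cvgB; last exact: crw.
by apply: cvgM; [exact: cru|apply: cvgV; [rewrite gt_eqF// u_gt0|exact: cu]].
Qed.

Let cS i : ctn (fun x => suu i x - (ru i x * rw i x + u x * sww i x)).
Proof.
move=> x clx; apply: cvgB; first exact: csu.
by apply: cvgD; apply: cvgM; [exact: cru|exact: crw|exact: cu|exact: csw].
Qed.

Let cH i : ctn (H i).
Proof.
by move=> x clx; apply: cvgD; apply: cvgM; [exact: cgradV|exact: cF|exact: cV|exact: cS].
Qed.

Let int_divG : (\int[mu]_(x in Omega) divG G x)%R = 0.
Proof.
have b1 i : exists C, 0 <= C /\ forall x, closure Omega x -> `|Gh i x| <= C.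
  by have [C C0 h] := ctn_bounded (@cGh i); exists C.
have b2 i : exists C, 0 <= C /\ forall x, closure Omega x -> `|H i x| <= C.
  by have [C C0 h] := ctn_bounded (@cH i); exists C.
have [C1 hC1] := choice b1; have [C2 hC2] := choice b2.
pose C := \sum_i (C1 i + C2 i).
have CE i : C1 i + C2 i <= C.
  rewrite /C (bigD1 i)//= lerDl sumr_ge0// => j _.
  by rewrite addr_ge0//; [have [] := hC1 j|have [] := hC2 j].
have C1C i : C1 i <= C by apply: le_trans (CE i); rewrite lerDl; have [] := hC2 i.
have C2C i : C2 i <= C by apply: le_trans (CE i); rewrite lerDr; have [] := hC1 i.
have C0 : 0 <= C.
  by rewrite sumr_ge0// => j _; rewrite addr_ge0//; [have [] := hC1 j|have [] := hC2 j].
have GhE i x : Omega x -> G i x = Gh i x by move=> Ox; rewrite /G /Gh ruE// rwE.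
have HE i x : Omega x -> pderiv i (G i) x = H i x by move=> Ox; exact: (@derive_val _ _ _ _ _ _ _ (@dG i x Ox)).
have mGh i : measurable_fun Omega (G i).
  apply: (eq_measurable_fun (Gh i)).
    by move=> x; rewrite inE => Ox; rewrite GhE.
  exact: measurable_within_closure (ctnP (@cGh i)).
have mH i : measurable_fun Omega (pderiv i (G i)).
  apply: (eq_measurable_fun (H i)).
    by move=> x; rewrite inE => Ox; rewrite HE.
  exact: measurable_within_closure (ctnP (@cH i)).
have dGi i x : Omega x -> derivable (G i) x (evec i) by move=> Ox; have [] := @dG i x Ox.
have GhC i x : closure Omega x -> `|Gh i x| <= C.
  by move=> clx; apply: le_trans (C1C i); exact: (hC1 i).2.
have GC i x : Omega x -> `|G i x| <= C.
  by move=> Ox; rewrite GhE//; apply: GhC; exact: subset_closure.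
have DGC i x : Omega x -> `|pderiv i (G i) x| <= C.
  move=> Ox; rewrite HE//; apply: le_trans (C2C i).
  by apply: (hC2 i).2; exact: subset_closure.
have Gn x0 n : outer_normal Omega x0 n -> \sum_i Gh i x0 * n 0 i = 0.
  move=> on; have h1 := neumann_trace nu cru ruE on.
  have h2 := neumann_trace nw crw rwE on.
  (* The normal component of the field splits into the normal derivatives of [u] and of [w], which
     both vanish. *)
  have -> : \sum_i Gh i x0 * n 0 i = (ln (u x0) - w x0) *
     (\sum_i ru i x0 * n 0 i - u x0 * \sum_i rw i x0 * n 0 i).
    rewrite [in RHS]mulr_sumr -sumrB mulr_sumr; apply: eq_bigr => i _.
    by rewrite /Gh; lra.
  by rewrite h1 h2 mulr0 subr0 mulr0.
exact: (neumann_divergence oO OB dGi mGh mH C0 GC DGC (fun i => ctnP (@cGh i)) GhE GhC Gn charts).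
Qed.

(** In terms of the extensions the density is continuous up to the boundary; this is the form in
    which the dissipation is followed down to time 0. *)
Lemma dissipationE : dissipation Omega u w =
  (\int[mu]_(x in Omega) \sum_i u x * (ru i x / u x - rw i x) ^+ 2)%R.
Proof.
apply: eq_Rintegral => x; rewrite inE => Ox.
rewrite /enorm sqr_sqrtr ?dotvv_ge0// /dotv mulr_sumr; apply: eq_bigr => i _.
by rewrite mxE -expr2 /pderiv (@derive_val _ _ _ _ _ _ _ (@dV i x Ox)).
Qed.

(** Pointwise [divG G] is [D + L], with [D] the dissipation density and [L] the integrand of the
    left-hand side, and the integral of [divG G] is 0. *)
Lemma dissipation_identity :
  (\int[mu]_(x in Omega) ((ln (u x) - w x) *
     (laplacian u x - divergence (fun y => u y *: grad w y) x)))%R = - dissipation Omega u w.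
Proof.
pose D x := \sum_i u x * (ru i x / u x - rw i x) ^+ 2.
pose L x := (ln (u x) - w x) * \sum_i (suu i x - (ru i x * rw i x + u x * sww i x)).
have cD : ctn D.
  move=> x clx; apply: cvg_sumr => i; apply: cvgM; first exact: cu.
  by apply: cvgM; exact: cgradV.
have cL : ctn L.
  by move=> x clx; apply: cvgM; [exact: cV|apply: cvg_sumr => i; exact: cS].
have iD := ctn_integrable cD; have iL := ctn_integrable cL.
rewrite dissipationE -/D.
have -> : (\int[mu]_(x in Omega) ((ln (u x) - w x) *
     (laplacian u x - divergence (fun y => u y *: grad w y) x)))%R = (\int[mu]_(x in Omega) L x)%R.
  apply: eq_Rintegral => x; rewrite inE => Ox; congr (_ * _).
  rewrite /laplacian /divergence -sumrB; apply: eq_bigr => i _.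
  have -> : (fun y => grad u y 0 i) = pderiv i u by apply/funext => y; rewrite mxE.
  have -> : (fun y => (u y *: grad w y) 0 i) = (fun y => u y * pderiv i w y).
    by apply/funext => y; rewrite !mxE.
  rewrite suE//; congr (_ - _).
  have h1 := line (@du i x Ox); have h2 := line (@ddw i x Ox).
  have h : is_derive x (evec i) (fun y => u y * pderiv i w y) (ru i x * rw i x + u x * sww i x).
    apply: is_derive_along; apply: is_derive_eq.
    by rewrite scale0r addr0 ruE// swE// rwE// /GRing.scale/=; lra.
  by rewrite /pderiv (@derive_val _ _ _ _ _ _ _ h).
have := int_divG.
have -> : (\int[mu]_(x in Omega) divG G x)%R = (\int[mu]_(x in Omega) (D x + L x))%R.
  apply: eq_Rintegral => x; rewrite inE => Ox.
  rewrite /divG /D /L mulr_sumr -big_split/=; apply: eq_bigr => i _.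
  rewrite /pderiv (@derive_val _ _ _ _ _ _ _ (@dG i x Ox)) /H.
  congr (_ + _); rewrite expr2 mulrCA; congr (_ * _); rewrite mulrBr mulrCA mulfV ?mulr1//.
  by rewrite gt_eqF//; apply: u_gt0; exact: subset_closure.
by rewrite (RintegralD mO iD iL) => /eqP; rewrite addrC addr_eq0 => /eqP.
Qed.
End dissipation.

Lemma bounded_sub_cube (R : realType) (n : nat) (A : set 'rV[R]_n) : bounded_set A ->
  exists B, A `<=` cube 0 B.
Proof.
move=> [M [_ hM]]; exists (M + 1) => x Ax; rewrite /cube/= subr0.
by apply: (hM (M + 1)); rewrite ?ltrDl.
Qed.

(** The integral depends continuously on the time down to 0. This carries identities from positive
    times to the initial time. *)
Lemma cyl_Rintegral_eq0 (R : realType) (d : nat) (Omega : set 'rV[R]_d) (B : R)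
    (f : 'rV[R]_d -> R -> R) : open Omega -> Omega `<=` cube 0 B -> cyl_continuous Omega f ->
  (forall t, 0 < t -> (\int[lebesgue_rV d]_(x in Omega) f x t)%R = 0) ->
  forall t, 0 <= t -> (\int[lebesgue_rV d]_(x in Omega) f x t)%R = 0.
Proof.
move=> oO OB cf f0 t; rewrite le_eqVlt => /predU1P[<-|]; last exact: f0.
apply/eqP; rewrite -normr_le0; apply/ler_addgt0Pr => e e0; rewrite add0r.
have [del d0 h] := cyl_Rintegral_cvg oO OB cf (lexx 0) e0.
by have := h del (ltW d0); rewrite f0// subr0 sub0r normrN gtr0_norm//; apply.
Qed.

(** * Symmetry of the interaction energy at all times, including 0 *)

Section symmetry.
Context {R : realType} {d : nat}.
Local Notation E := 'rV[R]_d.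
Local Notation mu := (lebesgue_rV d).
Variables (Omega : set E) (B s : R) (lambda : nat -> R) (psi : nat -> E -> R).
Hypothesis oO : open Omega.
Hypothesis OB : Omega `<=` cube 0 B.
Hypothesis psi2 : forall k, in_Lp Omega 2%:E (psi k).
Variables rho c : E -> R -> R.
Hypothesis crho : cyl_continuous Omega rho.
Hypothesis cc : cyl_continuous Omega c.
Hypothesis pot : forall t, 0 < t -> frac_neumann_laplacian Omega lambda psi s (c^~ t)
      (fun x => - mean_free Omega (rho^~ t) x).

Let mO : measurable Omega. Proof. exact: measurable_open_rV. Qed.

Let ii t t' : 0 <= t -> 0 <= t' ->
  mu.-integrable Omega (EFin \o (fun x => c x t' * rho x t)).
Proof.
move=> t0 t'0.
exact: (cyl_integrable oO OB (cyl_continuousM (cyl_continuous_at t'0 cc) crho) t0).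
Qed.

(** The average subtracted from [rho] multiplies the integral of [c], which is 0; what remains is
    the symmetry of the fractional Laplacian. *)
Let sym_gt0 t t' : 0 < t -> 0 < t' ->
  (\int[mu]_(x in Omega) (c x t' * rho x t))%R = (\int[mu]_(x in Omega) (c x t * rho x t'))%R.
Proof.
have h a b : 0 < a -> 0 < b -> inner Omega (fun x => - mean_free Omega (rho^~ a) x) (c^~ b) =
    - (\int[mu]_(x in Omega) (c x b * rho x a))%R.
  move=> a0 b0.
  have i1 := ii (ltW a0) (ltW b0).
  have i2 := cyl_integrable oO OB cc (ltW b0).
  have i3 := integrable_funZ mO (average Omega (rho^~ a)) i2.
  have i4 := integrable_funZ mO (-1) i1.
  have -> : inner Omega (fun x => - mean_free Omega (rho^~ a) x) (c^~ b) =
      (\int[mu]_(x in Omega) ((-1) * (c x b * rho x a) + average Omega (rho^~ a) * c x b))%R.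
    by apply: eq_Rintegral => x _; rewrite /mean_free; lra.
  rewrite (RintegralD mO i4 i3) (RintegralZl _ mO i1) (RintegralZl _ mO i2).
  by rewrite (frac_mean_zero (pot b0)) mulr0 addr0 mulN1r.
move=> t0 t'0; apply: oppr_inj; rewrite -h// -h//.
exact: (frac_inner_sym mO psi2 (pot t0) (pot t'0)).
Qed.

Let Phi t' x t := c x t' * rho x t - c x t * rho x t'.

Let cPhi t' : 0 <= t' -> cyl_continuous Omega (Phi t').
Proof.
move=> t'0; apply: cyl_continuousB; apply: cyl_continuousM => //; exact: cyl_continuous_at.
Qed.

Let intPhi t t' : 0 <= t -> 0 <= t' -> (\int[mu]_(x in Omega) Phi t' x t)%R =
  (\int[mu]_(x in Omega) (c x t' * rho x t))%R - (\int[mu]_(x in Omega) (c x t * rho x t'))%R.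
Proof. by move=> t0 t'0; rewrite (RintegralB mO (ii t0 t'0) (ii t'0 t0)). Qed.

(** The two times are sent to 0 one after the other; the antisymmetry of [Phi] in its two times lets
    the first limit serve in the second. *)
Lemma interaction_sym t t' : 0 <= t -> 0 <= t' ->
  (\int[mu]_(x in Omega) (c x t' * rho x t))%R = (\int[mu]_(x in Omega) (c x t * rho x t'))%R.
Proof.
have h a b : 0 <= a -> 0 < b -> (\int[mu]_(x in Omega) Phi b x a)%R = 0.
  move=> a0 b0; apply: (cyl_Rintegral_eq0 oO OB (cPhi (ltW b0))) a0 => r r0.
  by rewrite intPhi ?ltW// sym_gt0// subrr.
move=> t0 t'0; apply/eqP; rewrite -subr_eq0 -intPhi//; apply/eqP.
apply: (cyl_Rintegral_eq0 oO OB (cPhi t'0)) t0 => r r0.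
have := h _ _ t'0 r0; rewrite !intPhi// ?ltW// => /eqP.
by rewrite subr_eq0 => /eqP ->; rewrite subrr.
Qed.
End symmetry.

(* At t = 0 the derivative of the energy is the right derivative. *)
Theorem lemma2p4 (R : realType) (d : nat) (s : R) (Omega : set 'rV[R]_d)
    (lambda : nat -> R) (psi : nat -> 'rV[R]_d -> R)
    (rho0 : 'rV[R]_d -> R) (rho c : 'rV[R]_d -> R -> R)
    (s_gt0 : 0 < s) (s_lt1 : s < 1)
    (domain_Omega : bounded_lipschitz_domain Omega)
    (spectrum_Omega : neumann_spectrum Omega lambda psi)
    (rho0_bounded : in_Lp Omega +oo%E rho0)
    (rho0_ge0 : {ae lebesgue_rV d, forall x, Omega x -> 0 <= rho0 x})
    (rho0_mean : average Omega rho0 = 1)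
    (rho_ge0 : forall x t, Omega x -> 0 <= t -> 0 <= rho x t)
    (solution : smooth_solution Omega lambda psi s rho0 rho c) :
  forall t, 0 <= t ->
    let energy_at t := energy Omega (rho^~ t) (c^~ t) in
    (h^-1 * (energy_at (t + h) - energy_at t)
       @[h --> within [set h | 0 <= t + h] (0 : R)^'] -->
     - dissipation Omega (rho^~ t) (c^~ t)) /\
    - dissipation Omega (rho^~ t) (c^~ t) <= 0.
Proof.
have oO := domain_open domain_Omega.
have charts := domain_lipschitz domain_Omega.
have [B OB] := bounded_sub_cube (domain_bounded domain_Omega).
have mO : measurable Omega by exact: measurable_open_rV.
have psi2 k : in_Lp Omega 2%:E (psi k).
  by have [g /H1_L2] := spectrum_eigen spectrum_Omega k.
have SR := sol_rho_space solution; have SC := sol_c_space solution.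
have ST := sol_rho_time solution.
have crho : cyl_continuous Omega rho by apply/cyl_continuousP; exact: C2_continuous SR.
have cc : cyl_continuous Omega c by apply/cyl_continuousP; exact: C2_continuous SC.
have rho_gt0 := sol_rho_pos solution.
(* [gt] extends the time derivative of [rho] continuously to time 0 and to the boundary. *)
have [gt cgt gtE] := up_to_closure_ext0 (f := fun x t => 'D_1 (rho x) t) (C1_continuous ST).
have first u : C2_space Omega u -> exists ru, forall i, cyl_continuous Omega (ru i) /\
    forall x t, Omega x -> 0 <= t -> pderiv i (u^~ t) x = ru i x t.
  move=> Su; have h i : exists g, cyl_continuous Omega g /\
      forall x t, Omega x -> 0 <= t -> pderiv i (u^~ t) x = g x t.
    by have [g cg gE] := up_to_closure_ext
    (f := fun x t => pderiv i (u^~ t) x) (C2_continuous1 Su i); exists g.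
  by have [f hf] := choice h; exists f.
have second u : C2_space Omega u -> exists su, forall i, cyl_continuous Omega (su i) /\
    forall x t, Omega x -> 0 <= t -> pderiv i (pderiv i (u^~ t)) x = su i x t.
  move=> Su; have h i : exists g, cyl_continuous Omega g /\
      forall x t, Omega x -> 0 <= t -> pderiv i (pderiv i (u^~ t)) x = g x t.
    by have [g cg gE] := up_to_closure_ext
    (f := fun x t => pderiv i (pderiv i (u^~ t)) x) (C2_continuous2 Su i i); exists g.
  by have [f hf] := choice h; exists f.
have [ru hru] := first _ SR; have [rw hrw] := first _ SC.
have [su hsu] := second _ SR; have [sw hsw] := second _ SC.
have drho x (t : R) : Omega x -> 0 < t -> is_derive t (1 : R) (rho x) (gt x t).
  move=> Ox t0; rewrite -gtE//.
  by split => //; exact: C1_derivable ST _ _ Ox t0.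
have sym := interaction_sym oO OB psi2 crho cc (sol_potential solution).
(* The dissipation density on the closed cylinder, written with the extended gradients. *)
pose D x t := \sum_i rho x t * (ru i x t / rho x t - rw i x t) ^+ 2.
have cD : cyl_continuous Omega D.
  apply: cyl_continuous_sum => i; apply: cyl_continuousM => //.
  have cg : cyl_continuous Omega (fun x t => ru i x t / rho x t - rw i x t).
    apply: cyl_continuousB; last exact: (hrw i).1.
    apply: cyl_continuousM; first exact: (hru i).1.
    by move=> p [p1 p2]; apply: cvgV; [rewrite gt_eqF// rho_gt0|exact: crho].
  exact: cyl_continuousM.
have DE t : 0 <= t -> dissipation Omega (rho^~ t) (c^~ t) =
    (\int[lebesgue_rV d]_(x in Omega) D x t)%R.
  move=> t0; apply: dissipationE.
  - by move=> x clx; exact: rho_gt0.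
  - by move=> i x Ox; exact: C2_derivable1 SR _ _ _ Ox t0.
  - by move=> i x Ox; exact: C2_derivable1 SC _ _ _ Ox t0.
  - by move=> i x Ox; exact: (hru i).2.
  - by move=> i x Ox; exact: (hrw i).2.
have cW : cyl_continuous Omega (fun x t => (ln (rho x t) - c x t) * gt x t).
  apply: cyl_continuousM => //; apply: cyl_continuousB => //.
  exact: cyl_ln crho rho_gt0.
have slice f t : cyl_continuous Omega f -> 0 <= t -> forall x, closure Omega x ->
    f y t @[y --> within (closure Omega) (nbhs x)] --> f x t.
  by move=> cf t0; apply/subspace_continuousP; exact: cyl_slice.
have W_gt0 t : 0 < t -> (\int[lebesgue_rV d]_(x in Omega) ((ln (rho x t) - c x t) * gt x t))%R =
    - dissipation Omega (rho^~ t) (c^~ t).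
  move=> t0; have t_0 := ltW t0.
  rewrite -(dissipation_identity oO OB charts (ru := fun i x => ru i x t)
    (rw := fun i x => rw i x t) (suu := fun i x => su i x t) (sww := fun i x => sw i x t)).
  - apply: eq_Rintegral => x; rewrite inE => Ox.
    by rewrite -gtE// (sol_evolution solution).
  - exact: slice.
  - exact: slice.
  - by move=> x clx; exact: rho_gt0.
  - by move=> i; apply: slice (hru i).1 t_0.
  - by move=> i; apply: slice (hrw i).1 t_0.
  - by move=> i; apply: slice (hsu i).1 t_0.
  - by move=> i; apply: slice (hsw i).1 t_0.
  - by move=> i x Ox; exact: C2_derivable1 SR _ _ _ Ox t_0.
  - by move=> i x Ox; exact: C2_derivable1 SC _ _ _ Ox t_0.
  - by move=> i x Ox; exact: (hru i).2.
  - by move=> i x Ox; exact: (hrw i).2.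
  - by move=> i x Ox; exact: C2_derivable2 SR _ _ _ _ Ox t_0.
  - by move=> i x Ox; exact: C2_derivable2 SC _ _ _ _ Ox t_0.
  - by move=> i x Ox; exact: (hsu i).2.
  - by move=> i x Ox; exact: (hsw i).2.
  - exact: sol_rho_neumann solution _ t0.
  - exact: sol_c_neumann solution _ t0.
have sumE t : 0 <= t -> (\int[lebesgue_rV d]_(x in Omega) ((ln (rho x t) - c x t) * gt x t + D x t))%R =
    (\int[lebesgue_rV d]_(x in Omega) ((ln (rho x t) - c x t) * gt x t))%R +
    dissipation Omega (rho^~ t) (c^~ t).
  move=> t0; have i1 := cyl_integrable oO OB cW t0; have i2 := cyl_integrable oO OB cD t0.
  by rewrite DE// -(RintegralD mO i1 i2).
have WE t : 0 <= t -> (\int[lebesgue_rV d]_(x in Omega) ((ln (rho x t) - c x t) * gt x t))%R =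
    - dissipation Omega (rho^~ t) (c^~ t).
  move=> t0; apply/eqP; rewrite -addr_eq0 -sumE//; apply/eqP.
  (* The identity is the vanishing of the integral of a single function continuous on the closed
     cylinder; known for positive times, it extends to [t = 0]. *)
  apply: (cyl_Rintegral_eq0 oO OB (cyl_continuousD cW cD)) t0 => r r0.
  by rewrite sumE ?ltW// W_gt0// addNr.
move=> t t0 energy_at; split.
  by rewrite -WE//; exact: (energy_is_derive oO OB crho cc cgt rho_gt0 drho sym t0).
rewrite oppr_le0; apply: Rintegral_ge0 => x Ox.
by rewrite mulr_ge0 ?sqr_ge0// rho_ge0.
Qed.
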